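(* Let $1\le p<q<\infty$ and $2\le r\le\infty$, and let $E$ be a Banach space. (1) If $1\le s\le2$ and $p\ge2$, then $\mathcal K_q(\overline{\ell}_r,\overline{\ell}_s)\setminus\mathcal K_p(\overline{\ell}_r,\overline{\ell}_s)$ is empty, while $\mathcal P_{\mathcal K_q}(^kE,\overline{\ell}_s)\setminus\mathcal P_{\mathcal K_p}(^kE,\overline{\ell}_s)$ (for every integer $k\ge2$) and $\mathrm{Lip}_{0,\mathcal K_q}(E,\overline{\ell}_s)\setminus\mathrm{Lip}_{0,\mathcal K_p}(E,\overline{\ell}_s)$ are $\overline{\ell}_s$-spaceable. (2) If $2\le s\le\infty$ and $q>2$, then $\mathcal K_q(\overline{\ell}_r,\overline{\ell}_s)\setminus\mathcal K_p(\overline{\ell}_r,\overline{\ell}_s)$ is empty, while $\mathcal P_{\mathcal K_q}(^kE,\overline{\ell}_s)\setminus\mathcal P_{\mathcal K_p}(^kE,\overline{\ell}_s)$ (for every integer $k\ge2$) and $\mathrm{Lip}_{0,\mathcal K_q}(E,\overline{\ell}_s)\setminus\mathrm{Lip}_{0,\mathcal K_p}(E,\overline{\ell}_s)$ are $\overline{\ell}_s$-spaceable.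
   Context: Banach spaces are over $\mathbb K=\mathbb R$ or $\mathbb C$; $B_E$ is the open unit ball of $E$; $\overline{\ell}_s=\ell_s$ if $s<\infty$ and $\overline{\ell}_\infty=c_0$. For $1\le p<\infty$ with conjugate index $p'$, a set $K$ in a Banach space $F$ is (relatively) $p$-compact if there is a sequence $(x_n)_n$ in $F$ with $\sum_n\|x_n\|^p<\infty$ and $K\subset\{\sum_n\alpha_nx_n:(\alpha_n)_n\in B_{\ell_{p'}}\}$; $m_p(K;F)$ is the infimum of $(\sum_n\|x_n\|^p)^{1/p}$ over all such sequences. $\mathcal K_p(E,F)$ is the space of bounded linear $T:E\to F$ with $T(B_E)$ $p$-compact. A $k$-homogeneous polynomial $P:E\to F$ is a map $P(x)=\widehat P(x,\dots,x)$ with $\widehat P$ a continuous symmetric $k$-linear map; it is $p$-compact if $P(B_E)$ is $p$-compact; $\mathcal P_{\mathcal K_p}(^kE,F)$ is the Banach space of these with norm $m_p(P(B_E);F)$. $\mathrm{Lip}_{0,\mathcal K_p}(E,F)$ is the Banach space of Lipschitz maps $f:E\to F$ with $f(0)=0$ for which $D_f:=\{\frac{f(x)-f(y)}{\|x-y\|}:x\neq y\}$ is $p$-compact, with norm $m_p(D_f;F)$. A subset $A$ of a Banach space $X$ is $\mathcal S$-spaceable, for a Banach space $\mathcal S$, if $A\cup\{0\}$ contains a linear subspace of $X$ isomorphic to $\mathcal S$; here the ambient spaces are $\mathcal P_{\mathcal K_q}(^kE,\overline{\ell}_s)$ and $\mathrm{Lip}_{0,\mathcal K_q}(E,\overline{\ell}_s)$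 with their norms.
   Formalization: E is assumed infinite-dimensional for the polynomial claims and non-zero for the Lipschitz claims; for finite-dimensional E (resp. E = {0}) the difference sets are empty, so they cannot be spaceable. *)

(* Defs.v *)
From HB Require Import structures.
From mathcomp Require Import all_boot all_order all_algebra all_fingroup.
From mathcomp Require Import complex.
From mathcomp Require Import all_classical all_reals all_analysis ess_sup_inf.
From mathcomp Require Import lra.

Set Implicit Arguments.
Unset Strict Implicit.
Unset Printing Implicit Defensive.
Import Order.TTheory GRing.Theory Num.Theory.
Import numFieldNormedType.Exports.
Local Open Scope classical_set_scope.
Local Open Scope ring_scope.

(* The scalar field is R or R[i]; norms of normed modules over R[i] take values
   in R[i], and rnorm below is the same norm with values in R. *)
Inductive scalar_kind := real_scalars | complex_scalars.

Definition scalar_field (R : realType) (k : scalar_kind) : numFieldType :=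
  match k with
  | real_scalars => R
  | complex_scalars => R[i]%C
  end.

Definition real_part (R : realType) (k : scalar_kind) : scalar_field R k -> R :=
  match k with
  | real_scalars => fun z => z
  | complex_scalars => fun z => complex.Re z
  end.

Definition of_real (R : realType) (k : scalar_kind) : R -> scalar_field R k :=
  match k with
  | real_scalars => fun t => t
  | complex_scalars => fun t => (t%:C)%C
  end.

Arguments real_part {R k} z.
Arguments of_real {R} k t.

Section scalars.
Variables (R : realType) (k : scalar_kind).
Local Notation K := (scalar_field R k).
Local Notation ofR := (@of_real R k).

Lemma of_realK t : real_part (ofR t) = t.
Proof. by case: k. Qed.

Lemma real_partK (z : K) : 0 <= z -> ofR (real_part z) = z.
Proof.
by move=> z0; rewrite /of_real /real_part; case: k z z0 => //= z z0; exact/RRe_real/ger0_real.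
Qed.

Lemma of_real_le a b : (ofR a <= ofR b) = (a <= b).
Proof. by rewrite /of_real; case: k => //=; rewrite lecR. Qed.

Lemma of_realD a b : ofR (a + b) = ofR a + ofR b.
Proof. by rewrite /of_real; case: k => //=; rewrite rmorphD. Qed.

Lemma of_realM a b : ofR (a * b) = ofR a * ofR b.
Proof. by rewrite /of_real; case: k => //=; rewrite rmorphM. Qed.

Lemma of_real0 : ofR 0 = 0.
Proof. by rewrite /of_real; case: k. Qed.

Lemma of_real1 : ofR 1 = 1.
Proof. by rewrite /of_real; case: k. Qed.

Lemma of_real_inj : injective ofR.
Proof. by move=> a b ab; rewrite -(of_realK a) ab of_realK. Qed.

Definition rnorm (V : normedModType K) (x : V) : R := real_part `|x|.

Section rnorm.
Variable V : normedModType K.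
Implicit Types x y : V.

Lemma rnormE x : ofR (rnorm x) = `|x|.
Proof. exact: real_partK. Qed.

Lemma rnorm_ge0 x : 0 <= rnorm x.
Proof. by rewrite -of_real_le of_real0 rnormE. Qed.

Lemma rnormD x y : rnorm (x + y) <= rnorm x + rnorm y.
Proof. by rewrite -of_real_le of_realD !rnormE ler_normD. Qed.

Lemma rnorm0 : rnorm (0 : V) = 0.
Proof. by apply: of_real_inj; rewrite rnormE of_real0 normr0. Qed.

Lemma rnorm0_eq0 x : rnorm x = 0 -> x = 0.
Proof.
by move=> x0; apply/eqP; rewrite -normr_eq0 -rnormE x0 of_real0.
Qed.

Lemma rnormN x : rnorm (- x) = rnorm x.
Proof. by apply: of_real_inj; rewrite !rnormE normrN. Qed.

End rnorm.

Lemma rnormZ (V : normedModType K) (a : K) (x : V) :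
  rnorm (a *: x) = rnorm a * rnorm x.
Proof. by apply: of_real_inj; rewrite of_realM !rnormE normrZ. Qed.

Lemma rnorm1 : rnorm (1 : K) = 1.
Proof. by apply: of_real_inj; rewrite rnormE of_real1 normr1. Qed.

Lemma rnormB (V : normedModType K) (x y : V) : rnorm (x - y) = rnorm (y - x).
Proof. by rewrite -rnormN opprB. Qed.

Lemma of_real_gt0 e : (0 < ofR e) = (0 < e).
Proof. by rewrite !lt_def -of_real0 of_real_le (inj_eq of_real_inj). Qed.

Lemma real_part_gt0 (e : K) : 0 < e -> 0 < real_part e.
Proof. by move=> e0; rewrite -of_real_gt0 real_partK// ltW. Qed.

Lemma cvg_rnormP (V : normedModType K) (F : set_system V) (l : V) :
  Filter F -> F --> l <-> forall e : R, 0 < e -> F [set y | rnorm (l - y) <= e].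
Proof.
move=> FF; split=> [/cvgrPdist_le Fl e|Fl].
  rewrite -of_real_gt0 => /Fl; apply: filterS => y /=.
  by rewrite -of_real_le rnormE.
apply/cvgrPdist_le => e e0; apply: filterS (Fl _ (real_part_gt0 e0)) => y /=.
by rewrite -of_real_le rnormE (real_partK (ltW e0)).
Qed.

Lemma cauchy_rnormP (V : normedModType K) (F : set_system V) :
  ProperFilter F -> cauchy F <->
  forall e : R, 0 < e -> exists x, F [set y | rnorm (x - y) <= e].
Proof.
move=> FF; split=> [/cauchyP Fc e|Fc].
  rewrite -of_real_gt0 => /Fc[x Fx]; exists x; apply: filterS Fx => y.
  by rewrite -ball_normE /= => /ltW; rewrite -of_real_le rnormE.
apply/cauchyP => e e0; have e20 : 0 < e / 2 by rewrite divr_gt0.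
have [x Fx] := Fc _ (real_part_gt0 e20); exists x; apply: filterS Fx => y /=.
rewrite -of_real_le rnormE (real_partK (ltW e20)) -ball_normE /=.
by move=> /le_lt_trans; apply; rewrite ltr_pdivrMr// ltr_pMr ?ltr1n.
Qed.

End scalars.
Arguments rnorm {R k V} x.

Lemma scalar_complete (R : realType) (k : scalar_kind)
  (F : set_system (scalar_field R k)) : ProperFilter F -> cauchy F -> cvg F.
Proof.
case: k F => F; first exact: R_complete.
move=> FF /cauchy_rnormP Fc.
have rn (z : scalar_field R complex_scalars) :
    rnorm z = Num.sqrt ((complex.Re z)^+2 + (complex.Im z)^+2).
  by rewrite /rnorm normc_def.
have comp (g : scalar_field R complex_scalars -> R) : (forall z, `|g z| <= rnorm z) ->
    (forall x y, g (x - y) = g x - g y) -> cvg (g @ F).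
  move=> gle gB; apply: R_complete; apply/cauchy_exP => e e0.
  have [//|x Fx] := Fc (e / 2); first by rewrite divr_gt0.
  exists (g x); rewrite /= nbhs_simpl /=; apply: filterS Fx => y /=.
  rewrite -ball_normE/= -gB => /(le_trans (gle _)) /le_lt_trans; apply.
  by rewrite ltr_pdivrMr// ltr_pMr ?ltr1n.
have /cvg_ex[a Fa] : cvg (@complex.Re R @ F).
  apply: comp => [z|[? ?] [? ?]//].
  by rewrite rn -sqrtr_sqr ler_wsqrtr// lerDl sqr_ge0.
have /cvg_ex[b Fb] : cvg (@complex.Im R @ F).
  apply: comp => [z|[? ?] [? ?]//].
  by rewrite rn -sqrtr_sqr ler_wsqrtr// lerDr sqr_ge0.
apply/cvg_ex; exists (Complex a b : scalar_field R complex_scalars).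
apply/cvg_rnormP => e e0.
have e20 : 0 < e / 2 by rewrite divr_gt0.
move/cvgrPdist_le : Fa => /(_ _ e20) Fa; move/cvgrPdist_le : Fb => /(_ _ e20) Fb.
have : F [set z | `|a - complex.Re z| <= e / 2 /\ `|b - complex.Im z| <= e / 2].
  exact: filterI.
apply: filterS => -[x y] [/= ax byy].
rewrite -(ger0_norm (ltW e0)) -sqrtr_sqr ler_wsqrtr//.
have sq (t : R) : `|t| <= e / 2 -> t ^+ 2 <= (e / 2) ^+ 2.
  by move=> te; rewrite -real_normK ?num_real// lerXn2r ?nnegrE// ltW.
apply: le_trans (lerD (sq _ ax) (sq _ byy)) _.
by rewrite {3}(splitr e); have := sqr_ge0 (e / 2); lra.
Qed.

Section seq_norm.
Variables (R : realType) (k : scalar_kind).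
Local Notation K := (scalar_field R k).

(* the l_s norm; the sup norm for s = +oo *)
Definition seq_norm (V : normedModType K) (s : \bar R) (x : nat -> V) : \bar R :=
  Lnorm (@counting nat R) s (fun n => (rnorm (x n))%:E).

Lemma ess_sup_countingP (f : nat -> \bar R) y :
  (ess_sup (@counting nat R) f <= y)%E <-> forall n, (f n <= y)%E.
Proof.
split=> [/ess_supP [A [_ A0 fA]] n|fy]; last by apply/ess_supP/nearW.
case: (pselect (f n <= y)%E) => // /fA An; exfalso.
move: A0; apply/eqP; rewrite gt_eqF//.
apply: (@lt_le_trans _ _ (@counting nat R [set n])).
  by rewrite /counting asboolT// fset_set1 finmap.cardfs1 lte_fin.
by apply: le_measure; rewrite ?inE// => _ ->.
Qed.

Lemma counting_setT_gt0 : (0 < @counting nat R setT)%E.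
Proof.
by rewrite /counting asboolF ?lt0y// => /infinite_nat.
Qed.

Lemma le_poweR (x y : \bar R) r : 0 <= r -> (0 <= x)%E -> (x <= y)%E ->
  (x `^ r <= y `^ r)%E.
Proof.
move=> r0 x0 xy; have y0 := le_trans x0 xy.
by apply: gt0_ler_poweR => //; rewrite in_itv/= leey ?x0 ?y0.
Qed.

Variable s : \bar R.
Hypothesis s1 : (1 <= s)%E.

Lemma le_Lnorm_counting (f g : nat -> \bar R) :
  (forall n, `|f n| <= `|g n|)%E ->
  (Lnorm (@counting nat R) s f <= Lnorm (@counting nat R) s g)%E.
Proof.
move=> fg; case: s s1 => [r r1| |//].
  have r0 : 0 < r by rewrite -lte_fin (lt_le_trans _ r1)// lte_fin.
  rewrite !Lnorm_counting//; apply: le_poweR.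
  - by rewrite invr_ge0 ltW.
  - by apply: nneseries_ge0 => *; rewrite poweR_ge0.
  apply: lee_nneseries => n _ *; first by rewrite poweR_ge0.
  by apply: le_poweR; [exact: ltW|exact: abse_ge0|].
rewrite unlock /Lnorm counting_setT_gt0 => _.
by apply/ess_sup_countingP => n /=; apply: (le_trans (fg n)); move: n; apply/ess_sup_countingP.
Qed.

Section V.
Variable V : normedModType K.
Implicit Types x y : nat -> V.

Lemma seq_norm_ge0 x : (0 <= seq_norm s x)%E.
Proof. exact: Lnorm_ge0. Qed.

Lemma seq_normD x y : (seq_norm s (x + y)%R <= seq_norm s x + seq_norm s y)%E.
Proof.
have mf (f : nat -> R) : measurable_fun setT f by [].
apply: le_trans (eminkowski _ (mf (rnorm \o x)) (mf (rnorm \o y)) s1).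
apply: le_Lnorm_counting => n /=; rewrite lee_fin !ger0_norm ?rnorm_ge0 ?addr_ge0 ?rnorm_ge0//.
exact: rnormD.
Qed.

Lemma seq_norm0 : seq_norm s (0 : nat -> V) = 0%E.
Proof.
rewrite /seq_norm -[RHS](@Lnorm0 _ _ _ (@counting nat R) s) ?gt_eqF ?(lt_le_trans _ s1)//.
by apply: eq_Lnorm => n /=; rewrite rnorm0.
Qed.

Lemma le_seq_norm x y : (forall n, rnorm (x n) <= rnorm (y n)) ->
  (seq_norm s x <= seq_norm s y)%E.
Proof.
by move=> xy; apply: le_Lnorm_counting => n /=; rewrite lee_fin !ger0_norm ?rnorm_ge0.
Qed.

Lemma seq_norm_delta n (v : V) :
  seq_norm s (fun m => if m == n then v else 0) = (rnorm v)%:E.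
Proof.
rewrite /seq_norm; case: s s1 => [r r1| |//].
  have r0 : 0 < r by rewrite -lte_fin (lt_le_trans _ r1)// lte_fin.
  rewrite Lnorm_counting// (@nneseriesD1 _ _ n)//; last by move=> *; rewrite poweR_ge0.
  rewrite eseries0 ?adde0; last first.
    move=> i _ /= /negPf ->.
    by rewrite rnorm0 normr0 powR0// gt_eqF.
  rewrite /= eqxx ger0_norm ?rnorm_ge0// -powRrM mulfV ?gt_eqF//.
  by rewrite powRr1 ?rnorm_ge0.
rewrite unlock /Lnorm counting_setT_gt0 => _.
apply/eqP; rewrite eq_le; apply/andP; split.
  apply/ess_sup_countingP => m /=; rewrite lee_fin ger0_norm ?rnorm_ge0//.
  by case: ifP => //; rewrite rnorm0 rnorm_ge0.
rewrite [leLHS](_ : _ = `|(rnorm (if n == n then v else 0))%:E|)%E; last first.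
  by rewrite eqxx gee0_abs ?lee_fin ?rnorm_ge0.
pose f := (abse \o (fun m => (rnorm (if m == n then v else 0))%:E)).
have := ess_sup_countingP f (ess_sup (@counting nat R) f).
by rewrite lexx => -[/(_ erefl n)].
Qed.

Lemma rnorm_le_seq_norm x n : ((rnorm (x n))%:E <= seq_norm s x)%E.
Proof.
rewrite -(seq_norm_delta n); apply: le_seq_norm => m.
by case: eqP => [->|]; rewrite ?rnorm0 ?rnorm_ge0.
Qed.

Lemma seq_normZ (a : K) x :
  (seq_norm s (a *: x)%R <= (rnorm a)%:E * seq_norm s x)%E.
Proof.
have a0 := rnorm_ge0 a.
rewrite /seq_norm; case: s s1 => [r r1| |//].
  have r0 : 0 < r by rewrite -lte_fin (lt_le_trans _ r1)// lte_fin.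
  rewrite !Lnorm_counting//= [X in (X `^ _)%E](_ : _ =
      ((rnorm a `^ r)%:E * \sum_(n <oo) (`|rnorm (x n)| `^ r)%:E)%E); last first.
    rewrite -nneseriesZl; last by move=> i _; rewrite lee_fin powR_ge0.
    apply: eq_eseriesr => n _; rewrite -EFinM rnormZ normrM (ger0_norm a0).
    by rewrite powRM.
  rewrite poweRM ?lee_fin ?powR_ge0//; last first.
    by apply: nneseries_ge0 => n _ _; rewrite lee_fin powR_ge0.
  by rewrite poweR_EFin -powRrM mulfV ?gt_eqF// powRr1.
rewrite unlock /Lnorm counting_setT_gt0 => _.
apply/ess_sup_countingP => n /=; rewrite rnormZ normrM EFinM (ger0_norm a0).
apply: lee_wpmul2l; first by rewrite lee_fin.
pose f := (abse \o (fun m => (rnorm (x m))%:E)).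
have := ess_sup_countingP f (ess_sup (@counting nat R) f).
by rewrite lexx => -[/(_ erefl n)].
Qed.

Lemma seq_normN x : seq_norm s (- x) = seq_norm s x.
Proof. by apply: eq_Lnorm => n /=; rewrite rnormN. Qed.

Lemma seq_norm_trunc_le x N (d : R) :
  (forall n, (n < N)%N -> rnorm (x n) <= d) ->
  (seq_norm s (fun n => if (n < N)%N then x n else 0%R) <= (d * N%:R)%:E)%E.
Proof.
elim: N => [|N IH] xd; first by rewrite mulr0 [X in (X <= _)%E]seq_norm0.
rewrite [X in seq_norm s X](_ : _ = (fun n => if (n < N)%N then x n else 0) +
    (fun n => if n == N then x N else 0)); last first.
  apply/funext => n; rewrite /GRing.add /= ltnS leq_eqVlt.
  by case: eqP => [->|_]; rewrite ?ltnn/= ?add0r ?addr0.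
apply: le_trans (seq_normD _ _) _; rewrite seq_norm_delta -natr1 mulrDr mulr1.
rewrite EFinD; apply: leeD; last by rewrite lee_fin xd.
by apply: IH => n nN; rewrite xd// ltnS ltnW.
Qed.

Lemma seq_norm_trunc x (c : \bar R) :
  (forall N, seq_norm s (fun n => if (n < N)%N then x n else 0%R) <= c)%E ->
  (seq_norm s x <= c)%E.
Proof.
rewrite /seq_norm; case: s s1 => [r r1|_|//] H.
  have r0 : 0 < r by rewrite -lte_fin (lt_le_trans _ r1)// lte_fin.
  have rn0 : r != 0 by rewrite gt_eqF.
  have c0 : (0 <= c)%E := le_trans (Lnorm_ge0 _ _ _) (H 0%N).
  suff S : (\sum_(n <oo) `|(rnorm (x n))%:E| `^ r <= c `^ r)%E.
    rewrite Lnorm_counting// -[leRHS]poweRe1// -(mulfV rn0) poweRrM.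
    apply: le_poweR => //; first by rewrite invr_ge0 ltW.
    by apply: nneseries_ge0 => *; rewrite poweR_ge0.
  apply: lime_le; first by apply: is_cvg_nneseries => *; rewrite poweR_ge0.
  apply: nearW => N.
  have HN : (0 <= Lnorm (@counting nat R) r%:E
      (fun n => (rnorm (if (n < N)%N then x n else 0%R))%:E) <= c)%E.
    by rewrite Lnorm_ge0 H.
  move: HN => /andP[_]; rewrite Lnorm_counting// => HN.
  have S0 : (0 <= \sum_(n <oo) `|(rnorm (if (n < N)%N then x n else 0%R))%:E| `^ r)%E.
    by apply: nneseries_ge0 => *; rewrite poweR_ge0.
  apply: (@le_trans _ _ (\sum_(n <oo) `|(rnorm (if (n < N)%N then x n else 0%R))%:E| `^ r)%E).
    apply: le_trans (nneseries_lim_ge N _); last by move=> *; rewrite poweR_ge0.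
    rewrite le_eqVlt; apply/orP; left; apply/eqP.
    by apply: eq_big_nat => i /andP[_ ->].
  rewrite -[leLHS]poweRe1// -(mulVf rn0) poweRrM.
  by apply: le_poweR; rewrite ?(ltW r0) ?poweR_ge0.
rewrite unlock /Lnorm counting_setT_gt0.
apply/ess_sup_countingP => n.
have := H n.+1; rewrite unlock /Lnorm counting_setT_gt0.
by move=> /ess_sup_countingP /(_ n); rewrite /= ltnSn.
Qed.

End V.
End seq_norm.

(* exponents in [1, +oo] *)
Record exponent (R : realType) := Exponent {
  exponent_val :> \bar R;
  exponent_ge1 : (1 <= exponent_val)%E }.

Section lbar.
Variables (R : realType) (k : scalar_kind) (s : exponent R).
Local Notation K := (scalar_field R k).

(* l_s for s finite, c_0 for s = +oo *)
Definition lbar_pred : {pred nat -> K} :=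
  mem [set x : nat -> K |
    if exponent_val s == +oo%E then x @ \oo --> (0 : K)
    else (seq_norm s x < +oo)%E].

Record lbar := Lbar { lbar_val :> nat -> K; _ : lbar_val \in lbar_pred }.

HB.instance Definition _ := [isSub for lbar_val].
HB.instance Definition _ := [Choice of lbar by <:].

Lemma lbar_submod_closed : submod_closed lbar_pred.
Proof.
split; rewrite ?inE /=.
  case: ifP => _; first exact: cvg_cst.
  by rewrite seq_norm0 ?exponent_ge1.
move=> a x y; rewrite !inE /=; case: ifP => _.
  move=> x0 y0; rewrite -[X in _ --> X]addr0 -[X in _ --> X + _](scaler0 _ a).
  by apply: cvgD => //; apply: cvgZr.
move=> x0 y0; apply: le_lt_trans (seq_normD _ _ _) _; first exact: exponent_ge1.
apply: lte_add_pinfty => //; apply: le_lt_trans (seq_normZ _ _ _) _.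
  exact: exponent_ge1.
by rewrite lte_mul_pinfty// lee_fin rnorm_ge0.
Qed.

HB.instance Definition _ :=
  GRing.isSubmodClosed.Build _ _ lbar_pred lbar_submod_closed.
HB.instance Definition _ := [SubChoice_isSubLmodule of lbar by <:].

Lemma lbar_fin (x : lbar) : (seq_norm s x < +oo)%E.
Proof.
case: x => x /=; rewrite inE /=; case: ifP => // /eqP -> /cvg_rnormP.
move=> /(_ _ ltr01) [N _ HN].
pose b := 1 + \sum_(i < N) rnorm (x i).
apply: (@le_lt_trans _ _ b%:E); last exact: ltry.
rewrite /seq_norm unlock /Lnorm counting_setT_gt0.
apply/ess_sup_countingP => n /=; rewrite lee_fin ger0_norm ?rnorm_ge0// /b.
have [Nn|nN] := leqP N n.
  rewrite ler_wpDr ?sumr_ge0// => [*|]; first exact: rnorm_ge0.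
  by rewrite -rnormN -(sub0r (x n)); exact: HN.
rewrite (bigD1 (Ordinal nN))//= addrCA lerDl addr_ge0// sumr_ge0// => *.
exact: rnorm_ge0.
Qed.

Definition lbar_norm (x : lbar) : R := fine (seq_norm s x).

Lemma lbar_normE x : (lbar_norm x)%:E = seq_norm s x.
Proof. by rewrite fineK// ge0_fin_numE ?seq_norm_ge0 ?lbar_fin. Qed.

Lemma lbar_normD x y :
  of_real k (lbar_norm (x + y)) <=
  of_real k (lbar_norm x) + of_real k (lbar_norm y).
Proof.
rewrite -of_realD of_real_le -lee_fin EFinD !lbar_normE.
exact/seq_normD/exponent_ge1.
Qed.

Lemma lbar_norm0_eq0 x : of_real k (lbar_norm x) = 0 -> x = 0.
Proof.
rewrite -(of_real0 R k) => /of_real_inj x0; apply/val_inj/funext => n /=.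
apply: rnorm0_eq0; apply/eqP; rewrite eq_le rnorm_ge0 andbT -lee_fin.
by rewrite (le_trans (rnorm_le_seq_norm (exponent_ge1 s) _ _))// -lbar_normE x0.
Qed.

Lemma lbar_normZ_le a x : lbar_norm (a *: x) <= rnorm a * lbar_norm x.
Proof. by rewrite -lee_fin EFinM !lbar_normE seq_normZ ?exponent_ge1. Qed.

Lemma lbar_normZ a x : of_real k (lbar_norm (a *: x)) = `|a| * of_real k (lbar_norm x).
Proof.
rewrite -rnormE -of_realM; congr of_real; apply/eqP; rewrite eq_le lbar_normZ_le/=.
have [->|a0] := eqVneq a 0.
  by rewrite rnorm0 mul0r -lee_fin lbar_normE seq_norm_ge0.
have ra : 0 < rnorm a.
  rewrite lt_def rnorm_ge0 andbT; apply: contra a0 => /eqP/rnorm0_eq0 ->//.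
rewrite mulrC -ler_pdivlMr// mulrC.
have -> : (rnorm a)^-1 = rnorm (a^-1).
  apply: (mulfI (lt0r_neq0 ra)); rewrite mulfV ?lt0r_neq0//.
  by rewrite -rnormZ -[_ *: _]/(a * _) mulfV// rnorm1.
rewrite -{1}(scale1r x) -(mulVf a0) -scalerA; exact: lbar_normZ_le.
Qed.

HB.instance Definition _ := @Lmodule_isNormed.Build K lbar
  (fun x => of_real k (lbar_norm x)) lbar_normD lbar_normZ lbar_norm0_eq0.

Lemma rnorm_lbar (x : lbar) : rnorm x = lbar_norm x.
Proof. exact: of_realK. Qed.

Lemma lbar_complete (F : set_system lbar) : ProperFilter F -> cauchy F -> cvg F.
Proof.
move=> FF /cauchy_rnormP Fc.
have s1 := exponent_ge1 s.
have coord n : cvg ((fun x : lbar => x n : K) @ F).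
  apply: scalar_complete; apply/cauchy_rnormP => e /Fc[x Fx].
  exists (x n); rewrite /= nbhs_simpl /=; apply: filterS Fx => y /=.
  apply: le_trans; rewrite rnorm_lbar -lee_fin lbar_normE.
  exact: (rnorm_le_seq_norm s1 (x - y) n).
pose l n : K := lim ((fun x : lbar => x n : K) @ F).
have lP n e : 0 < e -> F [set y : lbar | rnorm (l n - y n) <= e].
  by move=> e0; move/cvg_rnormP : (coord n) => /(_ e e0).
have dist e (x : lbar) : 0 < e -> F [set y | rnorm (x - y) <= e] ->
    (seq_norm s (lbar_val x - l)%R <= (e + e)%:E)%E.
  move=> e0 Fx; apply: seq_norm_trunc => // N.
  have d0 : 0 < e / N.+1%:R by rewrite divr_gt0.
  have : F [set y : lbar | forall n, (n < N)%N -> rnorm (l n - y n) <= e / N.+1%:R].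
    elim: N {d0} (e / N.+1%:R) d0 => [|N IH] d d0.
      by apply: filterS (filterT) => y _ n.
    apply: filterS (filterI (IH d d0) (lP N d d0)) => y [yN yl] n.
    by rewrite ltnS leq_eqVlt => /predU1P[->//|]; exact: yN.
  move=> /(filterI Fx)/filter_ex[y [/= xy ly]].
  pose T (u : nat -> K) n := if (n < N)%N then u n else 0.
  rewrite -/(T (lbar_val x - l)).
  have -> : T (lbar_val x - l) = T (lbar_val (x - y)) + T (lbar_val y - l).
    apply/funext => n; rewrite /T /GRing.add /=; case: ifP => _; rewrite ?addr0//.
    by rewrite [RHS]addrA subrK.
  apply: le_trans (seq_normD s1 _ _) _; rewrite EFinD; apply: leeD.
    apply: (@le_trans _ _ (seq_norm s (x - y))).
      apply: le_seq_norm => // n; rewrite /T; case: ifP => // _.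
      by rewrite rnorm0 rnorm_ge0.
    by rewrite -lbar_normE -rnorm_lbar lee_fin.
  apply: (@le_trans _ _ (e / N.+1%:R * N%:R)%:E).
    apply: seq_norm_trunc_le => // n nN; rewrite -[_ n]/(y n - l n) rnormB.
    exact: ly.
  by rewrite lee_fin mulrAC ler_pdivrMr// ler_pM2l// ler_nat.
have lF : l \in lbar_pred.
  have [x1 Fx1] := Fc 1 ltr01; have := dist _ _ ltr01 Fx1.
  rewrite inE /=; case: ifPn => [/eqP soo _|soo xl].
    apply/cvg_rnormP => e e0; have e40 : 0 < e / 4 by rewrite divr_gt0.
    have [x Fx] := Fc _ e40; have xl := dist _ _ e40 Fx.
    have : lbar_val x \in lbar_pred := valP x.
    rewrite inE /= soo eqxx => /cvg_rnormP.
    move=> /(_ _ e40) xe.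
    suff: \forall n \near \oo, rnorm (0 - l n) <= e by [].
    have {xe} : \forall n \near \oo, rnorm (0 - x n) <= e / 4 by [].
    apply: filterS => n; rewrite !sub0r !rnormN => xn.
    have := le_trans (rnorm_le_seq_norm s1 _ n) xl; rewrite lee_fin => xln.
    have -> : l n = x n - (x n - l n) by rewrite opprB addrCA subrr addr0.
    apply: le_trans (rnormD _ _) _; rewrite rnormN.
    by have := lerD xn xln; lra.
  have -> : l = lbar_val x1 - (lbar_val x1 - l) by rewrite opprB addrCA subrr addr0.
  apply: le_lt_trans (seq_normD s1 _ _) _; apply: lte_add_pinfty.
    exact: lbar_fin.
  by rewrite seq_normN//; apply: le_lt_trans xl _; exact: ltry.
apply/cvg_ex; exists (Lbar lF); apply/cvg_rnormP => e e0.
have e40 : 0 < e / 4 by rewrite divr_gt0.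
have [x Fx] := Fc _ e40; have xl := dist _ _ e40 Fx; apply: filterS Fx => y /= xy.
have -> : Lbar lF - y = (x - y) - (x - Lbar lF).
  by rewrite opprB addrCA (addrAC x) subrr add0r.
apply: le_trans (rnormD _ _) _; rewrite rnormN.
have xl' : rnorm (x - Lbar lF) <= e / 4 + e / 4 by rewrite rnorm_lbar -lee_fin lbar_normE.
by have := lerD xy xl'; lra.
Qed.

HB.instance Definition _ := Uniform_isComplete.Build lbar lbar_complete.
End lbar.
Arguments lbar {R} k s.

Section p_compactness.
Variables (R : realType) (k : scalar_kind).
Local Notation K := (scalar_field R k).

Section sets.
Variable F : normedModType K.
Implicit Types (p : R) (x : nat -> F) (A : set F).

(* For p = 1 the conjugate exponent is +oo and the coefficients range over
   the unit ball of l_oo, not of c_0. *)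
Definition p_hull p x : set F :=
  [set v | exists2 a : nat -> K,
     (seq_norm (hoelder_conjugate p%:E) a < 1)%E &
     series (fun n => a n *: x n) @ \oo --> v].

Definition p_cover p A : set (nat -> F) :=
  [set x | (\sum_(n <oo) (rnorm (x n) `^ p)%:E < +oo)%E /\ A `<=` p_hull p x].

Definition p_compact p A : Prop := p_cover p A !=set0.

(* +oo when A is not p-compact *)
Definition m_ p A : \bar R :=
  ereal_inf [set ((\sum_(n <oo) (rnorm (x n) `^ p)%:E) `^ p^-1)%E
            | x in p_cover p A].

End sets.

Section maps.
Variables E F : normedModType K.
Implicit Types p : R.

Definition p_compact_operators p : set (E -> F) :=
  [set T | [/\ linear T, continuous T & p_compact p (T @` ball 0 1)]].

Definition multilinear n (M : ('I_n -> E) -> F) : Prop :=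
  forall (i : 'I_n) (v : 'I_n -> E),
    linear (fun z => M (fun j => if j == i then z else v j)).

Definition homogeneous_polynomial n (P : E -> F) : Prop :=
  exists M : ('I_n -> E) -> F,
    [/\ multilinear M,
        forall (t : 'S_n) v, M (v \o t) = M v,
        continuous (M : {ptws 'I_n -> E} -> F) &
        forall x, P x = M (fun=> x)].

Definition p_compact_polynomials p n : set (E -> F) :=
  [set P | homogeneous_polynomial n P /\ p_compact p (P @` ball 0 1)].

Definition polynomial_norm p (P : E -> F) : \bar R := m_ p (P @` ball 0 1).

Definition difference_quotients (f : E -> F) : set F :=
  [set `|z.1 - z.2|^-1 *: (f z.1 - f z.2) | z in [set z : E * E | z.1 != z.2]].

Definition p_compact_lipschitz p : set (E -> F) :=
  [set f | [/\ lipschitz f, f 0 = 0 & p_compact p (difference_quotients f)]].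

Definition lipschitz_norm p (f : E -> F) : \bar R :=
  m_ p (difference_quotients f).

End maps.

(* The ambient Banach space is a linear subspace of V containing A, with norm N;
   the copy of S is the range of phi. *)
Definition spaceable (S : normedModType K) (V : lmodType K) (N : V -> \bar R)
    (A : set V) : Prop :=
  exists2 phi : {linear S -> V},
    forall a, (A `|` [set 0]) (phi a) &
    exists c C : R, [/\ 0 < c, 0 < C &
      forall a, ((c * rnorm a)%:E <= N (phi a) <= (C * rnorm a)%:E)%E].

Definition infinite_dimensional (E : lmodType K) : Prop :=
  ~ exists n (e : 'I_n -> E),
      forall x, exists c : 'I_n -> K, x = \sum_i c i *: e i.

End p_compactness.

Arguments p_compact_operators {R k} E F p.
Arguments p_compact_polynomials {R k} E F p n.
Arguments p_compact_lipschitz {R k} E F p.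
Arguments polynomial_norm {R k E F} p P.
Arguments lipschitz_norm {R k E F} p f.
Arguments spaceable {R k} S {V} N A.
Arguments infinite_dimensional {R k} E.

(* Main.v *)
(* Operators.  Let T map the ball of l_r, r >= 2, into the q-hull of (x_m), q > 2.  Testing T on
   truncated Rademacher sums, with Khintchine's inequality for the error and for the x_m, gives
   sum_j |<y_j, T a_j>|^2 <= C ||(sum_j |<y_j, x_m>|^2)_m||_(q/2).  A Hahn-Banach argument in l_(q/2)
   turns this into weights nu with |<y, T a>|^2 <= sum_m nu_m |<y, x_m>|^2, and a second one in l_2
   puts the range of T in the 2-hull of (sqrt(nu_m) x_m).  So T is 2-compact, which settles p >= 2.
   If s >= 2, a 2-hull in l_s is even 1-compact: writing a Hilbertian combination as the expectation
   of a product of two Rademacher sums and truncating both factors gives an absolutely summable part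
   with bounded coefficients and a smaller remainder of the same kind, and one iterates.

   Spaceability.  One may assume p >= 2, replacing p by max(p, 2) < q.  For 2^(-1/p) < kap < 2^(-1/q)
   choose in l_s blocks b_(e,i), i < 2^e, of norm at most 1 with biorthogonal functionals L_(e,i)
   satisfying a Bessel inequality (unit vectors for s <= 2, rows of Hadamard matrices for s >= 2).
   The vectors kap^e b_(e,i) are q-summable, but a set with vectors on which |L_(e,i)| >= c kap^e for
   all e and i is not p-compact.  These vectors are difference quotients of a radial Lipschitz map;
   for polynomials one uses sum kap^e f_(e,i)(x)^d b_(e,i) with functionals f_(e,i) obtained by the
   Dvoretzky-Rogers method.  Composing with the maps y |-> a (x) y, a in l_s, gives a copy of l_s. *)

Require Import Defs.
From HB Require Import structures.
From mathcomp Require Import all_boot all_order all_algebra all_fingroup.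
From mathcomp Require Import complex.
From mathcomp Require Import all_classical all_reals all_analysis.
From mathcomp Require Import ring lra.

Set Implicit Arguments.
Unset Strict Implicit.
Unset Printing Implicit Defensive.
Import Order.TTheory GRing.Theory Num.Theory.
Import numFieldNormedType.Exports.
Local Open Scope classical_set_scope.
Local Open Scope ring_scope.

(** * Sequence norms and p-hulls *)

(** Read on adjoints, the two operator statements are cotype facts. A map with range in a [q]-hull
    has a [q]-summing adjoint; for [r >= 2] this adjoint ends in a space of cotype 2, where
    [q]-summing gives 2-summing when [q > 2], and for [s >= 2] it starts from a space of cotype 2,
    where 2-summing gives 1-summing. The proof forms no dual space: cotype 2 of the dual appears as
    2-convexity of [l_r] and [l_s] ([lbar_square_function]), and truncated Rademacher sums do the
    extrapolation by shrinking a remainder at each use. Polynomials and Lipschitz maps escape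
    because they reach absolutely summable coefficients: the difference quotients of a radial map
    have coefficients of total at most 1, and a product of at least two functionals from a Bessel
    family is absolutely summable over the family. A linear map on [l_r], [r >= 2], offers only
    square summability. Constants are crude throughout, since spaceability only asks for an
    isomorphic copy. *)

Section real_powers.
Context {R : realType}.
Implicit Types a b x y p q B : R.

Lemma ler_powR_base a x y : 0 <= a -> 0 <= x -> x <= y -> x `^ a <= y `^ a.
Proof. by move=> a0 x0 xy; rewrite ge0_ler_powR ?nnegrE// (le_trans x0). Qed.

Lemma powR_invK x a : 0 <= x -> a != 0 -> (x `^ a^-1) `^ a = x.
Proof. by move=> x0 a0; rewrite -powRrM mulVf ?powRr1. Qed.

Lemma powRK_inv x a : 0 <= x -> a != 0 -> (x `^ a) `^ a^-1 = x.
Proof. by move=> x0 a0; rewrite -powRrM mulfV ?powRr1. Qed.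

(** Young's inequality without its coefficients: if [M] is the larger of [x^a] and [y^b], then
    [x <= M^(1/a)] and [y <= M^(1/b)], so the product to the power [c] is at most [M]. It does the
    work of Hoelder's inequality for hulls. *)
Lemma mulr_powR_le_add x y a b c : 0 <= x -> 0 <= y -> 0 < a -> 0 < b -> 0 < c ->
  a^-1 + b^-1 = c^-1 -> (x * y) `^ c <= x `^ a + y `^ b.
Proof.
move=> x0 y0 a0 b0 c0 abc; have c0' := ltW c0.
pose M := Num.max (x `^ a) (y `^ b).
have M0 : 0 <= M by rewrite /M le_max powR_ge0.
have xM : x <= M `^ a^-1.
  rewrite -{1}(@powRK_inv x a) ?gt_eqF//.
  by apply: ler_powR_base; [rewrite invr_ge0 ltW|exact: powR_ge0|rewrite /M le_max lexx].
have yM : y <= M `^ b^-1.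
  rewrite -{1}(@powRK_inv y b) ?gt_eqF//.
  by apply: ler_powR_base; [rewrite invr_ge0 ltW|exact: powR_ge0|rewrite /M le_max lexx orbT].
apply: (@le_trans _ _ M); last first.
  by rewrite /M ge_max lerDl lerDr; apply/andP; split; exact: powR_ge0.
apply: (@le_trans _ _ ((M `^ a^-1 * M `^ b^-1) `^ c)).
  by apply: ler_powR_base; rewrite ?mulr_ge0// ler_pM.
rewrite -powRD ?abc; last first.
  by rewrite gt_eqF ?invr_gt0.
by rewrite powR_invK ?gt_eqF.
Qed.

Lemma powRVl x a : 0 <= x -> x^-1 `^ a = (x `^ a)^-1.
Proof. by move=> x0; rewrite -powR_inv1// -powRrM mulN1r powRN. Qed.

Lemma ler_powR_le1 x a : 0 <= x -> x <= 1 -> 1 <= a -> x `^ a <= x.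
Proof.
move=> x0 x1 a1; have [->|xn0] := eqVneq x 0.
  by rewrite powR0// gt_eqF// (lt_le_trans _ a1).
by rewrite -[leRHS]powRr1// ger_powR// x1 lt_def xn0 x0.
Qed.

Lemma exprn_powR x a n : 0 <= x -> (x ^+ n) `^ a = (x `^ a) ^+ n.
Proof.
by move=> x0; elim: n => [|n IH]; rewrite ?expr0 ?powR1// !exprS powRM ?exprn_ge0// IH.
Qed.

End real_powers.

Section sequence_norms.
Context {R : realType} {k : scalar_kind}.
Local Notation K := (scalar_field R k).

Lemma nneseries_leP (f : nat -> R) (M : R) : (forall n, 0 <= f n) ->
  (\sum_(n <oo) (f n)%:E <= M%:E)%E <-> forall N, \sum_(n < N) f n <= M.
Proof.
move=> f0; split=> [H N|H].
  rewrite -lee_fin (le_trans _ H)// -sumEFin -(big_mkord xpredT (fun n => (f n)%:E)).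
  by apply: nneseries_lim_ge => n _; rewrite lee_fin.
apply: lime_le; first by apply: is_cvg_nneseries => n _ _; rewrite lee_fin.
by apply: nearW => N; rewrite big_mkord sumEFin lee_fin.
Qed.

Lemma nneseries_ltyP (f : nat -> R) : (forall n, 0 <= f n) ->
  (\sum_(n <oo) (f n)%:E < +oo)%E <-> exists M, forall N, \sum_(n < N) f n <= M.
Proof.
move=> f0; split=> [H|[M /(nneseries_leP _ f0) H]]; last exact: le_lt_trans H (ltry _).
have S0 : (0 <= \sum_(n <oo) (f n)%:E)%E.
  by apply: nneseries_ge0 => n _ _; rewrite lee_fin.
exists (fine (\sum_(n <oo) (f n)%:E)%E); apply/nneseries_leP => //.
by rewrite fineK ?ge0_fin_numE.
Qed.

Variable V : normedModType K.
Implicit Types x y : nat -> V.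

Lemma seq_norm_leP (r c : R) x : 1 <= r -> 0 <= c ->
  (seq_norm r%:E x <= c%:E)%E <-> forall N, \sum_(n < N) rnorm (x n) `^ r <= c `^ r.
Proof.
move=> r1 c0; have r0 : 0 < r by rewrite (lt_le_trans _ r1).
have f0 n : 0 <= rnorm (x n) `^ r by rewrite powR_ge0.
rewrite /seq_norm Lnorm_counting//.
rewrite (_ : (\sum_(n <oo) _)%E = (\sum_(n <oo) (rnorm (x n) `^ r)%:E)%E); last first.
  by apply: eq_eseriesr => n _; rewrite /= ger0_norm ?rnorm_ge0.
have S0 : (0 <= \sum_(n <oo) (rnorm (x n) `^ r)%:E)%E.
  by apply: nneseries_ge0 => n _ _; rewrite lee_fin.
rewrite -(nneseries_leP _ f0) -poweR_EFin; split=> H.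
  rewrite -[leLHS]poweRe1// -(mulVf (lt0r_neq0 r0)) poweRrM.
  by apply: le_poweR; rewrite ?(ltW r0) ?poweR_ge0.
rewrite -[leRHS]poweRe1 ?lee_fin// -(mulfV (lt0r_neq0 r0)) poweRrM.
by apply: le_poweR; rewrite ?invr_ge0 ?(ltW r0).
Qed.

Lemma seq_norm_ooP (c : R) x :
  (seq_norm +oo%E x <= c%:E)%E <-> forall n, rnorm (x n) <= c.
Proof.
rewrite /seq_norm unlock /Lnorm counting_setT_gt0 ess_sup_countingP; split=> H n.
  by have := H n; rewrite /= lee_fin ger0_norm ?rnorm_ge0.
by rewrite /= lee_fin ger0_norm ?rnorm_ge0.
Qed.

End sequence_norms.

Section conjugate_exponent.
Context {R : realType} {k : scalar_kind}.
Local Notation K := (scalar_field R k).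
Implicit Types (p q : R) (a : nat -> K).

Lemma conj1 : hoelder_conjugate (1 : R)%:E = +oo%E.
Proof. exact: hoelder_conjugate1. Qed.

Lemma conj_gt1 p : 1 < p -> hoelder_conjugate p%:E = (p / (p - 1))%:E.
Proof.
move=> p1; rewrite /hoelder_conjugate /= gt_eqF ?lte_fin ?(lt_trans _ p1)//.
by rewrite inver gt_eqF ?subr_gt0.
Qed.

Lemma conj_ge1 p : 1 <= p -> (1 <= hoelder_conjugate p%:E)%E.
Proof.
rewrite le_eqVlt => /predU1P[<-|p1]; first by rewrite conj1 leey.
by rewrite conj_gt1// lee_fin ler_pdivlMr ?subr_gt0// mul1r gerBl.
Qed.

(** Hoelder's inequality in additive form: [l] is rescaled by a free parameter [B], and [B] of the
    order of the [l_p] norm of [l] recovers the product bound up to a factor 2. Being additive, it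
    can be summed over several coefficient sequences. *)
Lemma conj_young p a (l : nat -> R) (B : R) M : 1 <= p -> 0 < B ->
  (forall m, 0 <= l m) -> (seq_norm (hoelder_conjugate p%:E) a <= 1)%E ->
  \sum_(m < M) rnorm (a m) * l m <= B + B `^ (1 - p) * \sum_(m < M) (l m) `^ p.
Proof.
move=> p1 B0 l0; have B0' := ltW B0.
have BS (S : R) : B `^ (1 - p) * S = B * (B^-1 `^ p * S).
  rewrite mulrA; congr (_ * _); rewrite powRB ?(gt_eqF B0)//= ?implybT//.
  by rewrite powRr1// powRVl.
have lS : \sum_(m < M) (B^-1 * l m) `^ p = B^-1 `^ p * \sum_(m < M) (l m) `^ p.
  by rewrite big_distrr/=; apply: eq_bigr => m _; rewrite powRM ?invr_ge0.
rewrite BS -lS -{1}(mulr1 B) -mulrDr.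
have -> : \sum_(m < M) rnorm (a m) * l m =
    B * \sum_(m < M) rnorm (a m) * (B^-1 * l m).
  rewrite big_distrr/=; apply: eq_bigr => m _.
  by rewrite mulrCA (mulrA B) mulfV ?gt_eqF// mul1r.
move=> a1; rewrite ler_pM2l//.
have t0 m : 0 <= B^-1 * l m by rewrite mulr_ge0 ?invr_ge0.
move: p1 a1; rewrite le_eqVlt => /predU1P[<-|p1].
  rewrite conj1 => /seq_norm_ooP a1; rewrite -[leLHS]add0r lerD//.
  apply: ler_sum => m _; rewrite powRr1//.
  by rewrite -[leRHS]mul1r ler_wpM2r.
have p'1 : 1 <= p / (p - 1) by rewrite ler_pdivlMr ?subr_gt0// mul1r gerBl.
rewrite conj_gt1// => /(seq_norm_leP _ p'1 ler01)/(_ M); rewrite powR1 => a1.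
apply: le_trans (lerD a1 (lexx _)); rewrite -big_split/=.
apply: ler_sum => m _; rewrite -[leLHS](powRr1 (mulr_ge0 (rnorm_ge0 _) (t0 m))).
apply: mulr_powR_le_add; rewrite ?rnorm_ge0// ?(lt_trans _ p1)//.
  by rewrite (lt_le_trans _ p'1).
rewrite invf_div invr1 mulrBl mul1r mulfV ?subrK//.
by rewrite gt_eqF// (lt_trans _ p1).
Qed.

(** Serves the Lipschitz and polynomial examples, whose coefficients are absolutely summable: powers
    of numbers at most 1 only decrease, so such coefficients are admissible in every hull. *)
Lemma conj_norm_le1 p a : 1 <= p -> (forall N, \sum_(n < N) rnorm (a n) <= 1) ->
  (seq_norm (hoelder_conjugate p%:E) a <= 1)%E.
Proof.
move=> p1 a1; have an n : rnorm (a n) <= 1.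
  apply: le_trans (a1 n.+1); rewrite big_ord_recr/= lerDr sumr_ge0// => *.
  exact: rnorm_ge0.
move: p1; rewrite le_eqVlt => /predU1P[<-|p1].
  by rewrite conj1; apply/seq_norm_ooP.
have p'1 : 1 <= p / (p - 1) by rewrite ler_pdivlMr ?subr_gt0// mul1r gerBl.
rewrite conj_gt1//; apply/seq_norm_leP => // N; rewrite powR1.
apply: le_trans (a1 N); apply: ler_sum => n _.
by apply: ler_powR_le1; rewrite ?rnorm_ge0.
Qed.

End conjugate_exponent.

Section real_series.
Context {R : realType}.
Implicit Types f : nat -> R.

Lemma ler_sum_ord_le f m n : (forall i, 0 <= f i) -> (m <= n)%N ->
  \sum_(i < m) f i <= \sum_(i < n) f i.
Proof.
move=> f0 mn; rewrite -!(big_mkord xpredT f) [leRHS](big_cat_nat (leq0n m) mn)/= lerDl.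
by rewrite sumr_ge0.
Qed.

Lemma bounded_sum_tail f (M : R) : (forall i, 0 <= f i) ->
  (forall N, \sum_(i < N) f i <= M) -> forall e, 0 < e ->
  exists N, forall n, (N <= n)%N -> \sum_(i < n) f i <= \sum_(i < N) f i + e.
Proof.
move=> f0 fM e e0; pose A := range (fun N => \sum_(i < N) f i).
have supA : has_sup A.
  by split; [exists (\sum_(i < 0) f i); exists 0%N|exists M => _ [N _ <-]].
have [_ [N _ <-] Ne] := sup_adherent e0 supA.
exists N => n Nn; rewrite -lerBlDr; apply: ltW; apply: le_lt_trans Ne.
by rewrite lerB//; apply: ub_le_sup; [case: supA|exists n].
Qed.

End real_series.

Section rnorm_convergence.
Context {R : realType} {k : scalar_kind}.
Local Notation K := (scalar_field R k).

Lemma cvg_seq_rnormP (V : normedModType K) (u : nat -> V) (l : V) :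
  u @ \oo --> l <-> forall e : R, 0 < e ->
    exists N, forall n, (N <= n)%N -> rnorm (l - u n) <= e.
Proof.
rewrite cvg_rnormP; split=> H e /H.
  by move=> [N _ HN]; exists N => n Nn; exact: HN.
by move=> [N HN]; exists N.
Qed.

Lemma rnorm_sum (V : normedModType K) (I : Type) (r : seq I) (P : pred I) (u : I -> V) :
  rnorm (\sum_(i <- r | P i) u i) <= \sum_(i <- r | P i) rnorm (u i).
Proof.
elim/big_rec2 : _ => [|i y x _ xy]; first by rewrite rnorm0.
by apply: le_trans (rnormD _ _) _; rewrite lerD2l.
Qed.

Lemma rnorm_of_real (a : R) : rnorm (of_real k a) = `|a|.
Proof.
rewrite /rnorm /of_real /real_part; case: k => //=.
by rewrite expr0n/= addr0 sqrtr_sqr.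
Qed.

Lemma rnorm_of_real_ge0 (a : R) : 0 <= a -> rnorm (of_real k a) = a.
Proof. by move=> a0; rewrite rnorm_of_real ger0_norm. Qed.

Lemma rnormM (a b : K) : rnorm (a * b) = rnorm a * rnorm b.
Proof. exact: (@rnormZ _ _ K^o a b). Qed.

Lemma seriesE (V : zmodType) (u : nat -> V) n : series u n = \sum_(i < n) u i.
Proof. by rewrite /series/= big_mkord. Qed.

Lemma abs_series_cvg (V : completeNormedModType K) (u : nat -> V) (M : R) :
  (forall N, \sum_(n < N) rnorm (u n) <= M) -> exists v : V, series u @ \oo --> v.
Proof.
move=> uM; apply/(@cvg_ex V); apply: (@cauchy_cvg V); apply/cauchy_rnormP => e e0.
have [N HN] := bounded_sum_tail (fun i => rnorm_ge0 (u i)) uM e0.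
exists (series u N); exists N => // n /= Nn; rewrite rnormB.
rewrite /series/= (big_cat_nat (leq0n N) Nn)//= addrC addrK.
apply: le_trans (rnorm_sum _ _ _) _; have := HN n Nn.
by rewrite -!(big_mkord xpredT (fun i => rnorm (u i))) (big_cat_nat (leq0n N) Nn)//= lerD2l.
Qed.

End rnorm_convergence.

Section hulls.
Context {R : realType} {k : scalar_kind}.
Local Notation K := (scalar_field R k).

Lemma seq_norm_scale (c C : R) (a : nat -> K) t : (1 <= t)%E -> 0 <= c ->
  (seq_norm t a <= C%:E)%E -> (seq_norm t (fun n => (of_real k c * a n)%R) <= (c * C)%:E)%E.
Proof.
move=> t1 c0 aC; apply: le_trans (@seq_normZ _ _ _ t1 K^o (of_real k c) a) _.
by rewrite rnorm_of_real_ge0// EFinM lee_wpmul2l ?lee_fin.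
Qed.

(** The coefficient ball of [p_hull] is open, so coefficients of norm at most [C] are divided by
    [2 * C], and the factor is given to the vectors. The factors 2 in front of later hull sequences
    come from here. *)
Lemma p_hull_scale (F : normedModType K) (p C : R) (x : nat -> F) (a : nat -> K) v :
  1 <= p -> 0 < C -> (seq_norm (hoelder_conjugate p%:E) a <= C%:E)%E ->
  series (fun n => a n *: x n) @ \oo --> v ->
  p_hull p (fun n => of_real k (2 * C) *: x n) v.
Proof.
move=> p1 C0 aC av; exists (fun n => of_real k (2 * C)^-1 * a n).
  apply: le_lt_trans (seq_norm_scale (conj_ge1 p1) _ aC) _.
    by rewrite invr_ge0 mulr_ge0// ltW.
  by rewrite lte_fin invfM -mulrA mulVf ?gt_eqF// mulr1; lra.
rewrite (_ : (fun n => _) = (fun n => a n *: x n))//.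
apply/funext => n; rewrite scalerA mulrAC -of_realM mulVf ?of_real1 ?mul1r//.
by rewrite gt_eqF// mulr_gt0.
Qed.

(** The quantitative content of lying in a hull: each [v i] is replaced by a partial sum, of one
    length for all [i], and [conj_young] is applied to the numbers [N i (x m)]. Each point has its
    own seminorm, as biorthogonal functionals and random signs require. *)
Lemma hull_seminorm (F : normedModType K) (I : finType) (p C B S : R) (v : I -> F)
  (N : I -> F -> R) (x : nat -> F) : 1 <= p -> 0 < B -> 0 <= C ->
  (forall i y, 0 <= N i y) ->
  (forall i y z, N i (y + z) <= N i y + N i z) ->
  (forall i c y, N i (c *: y) <= rnorm c * N i y) ->
  (forall i y, N i y <= C * rnorm y) ->
  (forall i, p_hull p x (v i)) ->
  (forall M, \sum_i \sum_(m < M) N i (x m) `^ p <= S) ->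
  \sum_i N i (v i) <= #|I|%:R * B + B `^ (1 - p) * S.
Proof.
move=> p1 B0 C0 N0 ND NZ NC xv NS; apply/ler_addgt0Pr => e e0.
(* The errors of the partial sums add up to [#|I| * C * d <= e]; the [+ 1] keeps the denominator
   positive. *)
pose d := e / (#|I|%:R * C + 1).
have d0 : 0 < d by rewrite divr_gt0// ltr_wpDl// mulr_ge0.
have /choice[a /all_and2 [a1 ax]] : forall i, exists a : nat -> K,
    (seq_norm (hoelder_conjugate p%:E) a < 1)%E /\
    series (fun n => a n *: x n) @ \oo --> v i.
  by move=> i; have [a ? ?] := xv i; exists a.
have /choice[n nP] : forall i, exists n, forall m, (n <= m)%N ->
    rnorm (v i - series (fun n => a i n *: x n) m) <= d.
  by move=> i; have /cvg_seq_rnormP/(_ d d0) := ax i.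
pose M := \max_i n i.
have NM i : N i (v i) <= B + B `^ (1 - p) * (\sum_(m < M) N i (x m) `^ p) + C * d.
  rewrite -(subrK (series (fun n => a i n *: x n) M) (v i)) addrC.
  apply: le_trans (ND _ _ _) _; apply: lerD; last first.
    by apply: le_trans (NC _ _) _; rewrite ler_wpM2l// nP// leq_bigmax.
  apply: le_trans (conj_young M p1 B0 (fun m => N0 i (x m)) (ltW (a1 i))).
  rewrite seriesE; elim: M => [|M IH]; last first.
    rewrite !big_ord_recr/=; apply: le_trans (ND _ _ _) _.
    by apply: lerD => //; exact: NZ.
  by rewrite !big_ord0 -(scale0r (v i)); apply: le_trans (NZ _ _ _) _; rewrite rnorm0 mul0r.
apply: le_trans (ler_sum _ (fun i _ => NM i)) _.
have -> : \sum_i (B + B `^ (1 - p) * (\sum_(m < M) N i (x m) `^ p) + C * d) =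
    #|I|%:R * B + B `^ (1 - p) * (\sum_i \sum_(m < M) N i (x m) `^ p) + #|I|%:R * (C * d).
  by rewrite !big_split/= !sumr_const -mulr_sumr !mulr_natl.
apply: lerD; first by rewrite lerD2l ler_wpM2l ?powR_ge0.
rewrite mulrA /d mulrCA ger_pMr// ler_pdivrMr ?mul1r ?lerDl//.
by rewrite ltr_wpDl// mulr_ge0.
Qed.

Lemma p_hull_rnorm (F : normedModType K) (p B S : R) (x : nat -> F) v : 1 <= p -> 0 < B ->
  p_hull p x v -> (forall M, \sum_(m < M) rnorm (x m) `^ p <= S) ->
  rnorm v <= B + B `^ (1 - p) * S.
Proof.
move=> p1 B0 xv xS.
have := @hull_seminorm F 'I_1 p 1 B S (fun=> v) (fun=> rnorm) x p1 B0 ler01.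
rewrite big_ord1 card_ord mul1r; apply => //.
- by move=> *; exact: rnorm_ge0.
- by move=> *; exact: rnormD.
- by move=> *; rewrite rnormZ.
- by move=> *; rewrite mul1r.
- by move=> M; rewrite big_ord1.
Qed.

Lemma p_hull_image (F G : normedModType K) (f : {linear F -> G}) (C p : R) (x : nat -> F) :
  0 <= C -> (forall y, rnorm (f y) <= C * rnorm y) ->
  f @` p_hull p x `<=` p_hull p (f \o x).
Proof.
move=> C0 fC _ [v [a a1 av] <-]; exists a => //.
apply/cvg_seq_rnormP => e e0; have e0' : 0 < e / (C + 1) by rewrite divr_gt0// ltr_wpDl.
move/cvg_seq_rnormP : av => /(_ _ e0')[N HN]; exists N => n /HN vn.
have -> : series (fun n => a n *: (f \o x) n) n = f (series (fun n => a n *: x n) n).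
  by rewrite !seriesE raddf_sum/=; apply: eq_bigr => i _; rewrite linearZ.
rewrite -raddfB; apply: le_trans (fC _) _; apply: le_trans (ler_wpM2l C0 vn) _.
by rewrite mulrCA ger_pMr// ler_pdivrMr ?ltr_wpDl// mul1r lerDl.
Qed.

Lemma p_coverP (F : normedModType K) (p : R) (A : set F) x :
  p_cover p A x <-> (exists M, forall N, \sum_(n < N) rnorm (x n) `^ p <= M) /\
                    A `<=` p_hull p x.
Proof.
have x0 n : 0 <= rnorm (x n) `^ p by rewrite powR_ge0.
by split=> -[xp Ax]; split => //; apply/(nneseries_ltyP x0).
Qed.

Lemma p_compact_image (F G : normedModType K) (f : {linear F -> G}) (C p : R) (A : set F) :
  1 <= p -> 0 <= C -> (forall y, rnorm (f y) <= C * rnorm y) ->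
  p_compact p A -> p_compact p (f @` A).
Proof.
move=> p1 C0 fC [x /p_coverP[[M xM] Ax]].
exists (f \o x); apply/p_coverP; split; last first.
  by apply: subset_trans (p_hull_image C0 fC); exact: image_subset.
exists (C `^ p * M) => N; apply: le_trans (ler_wpM2l (powR_ge0 _ _) (xM N)).
rewrite mulr_sumr; apply: ler_sum => n _; rewrite -powRM ?rnorm_ge0//=.
by apply: ler_powR_base; rewrite ?rnorm_ge0// (le_trans _ p1).
Qed.

Lemma p_compact_sub (F : normedModType K) (p : R) (A B : set F) :
  A `<=` B -> p_compact p B -> p_compact p A.
Proof. by move=> AB [x [xp Bx]]; exists x; split=> //; exact: subset_trans Bx. Qed.

(* With x_n = c_n y_n and c_n = ||x_n|| ^ (1 - p/q), Hoelder's inequality sends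
   l_p' coefficients of (x_n) to l_q' coefficients of (y_n). *)
Lemma p_compact_mono (F : normedModType K) (p q : R) (A : set F) :
  1 <= p -> p <= q -> p_compact p A -> p_compact q A.
Proof.
move=> p1; rewrite le_eqVlt => /predU1P[<-//|pq] [x /p_coverP[[M xM] Ax]].
have p0 : 0 < p by rewrite (lt_le_trans _ p1).
have q0 : 0 < q by rewrite (lt_trans p0).
have q1 : 1 < q by rewrite (le_lt_trans p1).
have qp0 : 0 < q - p by rewrite subr_gt0.
have M0 : 0 <= M by have := xM 0%N; rewrite big_ord0.
pose c n := rnorm (x n) `^ (1 - p / q).
pose y n := of_real k (rnorm (x n) `^ (1 - p / q))^-1 *: x n.
have pq0 : 0 < 1 - p / q by rewrite subr_gt0 ltr_pdivrMr// mul1r.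
exists (fun n => of_real k (2 * (1 + M)) *: y n); apply/p_coverP; split.
  exists ((2 * (1 + M)) `^ q * M) => N.
  apply: le_trans (ler_wpM2l (powR_ge0 _ _) (xM N)).
  rewrite mulr_sumr; apply: ler_sum => n _.
  rewrite rnormZ rnorm_of_real_ge0 ?mulr_ge0 ?addr_ge0//.
  rewrite powRM ?rnorm_ge0 ?mulr_ge0 ?addr_ge0// ler_wpM2l ?powR_ge0//.
  rewrite rnormZ rnorm_of_real_ge0 ?invr_ge0 ?powR_ge0//.
  have [->|xn0] := eqVneq (rnorm (x n)) 0.
    by rewrite mulr0 !powR0 ?gt_eqF//.
  rewrite -powRN -{2}(powRr1 (rnorm_ge0 (x n))) -powRD ?xn0 ?implybT//.
  by rewrite opprB subrK -powRrM divfK ?gt_eqF.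
move=> v /Ax[a a1 av].
apply: (@p_hull_scale _ q (1 + M) y (fun n => a n * of_real k (c n))) => //.
- exact: ltW.
- by rewrite ltr_wpDr.
- rewrite conj_gt1//.
  have q'1 : 1 <= q / (q - 1) by rewrite ler_pdivlMr ?subr_gt0// mul1r gerBl.
  have M1 : 1 <= 1 + M by rewrite lerDl.
  apply/seq_norm_leP => //; first by rewrite addr_ge0.
  move=> N; apply: le_trans (le1r_powR M1 q'1).
  (* [1/t = 1/p - 1/q], hence [1/p' + 1/t = 1/q'], and [c_n^t = ||x_n||^p]: the sum of the [q']-th
     powers of [a_n * c_n] is at most [1 + M]. *)
  pose t := p * q / (q - p).
  have t0 : 0 < t by rewrite divr_gt0// mulr_gt0.
  have cn n : c n `^ t = rnorm (x n) `^ p.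
    rewrite /c -powRrM; congr (_ `^ _); rewrite /t.
    have -> : 1 - p / q = (q - p) / q by rewrite mulrBl mulfV ?gt_eqF.
    by field; rewrite !gt_eqF.
  have -> : \sum_(n < N) rnorm (a n * of_real k (c n)) `^ (q / (q - 1)) =
      \sum_(n < N) (rnorm (a n) * c n) `^ (q / (q - 1)).
    by apply: eq_bigr => n _; rewrite rnormM rnorm_of_real_ge0 ?powR_ge0.
  move: (p1); rewrite le_eqVlt => /predU1P[p1'|p1'].
    move: a1; rewrite -p1' conj1 => /ltW/seq_norm_ooP a1.
    rewrite -[leLHS]add0r lerD//; apply: le_trans (xM N); apply: ler_sum => n _.
    rewrite -cn /t -p1' mul1r.
    apply: ler_powR_base; first exact: le_trans ler01 q'1.
      by rewrite mulr_ge0 ?rnorm_ge0 ?powR_ge0.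
    by rewrite -[leRHS]mul1r ler_wpM2r ?powR_ge0.
  move: a1; rewrite conj_gt1// => /ltW.
  have p'1 : 1 <= p / (p - 1) by rewrite ler_pdivlMr ?subr_gt0// mul1r gerBl.
  move=> /(seq_norm_leP _ p'1 ler01)/(_ N); rewrite powR1 => a1.
  apply: le_trans (lerD a1 (xM N)); rewrite -big_split/=; apply: ler_sum => n _.
  rewrite -cn; apply: mulr_powR_le_add; rewrite ?rnorm_ge0 ?powR_ge0//.
  + exact: lt_le_trans ltr01 p'1.
  + exact: lt_le_trans ltr01 q'1.
  + by rewrite /t; field; rewrite !gt_eqF ?subr_gt0.
- rewrite (_ : (fun n => _) = (fun n => a n *: x n))//.
  apply/funext => n; rewrite scalerA -mulrA -of_realM.
  have [xn0|xn0] := eqVneq (rnorm (x n)) 0; first by rewrite (rnorm0_eq0 xn0) !scaler0.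
  by rewrite mulfV ?of_real1 ?mulr1// powR_eq0 (negbTE xn0).
Qed.

End hulls.

(** * Enumeration of finite blocks *)

Section block_enumeration.

(** The pairs [(j, i)] with [i < sz j] are listed block after block, and [s J] is the place where
    block [J] starts. As no block is empty, [J <= s J], so every initial segment of the enumeration
    is covered by finitely many blocks. *)
Lemma block_enum (sz : nat -> nat) : (forall j, 0 < sz j)%N ->
  exists (idx : nat -> nat * nat) (s : nat -> nat),
  [/\ forall J, (J <= s J)%N,
      forall n, ((idx n).2 < sz (idx n).1)%N,
      forall j k, (k < sz j)%N -> exists n, idx n = (j, k) &
      forall (V : nmodType) (f : nat -> nat -> V) J,
        \sum_(n < s J) f (idx n).1 (idx n).2 = \sum_(j < J) \sum_(k < sz j) f j k].
Proof.
move=> sz0.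
pose L j := [seq (j, i) | i <- iota 0 (sz j)].
have LP j : all (fun x => (x.1 == j) && (x.2 < sz j)%N) (L j).
  by rewrite all_map; apply/allP => i; rewrite mem_iota /= eqxx add0n.
pose F J := flatten [seq L j | j <- iota 0 J].
have FS J : F J.+1 = F J ++ L J.
  by rewrite /F -addn1 iotaD map_cat flatten_cat /= cats0.
have Fle m J : (m <= J)%N -> exists t, F J = F m ++ t.
  move=> /subnK <-; elim: (J - m)%N => [|i [t IH]]; first by exists [::]; rewrite cats0.
  by rewrite addSn FS IH -catA; eexists.
have sF J : (J <= size (F J))%N.
  elim: J => // J IH; rewrite FS size_cat size_map size_iota.
  by rewrite -[J.+1]addn1 leq_add.
pose idx n := nth (0, 0)%N (F n.+1) n.
have idxE J n : (n < size (F J))%N -> idx n = nth (0, 0)%N (F J) n.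
  move=> nJ; have [nJ'|Jn] := leqP n.+1 J.
    have [t ->] := Fle _ _ nJ'; rewrite nth_cat ifT//.
  by rewrite /idx; have [t ->] := Fle _ _ (ltnW Jn); rewrite nth_cat nJ.
exists idx, (fun J => size (F J)); split => //.
- move=> n; have : idx n \in F n.+1 by rewrite mem_nth// sF.
  move=> /flattenP[l /mapP[j _ ->]] /(allP (LP j))/andP[/eqP ->].
  by [].
- move=> j i ij; have : (j, i) \in F j.+1.
    rewrite FS mem_cat; apply/orP; right; apply: map_f.
    by rewrite mem_iota.
  move=> jF; exists (index (j, i) (F j.+1)).
  by rewrite (@idxE j.+1) ?index_mem// nth_index.
move=> V f J.
transitivity (\sum_(x <- F J) f x.1 x.2).
  rewrite (big_nth (0, 0)%N) big_mkord; apply: eq_bigr => n _.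
  by rewrite (@idxE J).
elim: J => [|J IH]; first by rewrite /F big_nil big_ord0.
rewrite FS big_cat big_ord_recr/= IH; congr (_ + _).
by rewrite big_map -(big_mkord xpredT (f J)) /index_iota subn0.
Qed.

End block_enumeration.

(** * The Hahn-Banach theorem *)

Section hahn_banach.
Context {R : realType} {k : scalar_kind}.
Local Notation K := (scalar_field R k).
Local Notation ofR := (@of_real R k).

Definition sublinear (V : lmodType K) (p : V -> R) : Prop :=
  (forall u v, p (u + v) <= p u + p v) /\
  (forall t u, 0 < t -> p (ofR t *: u) <= t * p u).

Definition real_linear (V : lmodType K) (l : V -> R) : Prop :=
  (forall u v, l (u + v) = l u + l v) /\ (forall t u, l (ofR t *: u) = t * l u).

Section sublinear_functionals.
Variable V : lmodType K.
Implicit Types p l : V -> R.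

Lemma sublinearZ p : sublinear p -> forall t u, 0 < t -> p (ofR t *: u) = t * p u.
Proof.
move=> [_ pZ] t u t0; apply/eqP; rewrite eq_le pZ//=.
have t10 : 0 < t^-1 by rewrite invr_gt0.
have := pZ t^-1 (ofR t *: u) t10.
rewrite scalerA -of_realM mulVf ?gt_eqF// of_real1 scale1r.
by rewrite -ler_pdivlMl ?invr_gt0// invrK.
Qed.

Lemma sublinear0 p : sublinear p -> p 0 = 0.
Proof.
move=> sp; have := sublinearZ sp 0 (ltr0n _ 2); rewrite scaler0 => h; lra.
Qed.

Lemma sublinear_geN p u : sublinear p -> - p (- u) <= p u.
Proof.
move=> sp; rewrite lerNl -subr_ge0 opprK.
by rewrite -(sublinear0 sp) -(addNr u); case: sp.
Qed.

(* The largest sublinear functional below p whose value at v is attained linearly. *)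
Lemma sublinear_direction p v : sublinear p -> exists q,
  [/\ sublinear q, forall u, q u <= p u & q (- v) <= - p v].
Proof.
move=> sp; have [pD pZ] := sp.
pose S u := [set p (u + ofR t *: v) - t * p v | t in [set t : R | 0 <= t]].
have S0 u : S u !=set0 by exists (p (u + ofR 0 *: v) - 0 * p v); exists 0 => //=.
have pvZ t : 0 <= t -> p (ofR t *: v) = t * p v.
  rewrite le_eqVlt => /predU1P[<-|]; last exact: sublinearZ.
  by rewrite of_real0 scale0r mul0r sublinear0.
have Slb u : lbound (S u) (- p (- u)).
  move=> _ [t /= t0 <-]; rewrite lerBrDr addrC lerBlDr -pvZ// addrC.
  by apply: le_trans (pD _ _); rewrite addrA addNr add0r.
have hS u : has_inf (S u) by split => //; exists (- p (- u)); exact: Slb.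
have infle u t : 0 <= t -> inf (S u) <= p (u + ofR t *: v) - t * p v.
  by move=> t0; apply: ge_inf; [case: (hS u)|exists t].
exists (fun u => inf (S u)); split; first split.
- move=> u w; apply/ler_addgt0Pr => e e0; have e20 : 0 < e / 2 by rewrite divr_gt0.
  have [_ [a /= a0 <-] au] := inf_adherent e20 (hS u).
  have [_ [b /= b0 <-] bw] := inf_adherent e20 (hS w).
  apply: le_trans (infle _ _ (addr_ge0 a0 b0)) _.
  have := pD (u + ofR a *: v) (w + ofR b *: v).
  by rewrite addrACA -scalerDl -of_realD mulrDl; lra.
- move=> t u t0; rewrite -ler_pdivrMl//; apply: lb_le_inf => // _ [a /= a0 <-].
  rewrite ler_pdivrMl// mulrBr -(sublinearZ sp)// scalerDr scalerA -of_realM mulrA.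
  by apply: infle; rewrite mulr_ge0// ltW.
- move=> u; have := infle u 0 (lexx _).
  by rewrite of_real0 scale0r addr0 mul0r subr0.
- have := infle (- v) 1 ler01.
  by rewrite of_real1 scale1r addNr mul1r sublinear0// sub0r.
Qed.

(** Minimality forces oddness: the functional given by [sublinear_direction] at [v] lies below [p],
    hence equals [p], and so [p (- v) <= - p v]. An odd subadditive functional is additive. *)
Lemma minimal_sublinear_linear p : sublinear p ->
  (forall q, sublinear q -> (forall u, q u <= p u) -> q = p) -> real_linear p.
Proof.
move=> sp pmin; have [pD pZ] := sp.
have pN v : p (- v) = - p v.
  have [q [sq qp qv]] := sublinear_direction v sp.
  apply/eqP; rewrite eq_le -{1}(pmin _ sq qp) qv/=.
  by have := sublinear_geN (- v) sp; rewrite opprK.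
split=> [u v|t u].
  apply/eqP; rewrite eq_le pD/=.
  by have := pD (u + v) (- v); rewrite addrK pN; lra.
have [t0|t0|->] := ltrgt0P t; first exact: sublinearZ.
  have -> : ofR t *: u = - (ofR (- t) *: u).
    by rewrite -scaleNr; congr (_ *: _); rewrite /of_real; case: k => //=;
      rewrite ?opprK// -rmorphN opprK.
  by rewrite pN sublinearZ ?oppr_gt0// mulNr opprK.
by rewrite of_real0 scale0r mul0r sublinear0.
Qed.

(** Zorn's lemma for the reversed pointwise order: a chain is bounded by its pointwise infimum,
    which is finite because every member dominates [- p (- u)], and a minimal sublinear functional
    is linear. *)
Lemma hahn_banach p : sublinear p ->
  exists l, real_linear l /\ forall u, l u <= p u.
Proof.
move=> sp.
pose T := {q : V -> R | sublinear q /\ forall u, q u <= p u}.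
pose mk q (sq : sublinear q) (qp : forall u, q u <= p u) : T :=
  exist (fun q : V -> R => sublinear q /\ forall u, q u <= p u) q (conj sq qp).
pose Rel (q r : T) := `[< forall u, sval r u <= sval q u >].
have [||||m mmin] := @Zorn T Rel.
- by move=> q; apply/asboolP.
- move=> q r s /asboolP qr /asboolP rs; apply/asboolP => u.
  exact: le_trans (rs u) (qr u).
- move=> [q hq] [r hr] /asboolP/= qr /asboolP/= rq.
  by apply: eq_exist => /=; apply/funext => u; apply/eqP; rewrite eq_le rq qr.
- move=> A Atot; have [[q0 Aq0]|A0] := pselect (A !=set0); last first.
    exists (mk p sp (fun u => lexx (p u))) => s As; exfalso.
    by apply: A0; exists s.
  pose S u := [set sval q u | q in A].
  have S0 u : S u !=set0 by exists (sval q0 u); exists q0.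
  have hS u : has_inf (S u).
    split => //; exists (- p (- u)) => _ [[q [sq qp]] _ <-] /=.
    by apply: le_trans (sublinear_geN _ sq); rewrite lerN2.
  have infle q u : A q -> inf (S u) <= sval q u.
    by move=> Aq; apply: ge_inf; [case: (hS u)|exists q].
  have si : sublinear (fun u => inf (S u)).
    split=> [u v|t u t0].
      apply/ler_addgt0Pr => e e0; have e20 : 0 < e / 2 by rewrite divr_gt0.
      have [_ [q Aq <-] qu] := inf_adherent e20 (hS u).
      have [_ [r Ar <-] rv] := inf_adherent e20 (hS v).
      have [/asboolP qr|/asboolP rq] := Atot _ _ Aq Ar.
        have := infle r (u + v) Ar; have [rD _] := (svalP r).1.
        by have := rD u v; have := qr u; lra.
      have := infle q (u + v) Aq; have [qD _] := (svalP q).1.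
      by have := qD u v; have := rq v; lra.
    rewrite -ler_pdivrMl//; apply: lb_le_inf => // _ [q Aq <-].
    by rewrite ler_pdivrMl// -(sublinearZ (svalP q).1)// infle.
  have ip u : inf (S u) <= p u.
    by apply: le_trans (infle _ u Aq0) _; case: (svalP q0).
  by exists (mk _ si ip) => q Aq; apply/asboolP => u /=; exact: infle.
have [sm mp] := svalP m; exists (sval m); split => //.
apply: minimal_sublinear_linear => // q sq qm.
have qp u : q u <= p u := le_trans (qm u) (mp u).
have /mmin mE : Rel m (mk q sq qp) by apply/asboolP.
by rewrite -mE.
Qed.

Lemma hahn_banach_at p v : sublinear p ->
  exists l, [/\ real_linear l, forall u, l u <= p u & l v = p v].
Proof.
move=> sp; have [q [sq qp qv]] := sublinear_direction v sp.
have [l [ll lq]] := hahn_banach sq; have lp u := le_trans (lq u) (qp u).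
exists l; split => //; apply/eqP; rewrite eq_le lp/=.
have lN : l (- v) = - l v.
  have [lD lZ] := ll; have l0 : l 0 = 0 by rewrite -(scale0r v) -of_real0 lZ mul0r.
  by apply/eqP; rewrite -subr_eq0 opprK -lD addNr l0.
by have := le_trans (lq (- v)) qv; rewrite lN lerN2.
Qed.

End sublinear_functionals.

End hahn_banach.

Section scalar_functionals.
Context {R : realType}.

Lemma real_part_inj (k : scalar_kind) (a b : scalar_field R k) :
  (forall c, real_part (c * a) = real_part (c * b)) -> a = b.
Proof.
case: k a b => [a b /(_ 1)|a b H]; first by rewrite /= !mul1r.
have := H 1; have := H (0 +i* 1)%C; case: a b {H} => [a1 a2] [b1 b2] /=.
rewrite /real_part/= !mul0r !mul1r !subr0 !sub0r => /oppr_inj -> ->.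
by [].
Qed.

Lemma real_partD (k : scalar_kind) (a b : scalar_field R k) :
  real_part (a + b) = real_part a + real_part b.
Proof. by case: k a b => //= -[? ?] [? ?]. Qed.

Lemma real_part_ofRM (k : scalar_kind) (t : R) (a : scalar_field R k) :
  real_part (of_real k t * a) = t * real_part a.
Proof. by case: k a => //= -[? ?] /=; rewrite mul0r subr0. Qed.

Lemma real_part_le (k : scalar_kind) (a : scalar_field R k) : real_part a <= rnorm a.
Proof.
case: k a => [a|[a b]]; first exact: ler_norm.
rewrite /rnorm normc_def /=; apply: le_trans (ler_norm _) _.
by rewrite -sqrtr_sqr ler_wsqrtr// lerDl sqr_ge0.
Qed.

(** A complex functional is determined by its real part, as [l u - i * l (i u)]. Real and imaginary
    parts are bounded separately, which costs the factor 2. *)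
Lemma real_functional_extension (k : scalar_kind) (V : lmodType (scalar_field R k))
    (N l : V -> R) : real_linear l -> (forall u, l u <= N u) ->
  (forall c u, N (c *: u) = rnorm c * N u) ->
  exists phi : {linear V -> (scalar_field R k)^o},
    (forall u, real_part (phi u) = l u) /\ forall u, rnorm (phi u) <= 2 * N u.
Proof.
move=> [lD lZ] lN NZ.
have l0 : l 0 = 0.
  by have := lZ 0 0; rewrite scaler0 mul0r.
have lopp u : l (- u) = - l u.
  by apply/eqP; rewrite -subr_eq0 opprK -lD addNr l0.
have Nopp u : N (- u) = N u.
  by rewrite -scaleN1r NZ rnormN rnorm1 mul1r.
have labs u : `|l u| <= N u.
  by rewrite ler_norml lN andbT lerNl -lopp -(Nopp u) lN.
have N0 u : 0 <= N u := le_trans (normr_ge0 _) (labs u).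
case: k V N l lD lZ lN NZ l0 lopp Nopp labs N0 => V N l lD lZ lN NZ l0 lopp Nopp labs N0.
  have phil : linear (l : V -> R^o) by move=> a u v; rewrite lD lZ.
  pose phi : {linear V -> R^o} := HB.pack (l : V -> R^o)
    (GRing.isLinear.Build _ _ _ _ _ phil).
  exists phi; split => // u; apply: le_trans (labs u) _.
  by rewrite ler_peMl// ler1n.
pose i : R[i]%C := (0 +i* 1)%C.
pose f u : R[i]%C := (l u +i* (- l (i *: u)))%C.
have fl : linear (f : V -> (R[i]%C)^o).
  move=> [a b] u v; apply/eqP; rewrite eq_complex /=.
  have abE w : ((a +i* b)%C : R[i]%C) *: w = (a%:C)%C *: w + (b%:C)%C *: (i *: w).
    rewrite scalerA -scalerDl; congr (_ *: _); apply/eqP; rewrite eq_complex /=.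
    by rewrite !mulr0 !mul0r !mulr1 !subr0 !addr0 !add0r !eqxx.
  have ii w : i *: (i *: w) = - w.
    rewrite scalerA -scaleN1r; congr (_ *: _); apply/eqP; rewrite eq_complex /=.
    by rewrite !mulr0 !mul0r !mulr1 !sub0r !addr0 oppr0 !eqxx.
  have -> : l ((a +i* b)%C *: u + v) = a * l u + b * l (i *: u) + l v.
    by rewrite lD abE lD (lZ a) (lZ b).
  have -> : l (i *: ((a +i* b)%C *: u + v)) = a * l (i *: u) - b * l u + l (i *: v).
    rewrite scalerDr lD scalerA mulrC -scalerA abE lD (lZ a) (lZ b) ii lopp.
    by rewrite mulrN.
  by apply/andP; split; apply/eqP; ring.
pose phi : {linear V -> (R[i]%C)^o} := HB.pack (f : V -> (R[i]%C)^o)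
    (GRing.isLinear.Build _ _ _ _ _ fl).
exists phi; split => // u.
have -> : (phi u : scalar_field R complex_scalars) =
    of_real complex_scalars (l u) + i * of_real complex_scalars (- l (i *: u)).
  by apply/eqP; rewrite eq_complex /= !mul0r !mulr0 !mul1r !subr0 !addr0 !add0r !eqxx.
apply: le_trans (rnormD _ _) _; rewrite rnormM !rnorm_of_real normrN.
have ri : rnorm (i : scalar_field R complex_scalars) = 1.
  by rewrite /rnorm normc_def /= expr0n /= add0r expr1n sqrtr1.
rewrite ri mul1r mulr_natl mulr2n lerD//.
by apply: le_trans (labs _) _; rewrite NZ ri mul1r.
Qed.

(** The sublinear functional is the infimum over [w] of [N (u - J w) + Re (f w)]: a real-linear
    functional below it is at most [N], and at most [Re f] along [J], where exchanging [w] and [- w]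
    turns the bound into an equality. *)
Lemma hahn_banach_extension (k : scalar_kind) (V W : lmodType (scalar_field R k))
    (N : V -> R) (J : {linear W -> V}) (f : {linear W -> (scalar_field R k)^o}) :
  (forall u v, N (u + v) <= N u + N v) -> (forall c u, N (c *: u) = rnorm c * N u) ->
  (forall w, rnorm (f w : scalar_field R k) <= N (J w)) ->
  exists phi : {linear V -> (scalar_field R k)^o},
    (forall w, phi (J w) = f w) /\ forall u, rnorm (phi u) <= 2 * N u.
Proof.
move=> ND NZ fN.
have Nopp u : N (- u) = N u by rewrite -scaleN1r NZ rnormN rnorm1 mul1r.
have N0 : N 0 = 0 by rewrite -(scale0r 0) NZ rnorm0 mul0r.
pose S u := [set N (u - J w) + real_part (f w : scalar_field R k) | w in setT].
have S0 u : S u !=set0 by exists (N (u - J 0) + real_part (f 0 : scalar_field R k)); exists 0.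
have Slb u : lbound (S u) (- N u).
  move=> _ [w _ <-].
  have := le_trans (real_part_le _) (fN (- w)).
  have := ND (u - J w) (- u); rewrite addrAC addrN add0r !Nopp.
  rewrite !raddfN/= Nopp => NJ.
  have -> : real_part (- f w : scalar_field R k) = - real_part (f w : scalar_field R k).
    by apply/eqP; rewrite -subr_eq0 opprK -real_partD addNr; case: (k).
  lra.
have hS u : has_inf (S u) by split => //; exists (- N u); exact: Slb.
have infle u w : inf (S u) <= N (u - J w) + real_part (f w : scalar_field R k).
  by apply: ge_inf; [case: (hS u)|exists w].
have sp : sublinear (fun u => inf (S u)).
  split=> [u v|t u t0].
    apply/ler_addgt0Pr => e e0; have e20 : 0 < e / 2 by rewrite divr_gt0.
    have [_ [a _ <-] au] := inf_adherent e20 (hS u).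
    have [_ [b _ <-] bv] := inf_adherent e20 (hS v).
    apply: le_trans (infle _ (a + b)) _.
    have := ND (u - J a) (v - J b); rewrite addrACA -opprD -raddfD.
    by rewrite (raddfD f) real_partD; lra.
  rewrite -ler_pdivrMl//; apply: lb_le_inf => // _ [a _ <-].
  rewrite ler_pdivrMl//; apply: le_trans (infle _ (of_real k t *: a)) _.
  rewrite !linearZ/= -scalerDr NZ rnorm_of_real_ge0 ?(ltW t0)//.
  by rewrite [_ *: f a]/(_ * _) real_part_ofRM mulrDr.
have [l [ll lp]] := hahn_banach sp.
have lN u : l u <= N u.
  apply: le_trans (lp u) _; have := infle u 0; rewrite (raddf0 J) subr0 (raddf0 f).
  have -> : real_part (0 : scalar_field R k) = 0 by case: (k).
  by rewrite addr0.
have lJ w : l (J w) <= real_part (f w : scalar_field R k).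
  by apply: le_trans (lp _) _; have := infle (J w) w; rewrite subrr N0 add0r.
have [phi [phil phiN]] := real_functional_extension ll lN NZ.
exists phi; split => // w; apply: real_part_inj => c.
have cphi : c * (phi (J w) : scalar_field R k) = phi (J (c *: w)) by rewrite !linearZ.
have cf : c * (f w : scalar_field R k) = f (c *: w) by rewrite linearZ.
rewrite cphi cf phil; apply/eqP; rewrite eq_le lJ/=.
have := lJ (- (c *: w)); have [lD lZ] := ll.
have l0 : l 0 = 0 by have := lZ 0 0; rewrite scaler0 mul0r.
have lopp u : l (- u) = - l u.
  by apply/eqP; rewrite -subr_eq0 opprK -lD addNr l0.
rewrite !raddfN/= lopp.
have -> : real_part (- f (c *: w) : scalar_field R k) = - real_part (f (c *: w) : scalar_field R k).
  by apply/eqP; rewrite -subr_eq0 opprK -real_partD addNr; case: (k).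
by rewrite lerN2.
Qed.

Lemma separating_functional (k : scalar_kind) (E : normedModType (scalar_field R k)) (x : E) :
  x != 0 -> exists phi : {linear E -> (scalar_field R k)^o},
    (forall u, rnorm (phi u) <= 2 * rnorm u) /\ phi x != 0.
Proof.
move=> x0; have sp : sublinear (fun u : E => rnorm u).
  split=> [u v|t u t0]; first exact: rnormD.
  by rewrite rnormZ rnorm_of_real_ge0// ltW.
have [l [ll lN lx]] := hahn_banach_at x sp.
have [phi [phil phiN]] := real_functional_extension ll lN (fun c u => rnormZ c u).
exists phi; split => //; apply: contra x0 => /eqP phix; apply/eqP.
by apply: rnorm0_eq0; rewrite -lx -phil phix; case: (k).
Qed.

End scalar_functionals.

(** * Rademacher sums *)

Section conjugation.
Context {R : realType} {k : scalar_kind}.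
Local Notation K := (scalar_field R k).
Local Notation ofR := (@of_real R k).

Definition kconj : K -> K :=
  match k with
  | real_scalars => fun z => z
  | complex_scalars => fun z => (z^*)%C
  end.

Lemma kconj_is_additive (a b : K) : kconj (a - b) = kconj a - kconj b.
Proof. by rewrite /kconj; case: k a b => //= -[? ?] [? ?]; rewrite rmorphB. Qed.

HB.instance Definition _ := GRing.isZmodMorphism.Build K K kconj kconj_is_additive.

Lemma kconjM (a b : K) : kconj (a * b) = kconj a * kconj b.
Proof. by rewrite /kconj; case: k a b => //= a b; rewrite rmorphM. Qed.

Lemma kconjK : involutive kconj.
Proof. by rewrite /kconj; case: k => //= -[a b]; rewrite /= opprK. Qed.

Lemma kconj_ofR (t : R) : kconj (ofR t) = ofR t.
Proof. by rewrite /kconj /of_real; case: k => //=; rewrite oppr0. Qed.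

Lemma kconj_mul (z : K) : kconj z * z = ofR (rnorm z ^+ 2).
Proof.
rewrite /kconj /of_real /rnorm; case: k z => [z/=|[a b]].
  by rewrite real_normK ?num_real// expr2.
rewrite normc_def /= sqr_sqrtr ?addr_ge0 ?sqr_ge0//.
by apply/eqP; rewrite eq_complex /=; apply/andP; split; apply/eqP; ring.
Qed.

Lemma rnorm_kconj (z : K) : rnorm (kconj z) = rnorm z.
Proof.
by rewrite /kconj /rnorm; case: k z => [//|[a b]]; rewrite !normc_def /= sqrrN.
Qed.

Lemma of_real_is_additive (a b : R) : ofR (a - b) = ofR a - ofR b.
Proof. by rewrite /of_real; case: k => //=; rewrite rmorphB. Qed.

HB.instance Definition _ := GRing.isZmodMorphism.Build R K ofR of_real_is_additive.

Lemma of_real_nat n : ofR n%:R = n%:R.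
Proof. by rewrite raddfMn/= of_real1. Qed.

Lemma of_realV (t : R) : ofR t^-1 = (ofR t)^-1.
Proof.
have [->|t0] := eqVneq t 0; first by rewrite invr0 of_real0 invr0.
have ot0 : ofR t != 0 by rewrite -(of_real0 R k) (inj_eq (@of_real_inj _ _)).
by apply: (mulfI ot0); rewrite -of_realM !mulfV// of_real1.
Qed.

(** For complex scalars [c = -i] extracts the imaginary part; for real ones [c = 0]. Moment
    estimates for scalars thus reduce to two real ones, uniformly in the scalar field. *)
Lemma rnorm_coordinates : exists2 c : K, rnorm c <= 1 &
  forall z : K, rnorm z <= `|real_part z| + `|real_part (c * z)|.
Proof.
rewrite /rnorm /real_part; case: k.
  by exists 0 => [|z]; rewrite ?normr0// mul0r normr0 addr0.
exists (0 +i* (-1))%C => [|[a b]].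
  by rewrite normc_def /= expr0n /= add0r sqrrN expr1n sqrtr1.
rewrite normc_def /= mul0r mulN1r sub0r opprK.
rewrite -(ger0_norm (addr_ge0 (normr_ge0 a) (normr_ge0 b))) -[leRHS]sqrtr_sqr.
rewrite ler_wsqrtr// sqrrD !real_normK ?num_real// -addrA lerD2l lerDr.
by rewrite mulrn_wge0 ?mulr_ge0.
Qed.

End conjugation.

Section orthogonal_systems.
Context {R : realType} {k : scalar_kind}.
Local Notation K := (scalar_field R k).
Local Notation ofR := (@of_real R k).
Variables (I J : finType) (U : I -> J -> K) (c : R).
Hypothesis orthU : forall j j', \sum_i kconj (U i j) * U i j' = ofR (c *+ (j == j')).

Lemma orth_isometry (x : J -> K) :
  \sum_i rnorm (\sum_j U i j * x j) ^+ 2 = c * \sum_j rnorm (x j) ^+ 2.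
Proof.
apply: (@of_real_inj R k); rewrite of_realM !raddf_sum /= mulr_sumr.
under eq_bigr do rewrite -kconj_mul raddf_sum/= mulr_suml.
rewrite exchange_big/=; apply: eq_bigr => j _.
rewrite -kconj_mul.
transitivity (\sum_j' (\sum_i kconj (U i j) * U i j') * (kconj (x j) * x j')).
  rewrite (eq_bigr (fun i => \sum_j' kconj (U i j * x j) * (U i j' * x j'))); last first.
    by move=> i _; rewrite mulr_sumr.
  rewrite exchange_big/=; apply: eq_bigr => j' _; rewrite mulr_suml.
  by apply: eq_bigr => i _; rewrite kconjM; ring.
rewrite (bigD1 j)//= orthU eqxx mulr1n big1 ?addr0// => j' jj'.
by rewrite orthU eq_sym (negbTE jj') mulr0n of_real0 mul0r.
Qed.

(** The adjoint of a multiple of an isometry has the same norm. Directly: for [y = U^* F] the number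
    [S = ||y||^2] is the inner product of [U y] with [F], while [||U y||^2 = c * S], and the two are
    compared by the inequality of means. *)
Lemma orth_bessel (F : I -> K) : 0 < c ->
  \sum_j rnorm (\sum_i kconj (U i j) * F i) ^+ 2 <= c * \sum_i rnorm (F i) ^+ 2.
Proof.
move=> c0; pose y j := \sum_i kconj (U i j) * F i.
pose G i := \sum_j U i j * y j.
pose S := \sum_j rnorm (y j) ^+ 2.
have GE : \sum_i rnorm (G i) ^+ 2 = c * S := orth_isometry y.
have SE : S = \sum_j rnorm (y j) ^+ 2 by [].
rewrite -[leLHS]/S.
have : ofR S = \sum_i kconj (G i) * F i.
  rewrite SE raddf_sum/= (eq_bigr (fun j => \sum_i kconj (y j) * (kconj (U i j) * F i))); last first.
    by move=> j _; rewrite -kconj_mul -mulr_sumr.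
  rewrite exchange_big/=; apply: eq_bigr => i _; rewrite /G raddf_sum/= mulr_suml.
  by apply: eq_bigr => j _; rewrite kconjM; ring.
move=> /(congr1 rnorm); rewrite rnorm_of_real_ge0; last first.
  by rewrite SE sumr_ge0// => *; rewrite sqr_ge0.
move=> SG; suff : 2 * S <= c * (\sum_i rnorm (F i) ^+ 2) + c^-1 * (c * S).
  by rewrite mulKf ?gt_eqF//; lra.
rewrite {1}SG SE -GE.
apply: le_trans (ler_wpM2l (ler0n _ 2) (rnorm_sum _ _ _)) _.
rewrite !mulr_sumr -big_split/=; apply: ler_sum => i _.
rewrite rnormM rnorm_kconj -subr_ge0 -/(G i).
have -> : c * rnorm (F i) ^+ 2 + c^-1 * rnorm (G i) ^+ 2 - 2 * (rnorm (G i) * rnorm (F i)) =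
    c^-1 * (c * rnorm (F i) - rnorm (G i)) ^+ 2 by field; rewrite gt_eqF.
by rewrite mulr_ge0 ?sqr_ge0// invr_ge0 ltW.
Qed.

End orthogonal_systems.

Section random_signs.
Context {R : realType} {k : scalar_kind}.
Local Notation K := (scalar_field R k).
Local Notation ofR := (@of_real R k).

Definition sgn (I : finType) (w : {ffun I -> bool}) (i : I) : R := (-1) ^+ w i.

Lemma sum_sgnM (I : finType) (i j : I) :
  \sum_(w : {ffun I -> bool}) sgn w i * sgn w j = #|{ffun I -> bool}|%:R *+ (i == j).
Proof.
have [<-|ij] := eqVneq i j.
  rewrite (eq_bigr (fun=> 1)) => [|w _]; first by rewrite sumr_const mulr1n.
  by rewrite /sgn -exprD addnn -mul2n exprM sqrrN expr1n expr1n.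
(* Flipping the sign at [i] alone is an involution that negates every summand. *)
pose h (w : {ffun I -> bool}) := [ffun x => if x == i then ~~ w x else w x].
have hK : involutive h.
  by move=> w; apply/ffunP => x; rewrite !ffunE; case: eqP => // _; rewrite negbK.
rewrite mulr0n; set S := LHS; suff : S = - S by lra.
rewrite {1}/S (reindex_inj (inv_inj hK))/= -sumrN; apply: eq_bigr => w _.
rewrite /sgn !ffunE eqxx eq_sym (negbTE ij); case: (w i) => /=; ring.
Qed.

Lemma orth_sgn (I : finType) (i j : I) :
  \sum_(w : {ffun I -> bool}) kconj (ofR (sgn w i)) * ofR (sgn w j) =
  ofR (#|{ffun I -> bool}|%:R *+ (i == j)).
Proof.
rewrite -sum_sgnM raddf_sum/=; apply: eq_bigr => w _.
by rewrite kconj_ofR of_realM.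
Qed.

(** The exponent [2 * x^2] in place of [x^2 / 2] lets everything follow from [1 + x <= exp x]: for
    [|x| <= 1/2] one has [exp x <= 1 / (1 - x) <= 1 + x + 2 * x^2], and for larger [|x|] already
    [|x| <= 2 * x^2]. *)
Lemma cosh_le (x : R) : expR x + expR (- x) <= 2 * expR (2 * x ^+ 2).
Proof.
have small (y : R) : `|y| <= 1 / 2 -> expR y <= 1 + y + 2 * y ^+ 2.
  move=> y2; have y12 : y <= 1/2 := le_trans (ler_norm y) y2.
  have h := expR_ge1Dx (- y); rewrite expRN in h.
  have y0 : 0 < 1 - y by lra.
  have : expR y <= (1 - y)^-1 by rewrite -[leLHS]invrK lef_pV2 ?posrE ?invr_gt0 ?expR_gt0.
  move=> /le_trans; apply; rewrite -div1r ler_pdivrMr//.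
  have -> : (1 + y + 2 * y ^+ 2) * (1 - y) = 1 + y ^+ 2 * (1 - 2 * y) by ring.
  by rewrite lerDl mulr_ge0 ?sqr_ge0//; lra.
have [x2|x2] := leP `|x| (1 / 2).
  apply: (@le_trans _ _ (2 * (1 + 2 * x ^+ 2))).
    have := small x x2; have := small (- x); rewrite normrN => /(_ x2).
    by rewrite sqrrN; lra.
  by rewrite ler_wpM2l// expR_ge1Dx.
have xx : `|x| <= 2 * x ^+ 2.
  rewrite -[x ^+ 2]real_normK ?num_real// expr2 mulrA -[leLHS]mul1r ler_wpM2r//; lra.
rewrite mulr_natl mulr2n lerD// ler_expR.
  exact: le_trans (ler_norm x) xx.
by apply: le_trans xx; rewrite -normrN ler_norm.
Qed.

Lemma sum_sgn_expR (I : finType) (x : I -> R) :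
  \sum_(w : {ffun I -> bool}) expR (\sum_i sgn w i * x i) <=
  #|{ffun I -> bool}|%:R * expR (2 * \sum_i x i ^+ 2).
Proof.
have -> : \sum_(w : {ffun I -> bool}) expR (\sum_i sgn w i * x i) =
    \prod_i (expR (x i) + expR (- x i)).
  rewrite (eq_bigr (fun w : {ffun I -> bool} => \prod_i expR ((-1) ^+ w i * x i))); last first.
    by move=> w _; rewrite expR_sum.
  rewrite -(bigA_distr_bigA (fun i (b : bool) => expR ((-1) ^+ b * x i)))/=.
  apply: eq_bigr => i _.
  by rewrite big_bool/= expr1 expr0 mul1r mulN1r addrC.
apply: (@le_trans _ _ (\prod_(i : I) (2 * expR (2 * x i ^+ 2)))).
  apply: ler_prod => i _; rewrite cosh_le andbT.
  by rewrite addr_ge0 ?expR_ge0.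
by rewrite big_split/= prodr_const card_ffun card_bool natrX mulr_sumr expR_sum.
Qed.

Lemma powR_le_expR (q : R) : 0 < q -> exists2 C : R, 0 < C &
  forall x, `|x| `^ q <= C * (expR x + expR (- x)).
Proof.
move=> q0; pose n := Num.truncn q.
have qn : q <= n.+1%:R by rewrite ltW// truncnS_gt.
have f1 : 1 <= n.+1`!%:R :> R by rewrite ler1n fact_gt0.
exists n.+1`!%:R => [|x]; first by rewrite ltr0n fact_gt0.
have e2 : expR `|x| <= expR x + expR (- x).
  have [x0|x0] := leP 0 x; first by rewrite ger0_norm// lerDl expR_ge0.
  by rewrite ltr0_norm// lerDr expR_ge0.
apply: (@le_trans _ _ (n.+1`!%:R * expR `|x|)); last by rewrite ler_wpM2l.
have := @expR_ge1Dxn R `|x| n (normr_ge0 _).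
have [x1|x1] := leP `|x| 1.
  move=> _; apply: (@le_trans _ _ 1).
    by have := ler_powR_base (ltW q0) (normr_ge0 x) x1; rewrite powR1.
  rewrite -[leLHS]mulr1 ler_pM//.
  by apply: le_trans (expR_ge1Dx _); rewrite lerDl.
move=> H; apply: (@le_trans _ _ (`|x| `^ n.+1%:R)); first by rewrite ler_powR// ltW.
rewrite powR_mulrn// -ler_pdivrMl ?ltr0n ?fact_gt0// mulrC.
by apply: le_trans H; rewrite lerDr.
Qed.

(** After division by the [l_2] norm, [|x|^q] is dominated by a multiple of [exp x + exp (- x)], and
    independence makes the exponential moment of a sign sum a product of hyperbolic cosines. *)
Lemma khintchine (q : R) : 0 < q -> exists2 C : R, 0 < C &
  forall (I : finType) (a : I -> K),
    \sum_(w : {ffun I -> bool}) rnorm (\sum_i ofR (sgn w i) * a i) `^ q <=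
    #|{ffun I -> bool}|%:R * (C * (\sum_i rnorm (a i) ^+ 2) `^ (q / 2)).
Proof.
move=> q0; have [C C0 HC] := powR_le_expR q0.
(* Each of the two real coordinates contributes [2 * C * expR 2], one exponential for each sign of
   [x]; [2^q] comes from [a + b <= 2 * max(a, b)]. *)
exists (2 `^ q * (4 * C * expR 2)) => [|I a].
  by rewrite !mulr_gt0 ?expR_gt0// powR_gt0.
set N := #|_|; set S := \sum_i rnorm (a i) ^+ 2.
have S0 : 0 <= S by apply: sumr_ge0 => i _; rewrite sqr_ge0.
have [S00|Sn0] := eqVneq S 0.
  have a0 i : a i = 0.
    apply: rnorm0_eq0; apply/eqP; rewrite -sqrf_eq0; apply/eqP.
    exact: (psumr_eq0P (fun i _ => sqr_ge0 (rnorm (a i))) S00).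
  rewrite big1 => [|w _]; first by rewrite !mulr_ge0 ?powR_ge0 ?expR_ge0// ltW.
  by rewrite big1 ?rnorm0 ?powR0 ?gt_eqF// => i _; rewrite a0 mulr0.
pose s := Num.sqrt S; have Sp : 0 < S by rewrite lt_def Sn0.
have s0 : 0 < s by rewrite sqrtr_gt0.
have sS : s ^+ 2 = S by rewrite sqr_sqrtr.
have -> : S `^ (q / 2) = s `^ q.
  by rewrite -sS -powR_mulrn ?ltW// -powRrM mulrCA mulfV ?mulr1.
have [J J1 HJ] := @rnorm_coordinates R k.
have moment (c : K) : rnorm c <= 1 ->
    \sum_(w : {ffun I -> bool}) `|real_part (c * \sum_i ofR (sgn w i) * a i)| `^ q <=
    N%:R * (2 * C * expR 2 * s `^ q).
  move=> c1; pose x i := s^-1 * real_part (c * a i).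
  have x2 : \sum_i x i ^+ 2 <= 1.
    rewrite -(mulVf Sn0) [leRHS]mulr_sumr; apply: ler_sum => i _.
    rewrite exprMn exprVn sS ler_wpM2l ?invr_ge0//.
    have rc (z : K) : real_part z ^+ 2 <= rnorm z ^+ 2.
      rewrite -[leLHS]real_normK ?num_real// lerXn2r ?nnegrE ?rnorm_ge0//.
      rewrite ler_norml real_part_le andbT lerNl.
      have -> : - real_part z = real_part (- z).
        by apply/eqP; rewrite -subr_eq0 -opprD oppr_eq0 -real_partD subrr; case: (k).
      by rewrite -(rnormN z) real_part_le.
    apply: le_trans (rc _) _; rewrite rnormM lerXn2r ?nnegrE ?mulr_ge0 ?rnorm_ge0//.
    by rewrite -[leRHS]mul1r ler_wpM2r ?rnorm_ge0.
  have xE (w : {ffun I -> bool}) :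
      real_part (c * \sum_i ofR (sgn w i) * a i) = s * \sum_i sgn w i * x i.
    rewrite mulr_sumr (big_morph _ (@real_partD R k) (_ : _ = 0)); last by case: (k).
    rewrite mulr_sumr; apply: eq_bigr => i _; rewrite mulrCA real_part_ofRM /x.
    by rewrite mulrCA (mulrA s) mulfV ?gt_eqF// mul1r.
  under eq_bigr do rewrite xE normrM powRM// (gtr0_norm s0).
  have -> : N%:R * (2 * C * expR 2 * s `^ q) =
      s `^ q * (C * (N%:R * expR 2 + N%:R * expR 2)) by ring.
  rewrite -mulr_sumr ler_wpM2l ?powR_ge0//.
  apply: le_trans (ler_sum _ (fun w _ => HC (\sum_i sgn w i * x i))) _.
  rewrite -mulr_sumr big_split/=.
  have e1 := sum_sgn_expR x; have e2 := sum_sgn_expR (fun i => - x i).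
  rewrite (eq_bigr (fun i => x i ^+ 2)) in e2; last by move=> i _; rewrite sqrrN.
  have e3 : expR (2 * \sum_i x i ^+ 2) <= expR 2 by rewrite ler_expR; lra.
  have NN : 0 <= N%:R :> R by [].
  have e4 := ler_wpM2l NN e3.
  rewrite ler_wpM2l ?(ltW C0)//; apply: lerD.
    exact: le_trans e1 e4.
  apply: le_trans e4; apply: le_trans e2; apply: ler_sum => w _.
  by rewrite ler_expR -sumrN; apply: ler_sum => i _; rewrite mulrN.
have one1 : rnorm (1 : K) <= 1 by rewrite rnorm1.
have h : N%:R * (2 `^ q * (4 * C * expR 2) * s `^ q) =
    2 `^ q * (N%:R * (2 * C * expR 2 * s `^ q) + N%:R * (2 * C * expR 2 * s `^ q)) by ring.
rewrite h; apply: le_trans (ler_wpM2l (powR_ge0 _ _) (lerD (moment 1 one1) (moment J J1))).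
rewrite -big_split/= mulr_sumr; apply: ler_sum => w _; set z := \sum_i _.
rewrite mul1r; apply: le_trans (ler_powR_base (ltW q0) (rnorm_ge0 _) (HJ z)) _.
set a1 := `|_|; set b1 := `|_|.
have a10 : 0 <= a1 := normr_ge0 _; have b10 : 0 <= b1 := normr_ge0 _.
have [ab|ba] := leP a1 b1.
  apply: (@le_trans _ _ ((2 * b1) `^ q)).
    by apply: ler_powR_base; rewrite ?addr_ge0 ?(ltW q0)// mulr_natl mulr2n lerD2r.
  by rewrite powRM// ler_wpM2l ?powR_ge0// lerDr powR_ge0.
apply: (@le_trans _ _ ((2 * a1) `^ q)).
  by apply: ler_powR_base; rewrite ?addr_ge0 ?(ltW q0)// mulr_natl mulr2n lerD2l ltW.
by rewrite powRM// ler_wpM2l ?powR_ge0// lerDl powR_ge0.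
Qed.

Definition trunc (c : R) (z : K) : K := if rnorm z <= c then z else 0.

Lemma rnorm_trunc (c : R) z : 0 <= c -> rnorm (trunc c z) <= c.
Proof. by rewrite /trunc => c0; case: ifP => //; rewrite rnorm0. Qed.

Lemma rnorm_trunc_le (c : R) z : rnorm (trunc c z) <= rnorm z.
Proof. by rewrite /trunc; case: ifP => // _; rewrite rnorm0 rnorm_ge0. Qed.

(** Chebyshev's argument with the fourth moment: where [|f| > t * s], one has
    [|f|^2 <= |f|^4 / (t * s)^2], and Khintchine's inequality bounds the mean of [|f|^4] by
    [C * s^4]. A large [t] makes the remainder small in [L_2], whatever the number of terms. *)
Lemma trunc_remainder : exists2 C : R, 0 < C &
  forall (I : finType) (a : I -> K) (s t : R), 0 < t -> 0 <= s ->
    s ^+ 2 = \sum_i rnorm (a i) ^+ 2 ->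
    \sum_(w : {ffun I -> bool}) rnorm (\sum_i ofR (sgn w i) * a i -
       trunc (t * s) (\sum_i ofR (sgn w i) * a i)) ^+ 2 <=
    #|{ffun I -> bool}|%:R * (C / t ^+ 2 * s ^+ 2).
Proof.
have [C C0 HC] := @khintchine 4 (ltr0n _ 4).
exists C => // I a s t t0 s0 sa; have := HC I a; rewrite -sa.
have -> : (s ^+ 2) `^ (4 / 2) = s ^+ 4.
  have -> : 4 / 2 = 2%:R :> R by field.
  by rewrite powR_mulrn ?sqr_ge0// -exprM.
under eq_bigr do rewrite powR_mulrn ?rnorm_ge0//.
set N := #|_|; move=> H.
have [s00|sn0] := eqVneq s 0.
  move: H; rewrite s00 !mulr0 !expr0n/= !mulr0 => H.
  rewrite le_eqVlt; apply/orP; left; apply/eqP.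
  apply: big1 => w _; rewrite /trunc.
  have w4 : rnorm (\sum_i ofR (sgn w i) * a i) ^+ 4 = 0.
    have f0 (v : {ffun I -> bool}) : true -> 0 <= rnorm (\sum_i ofR (sgn v i) * a i) ^+ 4.
      by move=> _; rewrite exprn_ge0 ?rnorm_ge0.
    apply: (psumr_eq0P f0) => //.
    by apply/eqP; rewrite eq_le H sumr_ge0.
  have -> : \sum_i ofR (sgn w i) * a i = 0.
    by apply: rnorm0_eq0; apply/eqP; move/eqP: w4; rewrite expf_eq0.
  by rewrite rnorm0 lexx subr0 rnorm0 expr0n.
have sp : 0 < s by rewrite lt_def sn0.
have ts0 : 0 < (t * s) ^+ 2 by rewrite exprn_gt0// mulr_gt0.
rewrite -(ler_pM2l ts0).
have -> : (t * s) ^+ 2 * (N%:R * (C / t ^+ 2 * s ^+ 2)) = N%:R * (C * s ^+ 4).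
  by field; rewrite gt_eqF.
apply: le_trans H; rewrite mulr_sumr; apply: ler_sum => w _; set f := \sum_i _.
rewrite /trunc; case: (leP (rnorm f) (t * s)) => [_|tf].
  by rewrite subrr rnorm0 expr0n/= mulr0 exprn_ge0// rnorm_ge0.
rewrite subr0 (exprD (rnorm f) 2 2) ler_wpM2r ?sqr_ge0//.
by rewrite lerXn2r ?nnegrE ?rnorm_ge0 ?mulr_ge0// ltW.
Qed.

End random_signs.

(** * The spaces l_s and c_0 *)

Section lbar_basics.
Context {R : realType} {k : scalar_kind}.
Local Notation K := (scalar_field R k).
Local Notation ofR := (@of_real R k).

Lemma exponentP (s : exponent R) :
  (exists2 r : R, 1 <= r & exponent_val s = r%:E) \/ exponent_val s = +oo%E.
Proof.
case: s => [[r| |] r1] /=; [left; exists r => //|by right|by []].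
Qed.

Variable s : exponent R.
Implicit Types x y : lbar k s.

Lemma lbarDE x y n : (x + y) n = x n + y n. Proof. by []. Qed.
Lemma lbarBE x y n : (x - y) n = x n - y n. Proof. by []. Qed.
Lemma lbarZE (c : K) x n : (c *: x) n = c * x n. Proof. by []. Qed.
Lemma lbar0E n : (0 : lbar k s) n = 0. Proof. by []. Qed.
Lemma lbar_sumE (I : Type) (r : seq I) (P : pred I) (x : I -> lbar k s) n :
  (\sum_(i <- r | P i) x i) n = \sum_(i <- r | P i) x i n.
Proof. by elim/big_rec2 : _ => // i y z _ <-. Qed.

Lemma lbarP x y : (forall n, x n = y n) -> x = y.
Proof. by move=> xy; apply/val_inj/funext. Qed.

Lemma rnorm_coord x n : rnorm (x n) <= rnorm x.
Proof.
by rewrite rnorm_lbar -lee_fin lbar_normE rnorm_le_seq_norm// exponent_ge1.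
Qed.

Lemma rnorm_lbar_le x (c : R) : (seq_norm s x <= c%:E)%E = (rnorm x <= c).
Proof. by rewrite rnorm_lbar -lee_fin lbar_normE. Qed.

Lemma rnorm_lbarP (r c : R) x : 1 <= r -> exponent_val s = r%:E -> 0 <= c ->
  rnorm x <= c <-> forall N, \sum_(n < N) rnorm (x n) `^ r <= c `^ r.
Proof. by move=> r1 sr c0; rewrite -rnorm_lbar_le sr seq_norm_leP. Qed.

Lemma rnorm_lbar_ooP (c : R) x : exponent_val s = +oo%E ->
  rnorm x <= c <-> forall n, rnorm (x n) <= c.
Proof. by move=> soo; rewrite -rnorm_lbar_le soo seq_norm_ooP. Qed.

Lemma lbar_ooP (u : nat -> K) : exponent_val s = +oo%E ->
  (forall e : R, 0 < e -> exists N, forall n, (N <= n)%N -> rnorm (u n) <= e) ->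
  exists y : lbar k s, forall n, y n = u n.
Proof.
move=> soo uc; suff us : u \in @lbar_pred R k s by exists (Lbar us).
rewrite inE /= soo eqxx; apply/(@cvg_seq_rnormP _ _ K^o) => e /uc[N HN].
by exists N => n /HN; rewrite sub0r rnormN.
Qed.

Lemma lbar_finP (r c : R) (u : nat -> K) : 1 <= r -> exponent_val s = r%:E -> 0 <= c ->
  (forall N, \sum_(n < N) rnorm (u n) `^ r <= c `^ r) ->
  exists y : lbar k s, forall n, y n = u n.
Proof.
move=> r1 sr c0 uc; suff us : u \in @lbar_pred R k s by exists (Lbar us).
rewrite inE /= sr /=; apply: (@le_lt_trans _ _ c%:E); last exact: ltry.
exact/(@seq_norm_leP _ _ K^o).
Qed.

Lemma lbar_cvg0 x : exponent_val s = +oo%E -> forall e : R, 0 < e ->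
  exists N, forall n, (N <= n)%N -> rnorm (x n) <= e.
Proof.
move=> soo e e0; have : lbar_val x \in @lbar_pred R k s := valP x.
rewrite inE /= soo eqxx => /(@cvg_seq_rnormP _ _ K^o)/(_ _ e0)[N HN].
by exists N => n /HN; rewrite sub0r rnormN.
Qed.

(** [l_s] and [c_0] are solid. Many later elements of [lbar k s] are obtained by domination, which
    treats finite and infinite exponents at once. *)
Lemma lbar_dominated (u : nat -> K) (C : R) x : 0 <= C ->
  (forall n, rnorm (u n) <= C * rnorm (x n)) ->
  exists2 y : lbar k s, (forall n, y n = u n) & rnorm y <= C * rnorm x.
Proof.
move=> C0 ux; have Cx0 : 0 <= C * rnorm x by rewrite mulr_ge0 ?rnorm_ge0.
have [[r r1 sr]|soo] := exponentP s.
  have r0 : 0 <= r by rewrite (le_trans _ r1).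
  have uN N : \sum_(n < N) rnorm (u n) `^ r <= (C * rnorm x) `^ r.
    rewrite powRM ?rnorm_ge0//.
    have /(rnorm_lbarP _ r1 sr (rnorm_ge0 _))/(_ N) xN := lexx (rnorm x).
    apply: le_trans (ler_wpM2l (powR_ge0 _ _) xN); rewrite mulr_sumr.
    by apply: ler_sum => n _; rewrite -powRM ?rnorm_ge0// ler_powR_base ?rnorm_ge0.
  have [y yu] := @lbar_finP r _ u r1 sr Cx0 uN; exists y => //.
  by apply/(rnorm_lbarP _ r1 sr) => // N; under eq_bigr do rewrite yu.
have [|y yu] := lbar_ooP soo (u := u).
  move=> e e0; have e0' : 0 < e / (C + 1) by rewrite divr_gt0// ltr_wpDl.
  have [N HN] := lbar_cvg0 x soo e0'; exists N => n /HN xn.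
  apply: le_trans (ux n) _; apply: le_trans (ler_wpM2l C0 xn) _.
  by rewrite mulrCA ger_pMr// ler_pdivrMr ?ltr_wpDl// mul1r lerDl.
exists y => //; apply/(rnorm_lbar_ooP _ _ soo) => n; rewrite yu.
by apply: le_trans (ux n) _; rewrite ler_wpM2l// rnorm_coord.
Qed.

Lemma lbar_finite_support (u : nat -> K) N : (forall n, (N <= n)%N -> u n = 0) ->
  exists y : lbar k s, forall n, y n = u n.
Proof.
move=> uN; have [[r r1 sr]|soo] := exponentP s.
  have r0 : 0 < r by rewrite (lt_le_trans _ r1).
  pose c := \sum_(n < N) rnorm (u n) `^ r.
  have c0 : 0 <= c by apply: sumr_ge0 => *; exact: powR_ge0.
  apply: (@lbar_finP r (c `^ r^-1)) => //; first exact: powR_ge0.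
  move=> M; rewrite powR_invK ?gt_eqF// /c.
  have uM M' : \sum_(n < N + M') rnorm (u n) `^ r = c.
    rewrite big_split_ord/= [X in _ + X]big1 ?addr0// => i _.
    by rewrite uN ?leq_addr// rnorm0 powR0// gt_eqF.
  rewrite -/c -(uM M); apply: (@ler_sum_ord_le _ (fun n => rnorm (u n) `^ r)); last exact: leq_addl.
  by move=> i; exact: powR_ge0.
apply: lbar_ooP => // e e0; exists N => n /uN ->.
by rewrite rnorm0 ltW.
Qed.

Definition lbar_unit n : lbar k s :=
  projT1 (cid (@lbar_finite_support (fun m => if m == n then 1 else 0) n.+1
    (fun m nm => ifN_eq _ _ (negbT (gtn_eqF nm))))).

Lemma lbar_unitE n m : lbar_unit n m = (m == n)%:R.
Proof. by rewrite /lbar_unit; case: cid => y /= ->; case: eqP. Qed.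

Lemma rnorm_lbar_unit n : rnorm (lbar_unit n) = 1.
Proof.
rewrite rnorm_lbar; apply/EFin_inj; rewrite lbar_normE.
rewrite (_ : lbar_val _ = (fun m => if m == n then (1 : K) else 0)).
  by rewrite (@seq_norm_delta _ _ _ (exponent_ge1 s) K^o) rnorm1.
by apply/funext => m; rewrite lbar_unitE; case: eqP.
Qed.

Definition lbar_coord n (x : lbar k s) : K^o := x n.

Lemma lbar_coord_is_linear n : linear (lbar_coord n).
Proof. by []. Qed.

HB.instance Definition _ n :=
  GRing.isLinear.Build K (lbar k s) K^o *:%R (lbar_coord n) (lbar_coord_is_linear n).

(** 2-convexity: the squared norm of the square function is the [l_(s/2)] norm of the sum of the
    sequences [|x_i|^2], and [s >= 2] provides the triangle inequality in [l_(s/2)]. In [c_0] the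
    bound holds coordinate by coordinate. *)
Lemma lbar_square_function (I : finType) (x : I -> lbar k s) : (2%:E <= s)%E ->
  exists2 y : lbar k s, (forall n, y n = ofR (Num.sqrt (\sum_i rnorm (x i n) ^+ 2))) &
    rnorm y ^+ 2 <= \sum_i rnorm (x i) ^+ 2.
Proof.
move=> s2; set B := \sum_i rnorm (x i) ^+ 2.
have B0 : 0 <= B by apply: sumr_ge0 => i _; exact: sqr_ge0.
have q0 n : 0 <= \sum_i rnorm (x i n) ^+ 2 by apply: sumr_ge0 => i _; exact: sqr_ge0.
(* The moduli [|x_i|] are summed only to show that the square function, being at most their sum,
   belongs to the space. *)
have /choice[a aE] : forall i, exists y : lbar k s, forall n, y n = ofR (rnorm (x i n)).
  move=> i; have [n|y yE _] := @lbar_dominated (fun n => ofR (rnorm (x i n))) 1 (x i) ler01.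
    by rewrite rnorm_of_real_ge0 ?rnorm_ge0// mul1r.
  by exists y.
have sqrt_le n : Num.sqrt (\sum_i rnorm (x i n) ^+ 2) <= rnorm ((\sum_i a i) n).
  rewrite lbar_sumE (eq_bigr (fun i => ofR (rnorm (x i n)))) => [|i _]; last by rewrite aE.
  have S0 : 0 <= \sum_i rnorm (x i n) by apply: sumr_ge0 => *; exact: rnorm_ge0.
  rewrite -raddf_sum/= rnorm_of_real_ge0// -[leRHS](ger0_norm S0) -sqrtr_sqr ler_wsqrtr//.
  rewrite expr2 mulr_suml; apply: ler_sum => i _.
  rewrite expr2 ler_wpM2l ?rnorm_ge0// (bigD1 i)//= lerDl.
  by apply: sumr_ge0 => *; exact: rnorm_ge0.
have [n|y yE _] := @lbar_dominated (fun n => ofR (Num.sqrt (\sum_i rnorm (x i n) ^+ 2))) 1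
    (\sum_i a i) ler01.
  by rewrite rnorm_of_real_ge0 ?sqrtr_ge0// mul1r.
exists y => //; rewrite -(sqr_sqrtr B0) lerXn2r ?nnegrE ?rnorm_ge0 ?sqrtr_ge0//.
have [[r r1 sr]|soo] := exponentP s; last first.
  apply/(rnorm_lbar_ooP _ _ soo) => n; rewrite yE rnorm_of_real_ge0 ?sqrtr_ge0//.
  rewrite ler_wsqrtr//; apply: ler_sum => i _.
  by rewrite lerXn2r ?nnegrE ?rnorm_ge0// rnorm_coord.
apply/(rnorm_lbarP _ r1 sr (sqrtr_ge0 _)).
have r2 : 2 <= r by move: s2; rewrite sr lee_fin.
pose t := r / 2; have t1 : 1 <= t by rewrite /t ler_pdivlMr// mul1r.
have sqt (c : R) : 0 <= c -> (Num.sqrt c) `^ r = c `^ t.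
  move=> c0; rewrite -{2}(sqr_sqrtr c0) -powR_mulrn ?sqrtr_ge0// -powRrM /t.
  by rewrite mulrCA mulfV ?mulr1.
move=> N; rewrite sqt//.
pose z i : nat -> K^o := fun n => ofR (rnorm (x i n) ^+ 2).
have zE n : (\sum_i z i) n = ofR (\sum_i rnorm (x i n) ^+ 2).
  by rewrite fct_sumE raddf_sum.
have zB : (seq_norm t%:E (\sum_i z i)%R <= B%:E)%E.
  rewrite /B; elim/big_ind2 : _ => [|a1 b1 a2 b2 h1 h2|i _].
  - by rewrite seq_norm0 ?lee_fin.
  - by rewrite EFinD; apply: le_trans (seq_normD _ _ _) _; rewrite ?lee_fin// leeD.
  apply/seq_norm_leP => //; first exact: sqr_ge0.
  move=> M; have /(rnorm_lbarP _ r1 sr (rnorm_ge0 _))/(_ M) := lexx (rnorm (x i)).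
  have sqt' (c : R) : 0 <= c -> c `^ r = (c ^+ 2) `^ t.
    by move=> c0; rewrite -sqt ?sqr_ge0// sqrtr_sqr ger0_norm.
  rewrite -sqt' ?rnorm_ge0//; apply: le_trans; rewrite le_eqVlt; apply/orP; left.
  apply/eqP/eq_bigr => n _; rewrite /z rnorm_of_real_ge0 ?sqr_ge0//.
  by rewrite -sqt' ?rnorm_ge0.
move/seq_norm_leP : zB => /(_ t1 B0 N); apply: le_trans.
rewrite le_eqVlt; apply/orP; left; apply/eqP/eq_bigr => n _.
by rewrite yE zE !rnorm_of_real_ge0 ?sqrtr_ge0// sqt.
Qed.

End lbar_basics.

(** * Tensor products of sequences *)

Section tensor.
Context {R : realType} {k : scalar_kind} (s : exponent R).
Local Notation K := (scalar_field R k).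

Lemma ler_sum_matching (I J : finType) (P : I -> pred J) (f : J -> R) (h : I -> R) :
  (forall j, 0 <= f j) -> (forall i, h i <= \sum_(j | P i j) f j) ->
  (forall j i i', P i j -> P i' j -> i = i') -> \sum_i h i <= \sum_j f j.
Proof.
move=> f0 hf Pinj; apply: le_trans (ler_sum _ (fun i _ => hf i)) _.
rewrite (exchange_big_dep predT)//=; apply: ler_sum => j _.
have [[i Pij]|nP] := pselect (exists i, P i j); last first.
  by rewrite big1// => i Pij; exfalso; apply: nP; exists i.
by rewrite (big_pred1 i)// => i' /=; apply/idP/eqP => [Pi|->//]; exact: Pinj Pi Pij.
Qed.

Lemma lbar_reindex (e : nat -> nat) (x : lbar k s) : injective e ->
  exists2 y : lbar k s, (forall n, y n = x (e n)) & rnorm y <= rnorm x.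
Proof.
move=> einj; have [[r r1 sr]|soo] := exponentP s.
  have xN N : \sum_(n < N) rnorm (x (e n)) `^ r <= rnorm x `^ r.
    pose M := \max_(n < N) (e n).+1.
    have /(rnorm_lbarP _ r1 sr (rnorm_ge0 _))/(_ M) := lexx (rnorm x).
    apply: le_trans.
    apply: (@ler_sum_matching _ _ (fun (n : 'I_N) (m : 'I_M) => m == e n :> nat)).
    - by move=> j; exact: powR_ge0.
    - move=> n; have enM : (e n < M)%N by exact: (@leq_bigmax _ (fun n : 'I_N => (e n).+1)).
      by rewrite (big_pred1 (Ordinal enM)).
    - by move=> j n n' /eqP -> /eqP/einj/val_inj.
  have [y yE] := @lbar_finP _ _ s r (rnorm x) (fun n => x (e n)) r1 sr (rnorm_ge0 x) xN; exists y => //.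
  by apply/(rnorm_lbarP _ r1 sr (rnorm_ge0 _)) => N; under eq_bigr do rewrite yE.
(* An injective [e] eventually leaves every initial segment, so the reindexed sequence still tends
   to 0. *)
have einf N : exists N', forall n, (N' <= n)%N -> (N <= e n)%N.
  elim: N => [|N [N' HN]]; first by exists 0%N.
  have [[m em]|ne] := pselect (exists m, e m = N); last first.
    exists N' => n /HN; rewrite leq_eqVlt => /predU1P[Ne|//].
    by exfalso; apply: ne; exists n.
  exists (maxn N' m.+1) => n; rewrite geq_max => /andP[/HN + mn].
  rewrite leq_eqVlt => /predU1P[Ne|//].
  have : m = n by apply: einj; rewrite em.
  by move=> mn'; rewrite mn' ltnn in mn.
have [e0 e00|y yE] := lbar_ooP (u := fun n => x (e n)) soo.
  have [N HN] := lbar_cvg0 x soo e00; have [N' HN'] := einf N.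
  by exists N' => n /HN' /HN.
by exists y => //; apply/(rnorm_lbar_ooP _ _ soo) => n; rewrite yE rnorm_coord.
Qed.

(** The double sequence [a_i * y_j] written on [nat] through the coding of pairs; a number that is
    not a code carries 0. *)
Definition tensor_seq (a y : lbar k s) (n : nat) : K :=
  if @pickle_inv (nat * nat)%type n is Some ij then a ij.1 * y ij.2 else 0.

(** The sum of [|a_i * y_j|^r] over pairs factorizes. In [c_0] an entry is small as soon as one
    index is large, because the other factor stays below the constant [C]. *)
Lemma tensor_lbar (a y : lbar k s) : exists2 z : lbar k s,
  forall n, z n = tensor_seq a y n & rnorm z <= rnorm a * rnorm y.
Proof.
have ay0 : 0 <= rnorm a * rnorm y by rewrite mulr_ge0 ?rnorm_ge0.
have [[r r1 sr]|soo] := exponentP s.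
  have r0 : 0 < r by rewrite (lt_le_trans _ r1).
  have xN N : \sum_(n < N) rnorm (tensor_seq a y n) `^ r <= (rnorm a * rnorm y) `^ r.
    pose b n : nat := if @pickle_inv (nat * nat)%type n is Some ij then maxn ij.1 ij.2 else 0%N.
    pose M := (\max_(n < N) b n).+1.
    have /(rnorm_lbarP _ r1 sr (rnorm_ge0 _))/(_ M) aM := lexx (rnorm a).
    have /(rnorm_lbarP _ r1 sr (rnorm_ge0 _))/(_ M) yM := lexx (rnorm y).
    have S0 (z : lbar k s) : 0 <= \sum_(n < M) rnorm (z n) `^ r.
      by apply: sumr_ge0 => *; exact: powR_ge0.
    rewrite powRM ?rnorm_ge0//; apply: le_trans (ler_pM (S0 a) (S0 y) aM yM).
    rewrite big_distrlr/= pair_big/=.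
    apply: (@ler_sum_matching _ _ (fun (n : 'I_N) (m : 'I_M * 'I_M) =>
        pickle (m.1 : nat, m.2 : nat) == n :> nat)).
    - by move=> j; rewrite mulr_ge0 ?powR_ge0.
    - move=> n; have : (b n < M)%N.
        by rewrite ltnS; exact: (@leq_bigmax _ (fun n : 'I_N => b n)).
      rewrite /tensor_seq /b; case E : (pickle_inv n) => [[i j]|] /=; last first.
        move=> _; rewrite rnorm0 powR0 ?gt_eqF// sumr_ge0// => *.
        by rewrite mulr_ge0 ?powR_ge0.
      rewrite gtn_max => /andP[iM jM].
      have ijn : pickle (i, j) = n by have := @pickle_invK (nat * nat)%type n; rewrite E.
      rewrite (bigD1 (Ordinal iM, Ordinal jM))/= ?ijn// rnormM powRM ?rnorm_ge0//.
      by rewrite lerDl sumr_ge0// => *; rewrite mulr_ge0 ?powR_ge0.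
    - by move=> j n n' /eqP -> /eqP/val_inj.
  have [z zE] := @lbar_finP _ _ s r _ (tensor_seq a y) r1 sr ay0 xN; exists z => //.
  by apply/(rnorm_lbarP _ r1 sr ay0) => N; under eq_bigr do rewrite zE.
have [e e0|z zE] := lbar_ooP (u := tensor_seq a y) soo.
  pose C := rnorm a + rnorm y + 1.
  have C0 : 0 < C by rewrite ltr_wpDl ?addr_ge0 ?rnorm_ge0.
  have eC0 : 0 < e / C by rewrite divr_gt0.
  have [I HI] := lbar_cvg0 a soo eC0; have [J HJ] := lbar_cvg0 y soo eC0.
  exists (\max_(i < I) \max_(j < J) (pickle (i : nat, j : nat)).+1) => n Nn.
  rewrite /tensor_seq; case E : (pickle_inv n) => [[i j]|] /=; last by rewrite rnorm0 ltW.
  have ijn : pickle (i, j) = n by have := @pickle_invK (nat * nat)%type n; rewrite E.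
  have aC : rnorm (a i) <= C.
    by apply: le_trans (rnorm_coord _ _) _; rewrite /C -addrA lerDl addr_ge0 ?rnorm_ge0.
  have yC : rnorm (y j) <= C.
    by apply: le_trans (rnorm_coord _ _) _; rewrite /C addrAC lerDr addr_ge0 ?rnorm_ge0.
  rewrite rnormM; have [Ii|iI] := leqP I i.
    rewrite -(divfK (lt0r_neq0 C0) e); apply: ler_pM; rewrite ?rnorm_ge0//.
    exact: HI.
  have [Jj|jJ] := leqP J j.
    rewrite -(divfK (lt0r_neq0 C0) e) mulrC; apply: ler_pM; rewrite ?rnorm_ge0//.
    exact: HJ.
  exfalso; move: Nn; apply/negP; rewrite -ltnNge -ijn.
  apply: leq_trans (@leq_bigmax _ (fun i : 'I_I => \max_(j < J) (pickle (i : nat, j : nat)).+1)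
    (Ordinal iI)).
  exact: (@leq_bigmax _ (fun j : 'I_J => (pickle (i, j : nat)).+1) (Ordinal jJ)).
exists z => //; apply/(rnorm_lbar_ooP _ _ soo) => n; rewrite zE /tensor_seq.
case: pickle_inv => [[i j]|] /=; last by rewrite rnorm0.
by rewrite rnormM ler_pM ?rnorm_ge0 ?rnorm_coord.
Qed.

Definition tensor (a y : lbar k s) : lbar k s := s2val (cid2 (tensor_lbar a y)).

Lemma tensorE a y n : tensor a y n = tensor_seq a y n.
Proof. by rewrite /tensor; case: cid2. Qed.

Lemma rnorm_tensor a y : rnorm (tensor a y) <= rnorm a * rnorm y.
Proof. by rewrite /tensor; case: cid2. Qed.

Lemma tensor_pickle a y i j : tensor a y (pickle (i, j)) = a i * y j.
Proof. by rewrite tensorE /tensor_seq pickleK_inv. Qed.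

Lemma tensor_is_linear a : linear (tensor a).
Proof.
move=> c y z; apply: lbarP => n; rewrite lbarDE lbarZE !tensorE /tensor_seq.
case: pickle_inv => [[i j]|]; last by rewrite mulr0 addr0.
by rewrite lbarDE lbarZE /=; ring.
Qed.

HB.instance Definition _ a :=
  GRing.isLinear.Build K (lbar k s) (lbar k s) *:%R (tensor a) (tensor_is_linear a).

Lemma tensor_linearl c a b y : tensor (c *: a + b) y = c *: tensor a y + tensor b y.
Proof.
apply: lbarP => n; rewrite lbarDE lbarZE !tensorE /tensor_seq.
case: pickle_inv => [[i j]|]; last by rewrite mulr0 addr0.
by rewrite lbarDE lbarZE /=; ring.
Qed.

(** The entries with second index [j] form the sequence [y_j * a], and passing to them contracts the
    norm. This yields the lower bound for the embedding of [l_s]. *)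
Lemma tensor_row_contraction (a y : lbar k s) j :
  rnorm a * rnorm (y j) <= rnorm (tensor a y).
Proof.
have [|z zE zle] := @lbar_reindex (fun i => pickle (i, j)) (tensor a y).
  by move=> i i' /(pcan_inj (@pickleK_inv _)) [].
apply: le_trans zle; rewrite mulrC -rnormZ (_ : z = y j *: a)//.
by apply: lbarP => i; rewrite zE tensor_pickle lbarZE mulrC.
Qed.

(* The contraction z |-> (z_(i, j))_j, which sends tensor a y to a_i y. *)
Lemma tensor_slice i : exists2 f : {linear lbar k s -> lbar k s},
  forall z, rnorm (f z) <= rnorm z & forall a y, f (tensor a y) = a i *: y.
Proof.
have inj_i : injective (fun j : nat => pickle (i, j)).
  by move=> j j' /(pcan_inj (@pickleK_inv _)) [].
pose f z := s2val (cid2 (lbar_reindex z inj_i)).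
have fE z n : f z n = z (pickle (i, n)) by rewrite /f; case: cid2.
have fl : linear f by move=> c y z; apply: lbarP => n; rewrite lbarDE lbarZE !fE.
pose F : {linear lbar k s -> lbar k s} := HB.pack f (GRing.isLinear.Build _ _ _ _ _ fl).
exists F => [z|a y]; first by rewrite /= /f; case: cid2.
apply: lbarP => n; change (f (tensor a y) n = (a i *: y) n).
by rewrite fE tensor_pickle lbarZE.
Qed.

End tensor.

(** * Block systems *)

Section geometric.
Context {R : realType}.

Lemma geometric_sum_le (g : R) N : 0 <= g -> g < 1 -> \sum_(j < N) g ^+ j <= (1 - g)^-1.
Proof.
move=> g0 g1; have g10 : 0 < 1 - g by rewrite subr_gt0.
rewrite -[leRHS]div1r ler_pdivlMr// mulrC.
have -> : (1 - g) * \sum_(j < N) g ^+ j = 1 - g ^+ N by rewrite -opprB mulNr -subrX1 opprB.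
by rewrite gerBl exprn_ge0.
Qed.

Lemma expr_unbounded (g M : R) : 1 < g -> exists n : nat, M < g ^+ n.
Proof.
move=> g1; have bern n : 1 + n%:R * (g - 1) <= g ^+ n.
  elim: n => [|n IH]; first by rewrite mul0r addr0 expr0.
  rewrite exprS; apply: le_trans (ler_wpM2l (ltW (lt_trans ltr01 g1)) IH).
  have := mulr_ge0 (ler0n R n) (sqr_ge0 (g - 1)).
  by rewrite -natr1; lra.
pose n := (Num.truncn (M / (g - 1))).+1; exists n; apply: lt_le_trans (bern n).
rewrite ltr_pwDl// -ler_pdivrMr ?subr_gt0//.
by rewrite ltW// truncnS_gt.
Qed.

(* kap lies between 2^(-1/p) and 2^(-1/q), and th between kap and 1, so close to 1 that kap / th
   is still below 2^(-1/q). *)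
Lemma block_weights (p q : R) : 0 < p -> p < q -> exists kap th : R,
  [/\ 0 < kap, 1 < 2 * kap `^ p, 0 < th < 1, kap <= th & 2 * (kap / th) `^ q < 1].
Proof.
move=> p0 pq; have q0 : 0 < q := lt_trans p0 pq.
have qp : q^-1 < p^-1 by rewrite ltf_pV2.
have qi0 : 0 < q^-1 by rewrite invr_gt0.
(* [kap = 2^(-a)] with [a] midway between [1/q] and [1/p], and [th = 2^(-b)]; as [a - b] is midway
   between [1/q] and [a], the quotient [kap / th] stays below [2^(-1/q)]. *)
pose a := (p^-1 + q^-1) / 2; pose b := (a - q^-1) / 2.
have pp : p * p^-1 = 1 by rewrite mulfV ?gt_eqF.
have qq : q * q^-1 = 1 by rewrite mulfV ?gt_eqF.
have two1 : (1 : R) < 2 by rewrite ltr1n.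
have pw (c : R) : (2 `^ c < 1) = (c < 0).
  by rewrite /powR gt_eqF// expR_lt1 pmulr_llt0// ln_gt0.
have pw' (c : R) : (1 < 2 `^ c) = (0 < c).
  by rewrite /powR gt_eqF// expR_gt1 pmulr_lgt0// ln_gt0.
have twoD (c d : R) : 2 `^ c * 2 `^ d = 2 `^ (c + d).
  by rewrite powRD// (gt_eqF (ltr0n R 2)) implybT.
have two (c : R) : 2 * 2 `^ c = 2 `^ (1 + c) by rewrite -twoD powRr1.
have kth : 2 `^ (- a) / 2 `^ (- b) = 2 `^ (- (a - b)).
  by rewrite -powRN twoD; congr (_ `^ _); ring.
exists (2 `^ (- a)), (2 `^ (- b)); split.
- by rewrite powR_gt0.
- rewrite -powRrM two pw' mulNr subr_gt0 mulrC -pp ltr_pM2l// /a; lra.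
- by rewrite powR_gt0//= pw oppr_lt0 /b /a; lra.
- rewrite -[leRHS]mul1r -ler_pdivrMr ?powR_gt0// kth ltW// pw oppr_lt0 /b /a; lra.
- rewrite kth -powRrM two pw mulNr subr_lt0 mulrC -{1}qq ltr_pM2l// /b /a; lra.
Qed.

End geometric.

Section hadamard.
Context {R : realType}.

(** Sylvester's matrices: for indices below [2^e] the entry is [-1] to the number of binary digits
    equal to 1 in both [i] and [j]; the recursion strips the top digit. *)
Fixpoint hadamard (e i j : nat) : R :=
  if e is e'.+1 then
    (-1) ^+ ((2 ^ e' <= i) && (2 ^ e' <= j))%N * hadamard e' (i %% 2 ^ e') (j %% 2 ^ e')
  else 1.

Lemma hadamardC e i j : hadamard e i j = hadamard e j i.
Proof. by elim: e i j => //= e IH i j; rewrite andbC IH. Qed.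

Lemma hadamard_abs e i j : `|hadamard e i j| = 1.
Proof.
elim: e i j => [|e IH] i j /=; first by rewrite normr1.
by rewrite normrM IH mulr1 normrX normrN1 expr1n.
Qed.

Lemma hadamard_orth e i i' : (i < 2 ^ e)%N -> (i' < 2 ^ e)%N ->
  \sum_(j < 2 ^ e) hadamard e i j * hadamard e i' j = (2 ^ e)%:R *+ (i == i').
Proof.
elim: e i i' => [|e IH] i i' ie ie'.
  move: ie ie'; rewrite !ltnS !leqn0 => /eqP-> /eqP->.
  by rewrite big_ord1 /= mulr1.
have e0 : (0 < 2 ^ e)%N by rewrite expn_gt0.
have eE : (2 ^ e.+1 = 2 ^ e + 2 ^ e)%N by rewrite expnS mul2n addnn.
rewrite -(big_mkord xpredT (fun j => hadamard e.+1 i j * hadamard e.+1 i' j)) eE big_mkord.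
rewrite big_split_ord/=.
set S := \sum_(j < 2 ^ e) hadamard e (i %% 2 ^ e) j * hadamard e (i' %% 2 ^ e) j.
rewrite (eq_bigr (fun j : 'I_(2 ^ e) => hadamard e (i %% 2 ^ e) j *
    hadamard e (i' %% 2 ^ e) j)) => [|j _]; last first.
  by rewrite (leqNgt _ (j : nat)) (ltn_ord j) !andbF expr0 !mul1r (modn_small (ltn_ord j)).
rewrite [X in _ + X](_ : _ = (-1) ^+ (2 ^ e <= i)%N * (-1) ^+ (2 ^ e <= i')%N * S); last first.
  rewrite /S mulr_sumr; apply: eq_bigr => j _.
  by rewrite leq_addr !andbT modnDl (modn_small (ltn_ord j))//; ring.
rewrite -/S /S IH ?ltn_pmod// natrD.
have iE x : (x < 2 ^ e.+1)%N -> x = ((2 ^ e <= x)%N * 2 ^ e + x %% 2 ^ e)%N.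
  rewrite eE => xe; have [ex|xe'] := leqP (2 ^ e)%N x; last by rewrite mul0n modn_small.
  rewrite mul1n -{1}(subnKC ex); congr addn.
  by rewrite -{2}(subnKC ex) modnDl modn_small// ltn_subLR.
have -> : (i == i') = (i %% 2 ^ e == i' %% 2 ^ e)%N && ((2 ^ e <= i)%N == (2 ^ e <= i')%N).
  apply/eqP/andP => [->//|[/eqP h1 /eqP h2]].
  by rewrite (iE _ ie) (iE _ ie') h1 h2.
case: (_ == _); last by rewrite !mulr0n mulr0 addr0.
by case: (2 ^ e <= i)%N; case: (2 ^ e <= i')%N => /=; ring.
Qed.

End hadamard.

Section block_systems.
Context {R : realType} {k : scalar_kind} (s : exponent R).
Local Notation K := (scalar_field R k).
Local Notation ofR := (@of_real R k).
Local Notation F := (lbar k s).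

Lemma sum_block_le (f : nat -> R) e : (forall n, 0 <= f n) ->
  \sum_(j < 2 ^ e) f (2 ^ e + j)%N <= \sum_(n < 2 ^ e + 2 ^ e) f n.
Proof. by move=> f0; rewrite big_split_ord/= lerDr sumr_ge0. Qed.

(* b_i and L_i are biorthogonal, live on the coordinates 2^e <= n < 2^(e+1), and the
   functionals L_i satisfy a Bessel inequality. *)
Definition block_system e (b : nat -> F) (L : nat -> F -> K^o) : Prop :=
  (forall i, linear (L i)) /\
  [/\ forall i, (i < 2 ^ e)%N -> rnorm (b i) <= 1,
      forall i j, (i < 2 ^ e)%N -> (j < 2 ^ e)%N -> L i (b j) = (i == j)%:R,
      forall i n, (i < 2 ^ e)%N -> ~~ (2 ^ e <= n < 2 ^ e.+1)%N -> b i n = 0 :> K,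
      forall i (x : F), (i < 2 ^ e)%N ->
        (forall n, (2 ^ e <= n < 2 ^ e.+1)%N -> x n = 0 :> K) -> L i x = 0 &
      forall x, \sum_(i < 2 ^ e) rnorm (L i x : K) ^+ 2 <= 2 * rnorm x ^+ 2].

Lemma block_double e : (2 ^ e.+1 = 2 ^ e + 2 ^ e)%N.
Proof. by rewrite expnS mul2n addnn. Qed.

(** Coordinate functionals satisfy the Bessel inequality because the [l_2] norm is at most the [l_s]
    norm for [s <= 2]. *)
Lemma block_system_le2 e : (s <= 2%:E)%E -> exists b L, block_system e b L.
Proof.
move=> s2; have [[r r1 sr]|soo] := exponentP s; last by rewrite soo in s2.
have r2 : r <= 2 by move: s2; rewrite sr lee_fin.
have sum2 (x : F) N : \sum_(n < N) rnorm (x n) ^+ 2 <= rnorm x ^+ 2.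
  have [x0|x0] := eqVneq (rnorm x) 0.
    by rewrite (rnorm0_eq0 x0) big1 ?sqr_ge0// => n _; rewrite lbar0E rnorm0 expr0n.
  have xp : 0 < rnorm x by rewrite lt_def x0 rnorm_ge0.
  have /(rnorm_lbarP _ r1 sr (rnorm_ge0 _))/(_ N) := lexx (rnorm x).
  rewrite -[X in _ <= X -> _]mulr1 -ler_pdivrMl ?powR_gt0// => xr.
  rewrite -[leRHS]mulr1 -ler_pdivrMl ?exprn_gt0//; apply: le_trans xr.
  rewrite !mulr_sumr; apply: ler_sum => n _.
  rewrite -exprVn -powRVl ?rnorm_ge0// -exprMn -powRM ?invr_ge0 ?rnorm_ge0//.
  have t0 : 0 <= (rnorm x)^-1 * rnorm (x n) by rewrite mulr_ge0 ?invr_ge0 ?rnorm_ge0.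
  have t1 : (rnorm x)^-1 * rnorm (x n) <= 1.
    by rewrite ler_pdivrMl// mulr1 rnorm_coord.
  rewrite -powR_mulrn//; have [->|tn0] := eqVneq ((rnorm x)^-1 * rnorm (x n)) 0.
    by rewrite !powR0// gt_eqF// (lt_le_trans _ r1).
  by rewrite ger_powR// t1 lt_def tn0 t0.
exists (fun i : nat => @lbar_unit R k s (2 ^ e + i)%N),
  (fun i : nat => @lbar_coord R k s (2 ^ e + i)%N); split; last split.
- by move=> i; exact: lbar_coord_is_linear.
- by move=> i _; rewrite rnorm_lbar_unit.
- by move=> i j _ _; rewrite /lbar_coord lbar_unitE eqn_add2l.
- move=> i n ie; rewrite lbar_unitE block_double; case: eqP => // ->.
  by rewrite leq_addr ltn_add2l ie.
- by move=> i x ie x0; rewrite /lbar_coord x0// block_double leq_addr ltn_add2l ie.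
- move=> x; apply: (@le_trans _ _ (rnorm x ^+ 2)).
    apply: le_trans (sum2 x (2 ^ e + 2 ^ e)%N).
    by apply: (sum_block_le (f := fun n => rnorm (x n) ^+ 2)) => n; exact: sqr_ge0.
  by rewrite ler_peMl ?sqr_ge0// ler1n.
Qed.

(** For [s > 2] the coordinates of a block satisfy no Bessel inequality with a uniform constant.
    Hadamard rows of order [N = 2^e] have entries of modulus 1, hence at most the norm [nu] of the
    indicator [w] of the block, and [nu] is at most [N^(1/s)]. Orthogonality reduces the inequality
    to [nu^2 / N] times the sum of [|x_n|^2] over the block. *)
Lemma block_system_ge2 e : (2%:E <= s)%E -> exists b L, block_system e b L.
Proof.
move=> s2; pose N := (2 ^ e)%N; have N0 : (0 < N)%N by rewrite expn_gt0.
have N0R : 0 < N%:R :> R by rewrite ltr0n.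
pose blk n := (N <= n < N + N)%N.
have [w wE] := @lbar_finite_support R k s (fun n => (blk n)%:R) (N + N)%N (fun n Nn =>
  congr1 (fun b : bool => b%:R) (introF andP (fun h => negP (negbT (leq_gtF Nn)) h.2))).
have /choice[u uE] : forall i, exists y : F, (forall n, y n =
    if blk n then ofR (hadamard e i (n - N)) else 0) /\ rnorm y <= rnorm w.
  move=> i; have [n|y yE yw] := @lbar_dominated R k s
      (fun n => if blk n then ofR (hadamard e i (n - N)) else 0) 1 w ler01.
    rewrite mul1r wE; case: (blk n); rewrite ?rnorm0 ?rnorm_ge0//.
    by rewrite rnorm1 rnorm_of_real hadamard_abs.
  by exists y; split => //; rewrite -[leRHS]mul1r.
pose nu := rnorm w.
have nu0 : 0 < nu.
  apply: lt_le_trans (rnorm_coord w N); rewrite wE /blk leqnn -{1}(addn0 N) ltn_add2l N0.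
  by rewrite rnorm1.
pose b i := ofR nu^-1 *: u i.
pose L i (x : F) : K^o := ofR (nu / N%:R) * \sum_(j < N) ofR (hadamard e i j) * x (N + j)%N.
have blkN j : (j < N)%N -> blk (N + j) by move=> jN; rewrite /blk leq_addr ltn_add2l.
have bN i j : (j < N)%N -> b i (N + j)%N = ofR (nu^-1 * hadamard e i j).
  move=> jN; rewrite /b lbarZE (proj1 (uE i)) blkN// addKn -of_realM//.
exists b, L; split; last split.
- move=> i c x y; rewrite /L.
  rewrite (eq_bigr (fun j : 'I_N => c * (ofR (hadamard e i j) * x (N + j)%N) +
      ofR (hadamard e i j) * y (N + j)%N)); last by move=> j _; rewrite lbarDE lbarZE; ring.
  by rewrite big_split/= -mulr_sumr mulrDr mulrCA.
- move=> i _; rewrite /b rnormZ rnorm_of_real_ge0 ?invr_ge0 ?(ltW nu0)//.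
  by rewrite ler_pdivrMl// mulr1; case: (uE i).
- move=> i j ie je; rewrite /L (eq_bigr (fun m : 'I_N => ofR (nu^-1 *
      (hadamard e i m * hadamard e j m)))); last first.
    by move=> m _; rewrite bN// -of_realM mulrCA.
  rewrite -raddf_sum/= -mulr_sumr hadamard_orth// -of_realM.
  have -> : nu / N%:R * (nu^-1 * (N%:R *+ (i == j))) = (i == j)%:R.
    by case: (i == j); rewrite ?mulr0n ?mulr1n ?mulr0//; field; rewrite !gt_eqF.
  by rewrite of_real_nat.
- move=> i n ie; rewrite block_double => nb; rewrite /b lbarZE (proj1 (uE i)).
  by rewrite /blk (negbTE nb) mulr0.
- move=> i x ie x0; rewrite /L big1 ?mulr0// => j _.
  by rewrite x0 ?mulr0// block_double; exact: blkN.
move=> x; rewrite /L.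
have -> : \sum_(i < 2 ^ e) rnorm (ofR (nu / N%:R) * \sum_(j < N) ofR (hadamard e i j) *
    x (N + j)%N) ^+ 2 = nu ^+ 2 / N%:R * \sum_(j < N) rnorm (x (N + j)%N) ^+ 2.
  have orth (j j' : 'I_N) : \sum_(i < N) kconj (ofR (hadamard e i j)) *
      ofR (hadamard e i j') = ofR (N%:R *+ (j == j')).
    rewrite -(hadamard_orth (ltn_ord j) (ltn_ord j')) raddf_sum/=.
    by apply: eq_bigr => i _; rewrite kconj_ofR of_realM !(hadamardC e i).
  rewrite -[X in _ = X](_ : (nu / N%:R) ^+ 2 *
      (N%:R * \sum_(j < N) rnorm (x (N + j)%N) ^+ 2) = _); last by field; rewrite gt_eqF.
  rewrite -(orth_isometry orth (fun j : 'I_N => x (N + j)%N)) mulr_sumr.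
  apply: eq_bigr => i _; rewrite rnormM exprMn rnorm_of_real_ge0//.
  by rewrite divr_ge0// ltW.
rewrite mulrAC ler_pdivrMr//.
have [[r r1 sr]|soo] := exponentP s; last first.
  have nu1 : nu <= 1.
    apply/(rnorm_lbar_ooP _ _ soo) => n; rewrite wE; case: (blk n).
      by rewrite rnorm1.
    by rewrite rnorm0.
  have nu21 : nu ^+ 2 <= 1 by rewrite expr_le1 ?(ltW nu0).
  apply: (@le_trans _ _ (\sum_(j < N) rnorm x ^+ 2)).
    rewrite -[leRHS]mul1r ler_pM ?sqr_ge0 ?sumr_ge0// => [j _|]; first exact: sqr_ge0.
    by apply: ler_sum => j _; rewrite lerXn2r ?nnegrE ?rnorm_ge0// rnorm_coord.
  rewrite sumr_const card_ord -[leLHS]mulr_natr ler_wpM2r// ler_peMl ?sqr_ge0 ?ler1n//.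
have r2 : 2 <= r by move: s2; rewrite sr lee_fin.
have r0 : 0 < r by rewrite (lt_le_trans _ r2).
pose m := (N%:R : R) `^ r^-1.
have m0 : 0 < m by rewrite powR_gt0.
have mr : m `^ r = N%:R by rewrite /m powR_invK// gt_eqF.
have num : nu <= m.
  apply/(rnorm_lbarP _ r1 sr (ltW m0)) => M; rewrite mr.
  have wr n : rnorm (w n) `^ r = (blk n)%:R.
    by rewrite wE; case: (blk n); rewrite ?rnorm1 ?rnorm0 ?powR1 ?powR0 ?gt_eqF.
  apply: (@le_trans _ _ (\sum_(n < N + N + M) rnorm (w n) `^ r)).
    by apply: (@ler_sum_ord_le _ (fun n => rnorm (w n) `^ r)); 
      [move=> i; exact: powR_ge0|exact: leq_addl].
  rewrite !big_split_ord/= [X in X + _ + _]big1 => [|i _]; last first.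
    by rewrite wr /blk leqNgt ltn_ord.
  rewrite [X in _ + X]big1 => [|i _]; last first.
    by rewrite wr /blk ltnNge leq_addr andbF.
  rewrite add0r addr0 (eq_bigr (fun=> 1)) => [|i _]; last by rewrite wr blkN.
  by rewrite sumr_const card_ord.
have [x0|xn0] := eqVneq (rnorm x) 0.
  rewrite (rnorm0_eq0 x0) rnorm0 (expr2 0) mul0r mulr0 mul0r big1 ?mulr0// => j _.
  by rewrite lbar0E rnorm0 expr0n.
have xp : 0 < rnorm x by rewrite lt_def xn0 rnorm_ge0.
pose B := rnorm x / m; have B0 : 0 < B by rewrite divr_gt0.
have /(rnorm_lbarP _ r1 sr (rnorm_ge0 _))/(_ (N + N)%N) := lexx (rnorm x).
move=> /(le_trans (@sum_block_le (fun n => rnorm (x n) `^ r) e (fun n => powR_ge0 _ _))) xr.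
(* Hoelder's inequality in additive form: [t^2 <= 1 + t^r] with [t = |x_n| / B]. This is the origin
   of the factor 2 in the definition of a block system. *)
have xB j : rnorm (x (N + j)%N) ^+ 2 <= B ^+ 2 * (1 + B^-1 `^ r * rnorm (x (N + j)%N) `^ r).
  rewrite -powRM ?rnorm_ge0 ?invr_ge0 ?(ltW B0)//; set t := _ * rnorm _.
  have t0 : 0 <= t by rewrite mulr_ge0 ?rnorm_ge0 ?invr_ge0 ?(ltW B0).
  have -> : rnorm (x (N + j)%N) = B * t by rewrite /t mulrA mulfV ?mul1r// gt_eqF.
  rewrite exprMn ler_wpM2l ?sqr_ge0//; have [t1|t1] := leP t 1.
    by apply: (@le_trans _ _ 1); [by rewrite expr_le1|by rewrite lerDl powR_ge0].
  apply: (@le_trans _ _ (t `^ r)); last by rewrite lerDr.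
  by rewrite -powR_mulrn// ler_powR// ltW.
apply: (@le_trans _ _ (nu ^+ 2 * (B ^+ 2 * (N%:R + N%:R)))).
  rewrite ler_wpM2l ?sqr_ge0//; apply: le_trans (ler_sum _ (fun (j : 'I_N) _ => xB j)) _.
  rewrite -mulr_sumr ler_wpM2l ?sqr_ge0// big_split/= sumr_const card_ord lerD2l.
  rewrite -mulr_sumr powRVl ?(ltW B0)// ler_pdivrMl ?powR_gt0//.
  apply: le_trans xr _; rewrite /B powRM ?rnorm_ge0 ?invr_ge0 ?(ltW m0)//.
  by rewrite powRVl ?(ltW m0)// mr mulfVK ?gt_eqF.
have -> : 2 * rnorm x ^+ 2 * N%:R = m ^+ 2 * (B ^+ 2 * (N%:R + N%:R)).
  by rewrite /B; field; rewrite gt_eqF.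
apply: ler_wpM2r; first by rewrite mulr_ge0 ?sqr_ge0 ?addr_ge0.
by rewrite lerXn2r ?nnegrE ?(ltW nu0) ?(ltW m0).
Qed.

Lemma block_system_exists e : exists b L, block_system e b L.
Proof.
by have [|/ltW] := leP (s : \bar R) 2%:E; [exact: block_system_le2|exact: block_system_ge2].
Qed.

(* Summed over the 2^e functionals of a block, the hull inequality with B of the order of kap^e
   bounds (2 kap^p)^e. *)
Lemma not_p_compact_blocks (p c kap : R) (L : nat -> nat -> F -> K^o) (A : set F) :
  2 <= p -> 0 < c -> 0 < kap -> 1 < 2 * kap `^ p ->
  (forall e i, linear (L e i)) ->
  (forall e x, \sum_(i < 2 ^ e) rnorm (L e i x : K) ^+ 2 <= 2 * rnorm x ^+ 2) ->
  (forall e i, (i < 2 ^ e)%N -> exists2 v, A v & c * kap ^+ e <= rnorm (L e i v : K)) ->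
  ~ p_compact p A.
Proof.
move=> p2 c0 kap0 kapp Ll Lx AL [x /p_coverP[[M xM] Ax]].
have p0 : 0 < p by rewrite (lt_le_trans _ p2).
have p1 : 1 <= p by rewrite (le_trans _ p2)// ler1n.
have L1 e (i : 'I_(2 ^ e)) y : rnorm (L e i y : K) <= 2 * rnorm y.
  rewrite -(ler_pXn2r (n := 2)) ?nnegrE ?rnorm_ge0 ?mulr_ge0 ?rnorm_ge0//.
  apply: le_trans (le_trans (Lx e y) _).
    by rewrite (bigD1 i)//= lerDl sumr_ge0// => *; exact: sqr_ge0.
  by rewrite exprMn ler_wpM2r ?sqr_ge0// expr2; lra.
(* As [p >= 2], the [l_p] norm of the [2^e] values is at most their [l_2] norm, so summing over [i]
   costs no power of [2^e]. *)
have Lp e y : \sum_(i < 2 ^ e) rnorm (L e i y : K) `^ p <= (2 * rnorm y) `^ p.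
  have [y0|yn0] := eqVneq (rnorm y) 0.
    rewrite big1 ?powR_ge0// => i _; have := L1 e i y; rewrite y0 mulr0 => L0.
    have -> : rnorm (L e i y : K) = 0 by apply/eqP; rewrite eq_le L0 rnorm_ge0.
    by rewrite powR0 ?gt_eqF.
  have yp : 0 < 2 * rnorm y by rewrite mulr_gt0// lt_def yn0 rnorm_ge0.
  rewrite -[leRHS]mulr1 -ler_pdivrMl ?powR_gt0// mulr_sumr.
  apply: (@le_trans _ _ (\sum_(i < 2 ^ e) ((2 * rnorm y)^-1 * rnorm (L e i y : K)) ^+ 2)).
    apply: ler_sum => i _; rewrite -powRVl ?(ltW yp)// -powRM ?rnorm_ge0 ?invr_ge0 ?(ltW yp)//.
    set t := _ * _; have t0 : 0 <= t by rewrite mulr_ge0 ?rnorm_ge0 ?invr_ge0 ?(ltW yp).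
    have t1 : t <= 1 by rewrite ler_pdivrMl// mulr1 L1.
    rewrite -powR_mulrn//; have [->|tn0] := eqVneq t 0; first by rewrite !powR0// gt_eqF.
    by rewrite ger_powR// t1 lt_def tn0 t0.
  under eq_bigr do rewrite exprMn.
  rewrite -mulr_sumr exprVn ler_pdivrMl ?exprn_gt0// mulr1.
  apply: le_trans (Lx e y) _.
  by rewrite exprMn ler_wpM2r ?sqr_ge0// expr2; lra.
have M0 : 0 <= M by have := xM 0%N; rewrite big_ord0.
have key e : (2 * kap `^ p) ^+ e * (c / 2) `^ p <= 2 `^ p * M.
  have /choice[v vP] : forall i : 'I_(2 ^ e), exists v, A v /\ c * kap ^+ e <= rnorm (L e i v : K).
    by move=> i; have [v Av cv] := AL e i (ltn_ord i); exists v.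
  (* [B] is half of the lower bound [c * kap^e]: the term [2^e * B] of the hull inequality is then
     absorbed by the left-hand side [2^e * (2 * B)]. *)
  pose B := c / 2 * kap ^+ e; have B0 : 0 < B by rewrite mulr_gt0 ?divr_gt0 ?exprn_gt0.
  have LD i y z : L e i (y + z) = L e i y + L e i z.
    by have := Ll e i 1 y z; rewrite !scale1r.
  have LZ i a y : L e i (a *: y) = a * (L e i y : K).
    have L0 : L e i 0 = 0 by apply: (addrI (L e i 0)); rewrite -LD !addr0.
    by have := Ll e i a y 0; rewrite L0 !addr0.
  have := @hull_seminorm R k F 'I_(2 ^ e) p 2 B (2 `^ p * M) v
    (fun i y => rnorm (L e i y : K)) x p1 B0 (ler0n _ 2).
  move=> /(_ (fun i y => rnorm_ge0 _)) H.
  have {H}: \sum_(i < 2 ^ e) rnorm (L e i (v i) : K) <=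
      #|'I_(2 ^ e)|%:R * B + B `^ (1 - p) * (2 `^ p * M).
    apply: H.
    - by move=> i y z; rewrite LD; exact: rnormD.
    - by move=> i a y; rewrite LZ rnormM.
    - exact: L1.
    - by move=> i; apply: Ax; case: (vP i).
    - move=> N; rewrite exchange_big/= -[leRHS]mulr1 mulr1.
      apply: le_trans (ler_wpM2l (powR_ge0 _ _) (xM N)); rewrite mulr_sumr.
      by apply: ler_sum => m _; rewrite -powRM ?rnorm_ge0// Lp.
  have sB : \sum_(i < 2 ^ e) (c * kap ^+ e) <= \sum_(i < 2 ^ e) rnorm (L e i (v i) : K).
    by apply: ler_sum => i _; case: (vP i).
  move=> /(le_trans sB); rewrite sumr_const card_ord -[leLHS]mulr_natl.
  have -> : c * kap ^+ e = 2 * B by rewrite /B; field.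
  have -> : (2 ^ e)%:R * (2 * B) = (2 ^ e)%:R * B + (2 ^ e)%:R * B by ring.
  rewrite lerD2l powRB ?(gt_eqF B0) ?implybT// powRr1 ?(ltW B0)// -mulrA mulrC.
  rewrite ler_pM2l// ler_pdivlMl ?powR_gt0//; apply: le_trans.
  have -> : B `^ p = (c / 2) `^ p * (kap `^ p) ^+ e.
    rewrite /B powRM ?exprn_ge0 ?(ltW kap0) ?divr_ge0 ?(ltW c0)//; congr (_ * _).
    by rewrite exprn_powR// ltW.
  by rewrite exprMn natrX le_eqVlt; apply/orP; left; apply/eqP; ring.
have [e] := expr_unbounded (2 `^ p * M / (c / 2) `^ p) kapp.
rewrite ltr_pdivrMr ?powR_gt0 ?divr_gt0//.
by rewrite ltNge key.
Qed.

End block_systems.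

(** * Spaceability of Lipschitz maps *)

Section p_compactness_measure.
Context {R : realType} {k : scalar_kind}.
Local Notation K := (scalar_field R k).

(** With [B] close to [S^(1/q)] the hull inequality reads [||v|| <= 2 * S^(1/q)]; the added [e / 2]
    keeps [B] positive when [S = 0]. *)
Lemma m_ge_half_rnorm (F : normedModType K) (q : R) (A : set F) v : 1 <= q -> A v ->
  ((rnorm v / 2)%:E <= m_ q A)%E.
Proof.
move=> q1 Av; have q0 : 0 < q by rewrite (lt_le_trans _ q1).
apply: le_ereal_inf_tmp => _ [z [zq Az] <-].
have z0 n : 0 <= rnorm (z n) `^ q by exact: powR_ge0.
have S0 : (0 <= \sum_(n <oo) (rnorm (z n) `^ q)%:E)%E.
  by apply: nneseries_ge0 => n _ _; rewrite lee_fin.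
move: zq S0 (nneseries_leP (fine (\sum_(n <oo) (rnorm (z n) `^ q)%:E)%E) z0).
case: (\sum_(n <oo) _)%E => // S _ S0 /= [/(_ (lexx _)) zS _].
have {}S0 : 0 <= S by rewrite -lee_fin.
rewrite ?poweR_EFin lee_fin ler_pdivrMr//; apply/ler_addgt0Pr => e e0.
pose B := S `^ q^-1 + e / 2.
have B0 : 0 < B by rewrite ltr_wpDl ?powR_ge0 ?divr_gt0.
apply: le_trans (p_hull_rnorm q1 B0 (Az _ Av) zS) _.
have -> : S `^ q^-1 * 2 + e = B + B by rewrite /B; field.
rewrite lerD2l powRB ?(gt_eqF B0) ?implybT// powRr1 ?(ltW B0)// -mulrA.
rewrite ger_pMr// ler_pdivrMl ?powR_gt0// mulr1.
rewrite -{1}(powR_invK S0 (lt0r_neq0 q0)); apply: ler_powR_base; rewrite ?powR_ge0 ?ltW//.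
by rewrite /B ltrDl divr_gt0.
Qed.

Lemma m_le (F : normedModType K) (q M : R) (A : set F) (x : nat -> F) : 0 < q ->
  (forall N, \sum_(n < N) rnorm (x n) `^ q <= M) -> A `<=` p_hull q x ->
  (m_ q A <= (M `^ q^-1)%:E)%E.
Proof.
move=> q0 xM Ax; have x0 n : 0 <= rnorm (x n) `^ q by exact: powR_ge0.
apply: (@le_trans _ _ ((\sum_(n <oo) (rnorm (x n) `^ q)%:E) `^ q^-1)%E).
  by apply: ereal_inf_lbound; exists x => //; apply/p_coverP; split => //; exists M.
rewrite -poweR_EFin; apply: le_poweR; first by rewrite invr_ge0 ltW.
  by apply: nneseries_ge0 => n _ _; rewrite lee_fin.
exact/nneseries_leP.
Qed.

Lemma p_compact_set0 (F : normedModType K) (p : R) (A : set F) : 1 <= p ->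
  (forall v, A v -> v = 0) -> p_compact p A.
Proof.
move=> p1 A0; have p0 : p != 0 by rewrite gt_eqF// (lt_le_trans _ p1).
exists (fun=> 0); apply/p_coverP; split.
  by exists 0 => N; rewrite big1// => n _; rewrite rnorm0 powR0.
move=> v /A0 ->; exists (fun=> 0).
  have : (seq_norm (hoelder_conjugate p%:E) (0%R : nat -> K^o) < 1)%E.
    by rewrite seq_norm0 ?conj_ge1.
  by [].
apply/cvg_seq_rnormP => e e0; exists 0%N => n _.
by rewrite seriesE big1 ?subr0 ?rnorm0 ?ltW// => i _; rewrite scaler0.
Qed.

(* The subspace consists of the maps x |-> tensor a (f x); when a_i <> 0, a contraction recovers
   a_i f from tensor a f, so these inherit the lack of p-compactness of f. *)
Lemma spaceable_tensor (E : Type) (s : exponent R) (p q : R)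
    (D : (E -> lbar k s) -> set (lbar k s)) (Q : set (E -> lbar k s)) (f : E -> lbar k s) :
  1 <= p -> 1 <= q ->
  (forall a, D (fun x => tensor a (f x)) = tensor a @` D f) ->
  (forall a, Q (fun x => tensor a (f x))) ->
  p_compact q (D f) -> ~ p_compact p (D f) ->
  @spaceable R k (lbar k s) (E -> lbar k s) (fun g => m_ q (D g))
    ((Q `&` [set g | p_compact q (D g)]) `\` (Q `&` [set g | p_compact p (D g)])).
Proof.
move=> p1 q1 DT QT fq fp; have q0 : 0 < q by rewrite (lt_le_trans _ q1).
pose phi a : E -> lbar k s := fun x => tensor a (f x).
have phil : linear phi by move=> c a b; apply/funext => x; exact: tensor_linearl.
pose Phi : {linear lbar k s -> (E -> lbar k s)} :=
  HB.pack phi (GRing.isLinear.Build _ _ _ _ _ phil).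
have tq a : p_compact q (tensor a @` D f).
  apply: (p_compact_image (C := rnorm a)) => //; first exact: rnorm_ge0.
  by move=> y; exact: rnorm_tensor.
exists Phi => [a|].
  have [->|a0] := eqVneq a 0; first by right; exact: (raddf0 Phi).
  left; split; first by split; [exact: QT|rewrite /= DT].
  move=> [_]; rewrite /= DT => ap; apply: fp.
  have [i ai] : exists i, a i != 0.
    apply: contrapT => ai; move/negP: a0; apply; apply/eqP/lbarP => i.
    by rewrite lbar0E; apply: contrapT => /eqP ain; apply: ai; exists i.
  have [g gle gT] := @tensor_slice R k s i.
  have {}ap : p_compact p (g @` (tensor a @` D f)).
    by apply: (p_compact_image (C := 1)) => // z; rewrite mul1r.
  pose h : {linear lbar k s -> lbar k s} := (a i)^-1 \*: idfun.
  have : p_compact p (h @` (g @` (tensor a @` D f))).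
    apply: (p_compact_image (C := rnorm ((a i)^-1))) => //; first exact: rnorm_ge0.
    by move=> z; rewrite /= rnormZ.
  apply: p_compact_sub => y fy; exists (a i *: y).
    by exists (tensor a y); [exists y|exact: gT].
  by rewrite /= scalerA mulVf// scale1r.
(* A set contained in [{0}] is [p]-compact, so [D f] has a non-zero element; one of its non-zero
   coordinates gives the lower constant. *)
have [y0 fy0 y00] : exists2 y, D f y & y != 0.
  apply: contrapT => H; apply: fp; apply: p_compact_set0 => // v fv.
  by apply: contrapT => /eqP v0; apply: H; exists v.
have [j yj] : exists j, y0 j != 0.
  apply: contrapT => yj; move/negP: y00; apply; apply/eqP/lbarP => i.
  by rewrite lbar0E; apply: contrapT => /eqP yin; apply: yj; exists i.
have yjp : 0 < rnorm (y0 j).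
  by rewrite lt_def rnorm_ge0 andbT; apply: contra yj => /eqP/rnorm0_eq0 ->.
have [x /p_coverP[[M xM] Dx]] := fq.
have M0 : 0 <= M by have := xM 0%N; rewrite big_ord0.
exists (rnorm (y0 j) / 2), (M `^ q^-1 + 1); split.
- by rewrite divr_gt0.
- by rewrite ltr_wpDl ?powR_ge0.
move=> a; rewrite /= DT; apply/andP; split.
  apply: (@le_trans _ _ (rnorm (tensor a y0) / 2)%:E).
    by rewrite lee_fin mulrAC ler_pM2r ?invr_gt0// mulrC tensor_row_contraction.
  by apply: m_ge_half_rnorm => //; exists y0.
apply: (@le_trans _ _ (((rnorm a) `^ q * M) `^ q^-1)%:E).
  apply: (@m_le _ _ _ _ (tensor a \o x)) => // [N|].
    apply: le_trans (ler_wpM2l (powR_ge0 _ _) (xM N)); rewrite mulr_sumr.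
    apply: ler_sum => n _; rewrite -powRM ?rnorm_ge0//; apply: ler_powR_base.
    - exact: ltW.
    - exact: rnorm_ge0.
    - exact: rnorm_tensor.
  apply: subset_trans (p_hull_image (rnorm_ge0 a) (rnorm_tensor a)).
  exact: image_subset.
rewrite lee_fin powRM ?powR_ge0// -powRrM mulfV ?gt_eqF// powRr1 ?rnorm_ge0//.
by rewrite mulrC ler_wpM2r ?rnorm_ge0// lerDl.
Qed.

End p_compactness_measure.

(** * Radial Lipschitz maps *)

Section ramps.
Context {R : realType}.
Implicit Types t : R.

(** For [t >= 0], the length of the part of [[0, t]] lying in [[n, n + 1]]. *)
Definition ramp n t : R := Num.min (Num.max (t - n%:R) 0) 1.

Lemma ramp_le n t u : t <= u -> ramp n t <= ramp n u.
Proof.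
move=> tu; rewrite /ramp le_min !ge_min lexx orbT andbT.
by apply/orP; left; rewrite ge_max !le_max lexx orbT andbT lerD2r tu.
Qed.

Lemma ramp0 n t : t <= n%:R -> ramp n t = 0.
Proof. by move=> tn; rewrite /ramp max_r ?subr_le0// min_l. Qed.

Lemma ramp1 n t : n%:R + 1 <= t -> ramp n t = 1.
Proof.
move=> tn; rewrite /ramp min_r// le_max; apply/orP; left; lra.
Qed.

Lemma sum_ramp N t : 0 <= t -> t <= N%:R -> \sum_(n < N) ramp n t = t.
Proof.
elim: N => [t0 t0'|N IH t0]; first by rewrite big_ord0; apply/eqP; rewrite eq_le t0 t0'.
rewrite -natr1 => tN1; rewrite big_ord_recr/=.
have [tN|Nt] := leP t N%:R; first by rewrite IH// ramp0// addr0.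
rewrite (eq_bigr (fun=> 1)) => [|n _].
  by rewrite sumr_const card_ord /ramp max_l ?subr_ge0 ?(ltW Nt)// min_l; lra.
rewrite ramp1// natr1; apply: le_trans (ltW Nt); by rewrite ler_nat.
Qed.

End ramps.

Section lipschitz_example.
Context {R : realType} {k : scalar_kind} (s : exponent R).
Local Notation K := (scalar_field R k).
Local Notation ofR := (@of_real R k).
Local Notation F := (lbar k s).

Section radial.
Variables (E : normedModType K) (u : nat -> F).

(** As [||x||] grows, the map moves at unit speed along [u_0], then [u_1], and so on, reaching
    [u_0 + ... + u_(N-1)] at norm [N]. The omitted ramps vanish at [||x||]. *)
Definition radial (x : E) : F :=
  \sum_(n < (Num.truncn (rnorm x)).+1) ofR (ramp n (rnorm x)) *: u n.

Lemma radialE N (x : E) : rnorm x <= N%:R ->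
  radial x = \sum_(n < N) ofR (ramp n (rnorm x)) *: u n.
Proof.
move=> xN; pose G M := \sum_(n < M) ofR (ramp n (rnorm x)) *: u n.
have GE M d : rnorm x <= M%:R -> G (M + d)%N = G M.
  move=> xM; rewrite /G big_split_ord/= [X in _ + X]big1 ?addr0// => i _.
  rewrite ramp0 ?of_real0 ?scale0r//; apply: le_trans xM _.
  by rewrite ler_nat leq_addr.
have xT : rnorm x <= (Num.truncn (rnorm x)).+1%:R by rewrite ltW// truncnS_gt.
by rewrite -/(G _) /radial -/(G _) -(GE _ (Num.truncn (rnorm x)).+1 xN) addnC GE.
Qed.

(* The ramps cut [0, ||x||] into unit pieces, so the coefficients of radial x - radial y have the
   same sign and add up to ||x|| - ||y|| in absolute value. *)
Lemma radial_quotient (x y : E) : exists N (th : nat -> R),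
  [/\ radial x - radial y = \sum_(n < N) ofR (th n) *: u n,
      \sum_(n < N) `|th n| <= rnorm (x - y) & forall n, (N <= n)%N -> th n = 0].
Proof.
wlog xy : x y / rnorm y <= rnorm x.
  move=> H; have [/H//|/ltW/H[N [th [th1 th2 th3]]]] := leP (rnorm y) (rnorm x).
  exists N, (fun n => - th n); split.
  - rewrite -opprB th1 -sumrN; apply: eq_bigr => i _.
    by rewrite -scaleNr -raddfN.
  - by rewrite rnormB; under eq_bigr do rewrite normrN.
  - by move=> n /th3 ->; rewrite oppr0.
pose N := (Num.truncn (rnorm x)).+1.
have xN : rnorm x <= N%:R by rewrite ltW// truncnS_gt.
have yN : rnorm y <= N%:R := le_trans xy xN.
exists N, (fun n => ramp n (rnorm x) - ramp n (rnorm y)); split.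
- rewrite (radialE xN) (radialE yN) -sumrB; apply: eq_bigr => n _.
  by rewrite -scalerBl -raddfB.
- rewrite (eq_bigr (fun n : 'I_N => ramp n (rnorm x) - ramp n (rnorm y))) => [|n _].
    rewrite sumrB !sum_ramp ?rnorm_ge0// lerBlDr.
    by have := rnormD (x - y) y; rewrite subrK.
  by rewrite ger0_norm// subr_ge0 ramp_le.
- move=> n Nn; have nN : (N%:R : R) <= n%:R by rewrite ler_nat.
  by rewrite !ramp0 ?subrr// (le_trans _ nN).
Qed.

Lemma radial0 : radial 0 = 0.
Proof.
by rewrite (@radialE 0) ?rnorm0// big_ord0.
Qed.

Lemma finite_sum_hull (q : R) (th : nat -> R) N : 1 <= q ->
  \sum_(n < N) `|th n| <= 1 -> (forall n, (N <= n)%N -> th n = 0) ->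
  p_hull q (fun n => ofR (2 * 1) *: u n) (\sum_(n < N) ofR (th n) *: u n).
Proof.
move=> q1 th1 th0; apply: (@p_hull_scale _ _ _ _ 1 _ (fun n => ofR (th n))) => //.
  apply: conj_norm_le1 => // M; apply: le_trans th1.
  under eq_bigr do rewrite rnorm_of_real.
  have thN d : \sum_(n < N + d) `|th n| = \sum_(n < N) `|th n|.
    by rewrite big_split_ord/= [X in _ + X]big1 ?addr0// => i _; rewrite th0 ?leq_addr ?normr0.
  by rewrite -(thN M); apply: (@ler_sum_ord_le _ (fun n => `|th n|)); [|exact: leq_addl].
apply/cvg_seq_rnormP => e e0; exists N => n /subnKC <-.
rewrite seriesE big_split_ord/= [X in _ - (_ + X)]big1 ?addr0 ?subrr ?rnorm0 ?ltW// => i _.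
by rewrite th0 ?leq_addr// of_real0 scale0r.
Qed.

Lemma radial_contraction : (forall n, rnorm (u n) <= 1) ->
  forall x y, rnorm (radial x - radial y) <= rnorm (x - y).
Proof.
move=> u1 x y; have [N [th [-> th1 _]]] := radial_quotient x y.
apply: le_trans (rnorm_sum _ _ _) _; apply: le_trans th1; apply: ler_sum => n _.
by rewrite rnormZ rnorm_of_real -[leRHS]mulr1 ler_wpM2l.
Qed.

Lemma difference_quotientsE (f : E -> F) : difference_quotients f =
  [set ofR (rnorm (z.1 - z.2))^-1 *: (f z.1 - f z.2) | z in [set z : E * E | z.1 != z.2]].
Proof.
by rewrite /difference_quotients; under eq_imagel do rewrite -rnormE -of_realV.
Qed.

Lemma radial_quotients_hull (q : R) : 1 <= q ->
  difference_quotients radial `<=` p_hull q (fun n => ofR (2 * 1) *: u n).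
Proof.
move=> q1; rewrite difference_quotientsE => _ [[x y] /= xy <-].
have xy0 : 0 < rnorm (x - y).
  rewrite lt_def rnorm_ge0 andbT; apply: contra xy => /eqP/rnorm0_eq0/eqP.
  by rewrite subr_eq0.
have [N [th [-> th1 th0]]] := radial_quotient x y.
rewrite scaler_sumr (eq_bigr (fun n : 'I_N => ofR ((rnorm (x - y))^-1 * th n) *: u n)).
  apply: (@finite_sum_hull q (fun n => (rnorm (x - y))^-1 * th n)) => // [|n /th0 ->];
    last by rewrite mulr0.
  under eq_bigr do rewrite normrM.
  rewrite -mulr_sumr (ger0_norm (ltW _)) ?invr_gt0// ler_pdivrMl// mulr1//.
by move=> n _; rewrite scalerA of_realM.
Qed.

Lemma radial_quotients_mem (v : E) : rnorm v = 1 -> forall n, difference_quotients radial (u n).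
Proof.
move=> v1 n; rewrite difference_quotientsE.
have nv m : rnorm (ofR m%:R *: v) = m%:R by rewrite rnormZ v1 mulr1 rnorm_of_real_ge0.
have v0 : v != 0 by apply/eqP => v0; move: v1; rewrite v0 rnorm0 => /eqP; rewrite eq_sym oner_eq0.
exists (ofR n.+1%:R *: v, ofR n%:R *: v) => /=.
  rewrite -subr_eq0 -scalerBl -raddfB/= scaler_eq0 (negbTE v0) orbF -natr1 addrAC subrr add0r.
  by rewrite of_real1 oner_eq0.
rewrite -scalerBl -raddfB/= -natr1 addrAC subrr add0r of_real1 scale1r v1 invr1 of_real1 scale1r.
rewrite natr1 !(@radialE n.+1) ?nv ?ler_nat// -sumrB big_ord_recr/= big1 => [|i _].
  by rewrite add0r ramp1 ?natr1// ramp0// of_real1 of_real0 scale1r scale0r subr0.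
by rewrite !ramp1 ?subrr// natr1 ler_nat// leqW.
Qed.

End radial.

Lemma enumerated_sum_le (idx : nat -> nat * nat) (sz : nat -> nat) (g : nat -> nat -> R) N :
  (forall J, (J <= sz J)%N) -> (forall i j, 0 <= g i j) ->
  (forall J, \sum_(n < sz J) g (idx n).1 (idx n).2 = \sum_(j < J) \sum_(i < 2 ^ j) g j i) ->
  \sum_(n < N) g (idx n).1 (idx n).2 <= \sum_(j < N) \sum_(i < 2 ^ j) g j i.
Proof.
move=> szJ g0 <-; exact: (@ler_sum_ord_le _ (fun n => g (idx n).1 (idx n).2)).
Qed.

(** Block [e] holds [2^e] vectors of norm at most [C * kap^e] and contributes at most
    [C^q * (2 * kap^q)^e]. The lemma is applied with [kap] for Lipschitz maps and with [kap / th]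
    for polynomials. *)
Lemma weighted_blocks_sum (q kap C : R) (idx : nat -> nat * nat) (sz : nat -> nat)
    (b : nat -> nat -> F) : 0 < q -> 0 < kap -> 0 <= C -> 2 * kap `^ q < 1 ->
  (forall J, (J <= sz J)%N) ->
  (forall (f : nat -> nat -> R) J,
    \sum_(n < sz J) f (idx n).1 (idx n).2 = \sum_(j < J) \sum_(i < 2 ^ j) f j i) ->
  (forall n, rnorm (b (idx n).1 (idx n).2) <= 1) ->
  forall N, \sum_(n < N) rnorm (ofR (C * kap ^+ (idx n).1) *: b (idx n).1 (idx n).2) `^ q <=
        C `^ q * (1 - 2 * kap `^ q)^-1.
Proof.
move=> q0 kap0 C0 kq szJ idxS b1 N.
apply: (@le_trans _ _ (\sum_(n < N) C `^ q * (kap `^ q) ^+ (idx n).1)).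
  apply: ler_sum => n _; rewrite rnormZ rnorm_of_real_ge0; last first.
    by rewrite mulr_ge0 ?exprn_ge0 ?(ltW kap0).
  rewrite -exprn_powR ?(ltW kap0)//.
  rewrite -powRM ?exprn_ge0 ?(ltW kap0)//; apply: ler_powR_base; first exact: ltW.
    by rewrite !mulr_ge0 ?exprn_ge0 ?rnorm_ge0 ?(ltW kap0).
  rewrite -[leRHS]mulr1 ler_wpM2l ?b1//.
  by rewrite mulr_ge0 ?exprn_ge0 ?(ltW kap0).
rewrite -mulr_sumr ler_wpM2l ?powR_ge0//.
apply: le_trans (enumerated_sum_le (g := fun j _ => (kap `^ q) ^+ j) N szJ _ (idxS _)) _.
  by move=> *; rewrite exprn_ge0 ?powR_ge0.
apply: le_trans (geometric_sum_le N _ kq); last by rewrite mulr_ge0 ?powR_ge0.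
apply: ler_sum => j _; rewrite sumr_const card_ord -[leLHS]mulr_natl natrX.
by rewrite exprMn.
Qed.

Lemma lipschitz_spaceable (E : normedModType K) (p q : R) :
  2 <= p -> p < q -> (exists x : E, x != 0) ->
  spaceable F (lipschitz_norm q)
    (p_compact_lipschitz E F q `\` p_compact_lipschitz E F p).
Proof.
move=> p2 pq [x0 x00].
have p0 : 0 < p by rewrite (lt_le_trans _ p2).
have p1 : 1 <= p by rewrite (le_trans _ p2)// ler1n.
have q1 : 1 <= q := le_trans p1 (ltW pq).
have q0 : 0 < q := lt_trans p0 pq.
have [kap [th [kap0 kp /andP[th0 th1] kt thq]]] := block_weights p0 pq.
have kq : 2 * kap `^ q < 1.
  apply: le_lt_trans thq; rewrite ler_pM2l//; apply: ler_powR_base; rewrite ?(ltW q0) ?(ltW kap0)//.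
  by rewrite ler_pdivlMr// -[leRHS]mulr1 ler_pM2l// ltW.
have kap1 : kap <= 1 := le_trans kt (ltW th1).
have /choice[b /choice[L bL]] := @block_system_exists R k s.
have b1 e i : (i < 2 ^ e)%N -> rnorm (b e i) <= 1 by case: (bL e) => _ [+ _ _ _ _]; apply.
have [idx [sz [szJ idx1 idx2 idxS]]] := @block_enum (fun e => 2 ^ e)%N (fun e => expn_gt0 2 e).
have {}idxS := weighted_blocks_sum q0 kap0 ler01 kq szJ (idxS R) (fun n => b1 _ _ (idx1 n)).
pose u n := ofR (kap ^+ (idx n).1) *: b (idx n).1 (idx n).2.
have uE n : ofR (1 * kap ^+ (idx n).1) *: b (idx n).1 (idx n).2 = u n by rewrite mul1r.
have u1 n : rnorm (u n) <= 1.
  rewrite /u rnormZ rnorm_of_real_ge0 ?exprn_ge0 ?(ltW kap0)// -[leRHS]mulr1.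
  by rewrite ler_pM ?exprn_ge0 ?rnorm_ge0 ?(ltW kap0) ?b1// exprn_ile1 ?(ltW kap0).
have xv : rnorm (ofR (rnorm x0)^-1 *: x0) = 1.
  have r0 : rnorm x0 != 0 by apply: contra x00 => /eqP/rnorm0_eq0 ->.
  by rewrite rnormZ rnorm_of_real_ge0 ?invr_ge0 ?rnorm_ge0// mulVf.
pose D (g : E -> F) := difference_quotients g.
have DT a : D (fun x => tensor a (radial u x)) = tensor a @` D (radial u).
  rewrite /D !difference_quotientsE; apply/seteqP; split=> [_ [z zz <-]|_ [_ [z zz <-] <-]].
    exists (ofR (rnorm (z.1 - z.2))^-1 *: (radial u z.1 - radial u z.2)); first by exists z.
    by rewrite linearZ/= (raddfB (tensor a)).
  by exists z => //; rewrite linearZ/= (raddfB (tensor a)).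
have := @spaceable_tensor R k E s p q D [set g | lipschitz g /\ g 0 = 0] (radial u) p1 q1 DT.
have -> : p_compact_lipschitz E F q = [set g | lipschitz g /\ g 0 = 0] `&` [set g | p_compact q (D g)].
  by apply/seteqP; split=> g; [case|case=> -[]].
have -> : p_compact_lipschitz E F p = [set g | lipschitz g /\ g 0 = 0] `&` [set g | p_compact p (D g)].
  by apply/seteqP; split=> g; [case|case=> -[]].
apply.
- move=> a; split; last by rewrite /= radial0 raddf0.
  have PF : ProperFilter (globally ([set: E] `*` [set: E])).
    exact: (globally_properfilter (conj I I : ([set: E] `*` [set: E]) (0, 0))).
  apply: (@klipschitzW _ _ _ (ofR (rnorm a))) => -[x y] _ /=.
  rewrite -(raddfB (tensor a)) -!rnormE -of_realM of_real_le.
  apply: le_trans (rnorm_tensor _ _) _; rewrite ler_wpM2l ?rnorm_ge0//.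
  exact: radial_contraction.
- exists (fun n => ofR (2 * 1) *: u n); apply/p_coverP; split; last exact: radial_quotients_hull.
  exists (2 `^ q * (1 `^ q * (1 - 2 * kap `^ q)^-1)) => N.
  apply: le_trans (ler_wpM2l (powR_ge0 _ _) (idxS N)); rewrite mulr_sumr.
  apply: ler_sum => n _; rewrite uE.
  have -> : 2 * 1 = 2 :> R by rewrite mulr1.
  by rewrite rnormZ rnorm_of_real_ge0// powRM ?rnorm_ge0.
apply: (@not_p_compact_blocks R k s p 1 kap L) => //.
- by move=> e; case: (bL e).
- by move=> e; case: (bL e) => _ [].
- move=> e i ie; have [n nE] := idx2 e i ie; exists (u n).
    exact: radial_quotients_mem xv n.
  have [Ll [_ Lb _ _ _]] := bL e.
  have L0 : L e i 0 = 0.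
    by have := Ll i (-1) 0 0; rewrite scaler0 addr0 scaleN1r addNr.
  have := Ll i (ofR (kap ^+ e)) (b e i) 0; rewrite L0 !addr0 /u nE /= => ->.
  by rewrite Lb// eqxx mulr1n rnormZ rnorm1 mulr1 rnorm_of_real_ge0 ?mul1r ?exprn_ge0 ?(ltW kap0).
Qed.

End lipschitz_example.

(** * Dvoretzky-Rogers functionals *)

Section conjugate_transpose.
Context {R : realType} {k : scalar_kind}.
Local Notation K := (scalar_field R k).
Local Notation ofR := (@of_real R k).

Definition ctr m n (A : 'M[K]_(m, n)) : 'M[K]_(n, m) := (map_mx (@kconj R k) A)^T.

Lemma ctrE m n (A : 'M[K]_(m, n)) i j : ctr A i j = kconj (A j i).
Proof. by rewrite !mxE. Qed.

Lemma ctrK m n (A : 'M[K]_(m, n)) : ctr (ctr A) = A.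
Proof. by apply/matrixP => i j; rewrite !ctrE kconjK. Qed.

Lemma ctr_mul m n p (A : 'M[K]_(m, n)) (B : 'M[K]_(n, p)) : ctr (A *m B) = ctr B *m ctr A.
Proof.
apply/matrixP => i j; rewrite ctrE !mxE raddf_sum/=; apply: eq_bigr => l _.
by rewrite !ctrE kconjM mulrC.
Qed.

Lemma ctrD m n (A B : 'M[K]_(m, n)) : ctr (A + B) = ctr A + ctr B.
Proof. by apply/matrixP => i j; rewrite !mxE raddfD. Qed.

Lemma ctrZ m n (t : R) (A : 'M[K]_(m, n)) : ctr (ofR t *: A) = ofR t *: ctr A.
Proof. by apply/matrixP => i j; rewrite !mxE kconjM kconj_ofR. Qed.

Definition sqnorm n (y : 'cV[K]_n) : R := \sum_i rnorm (y i 0) ^+ 2.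

Lemma sqnorm_ge0 n (y : 'cV[K]_n) : 0 <= sqnorm y.
Proof. by apply: sumr_ge0 => i _; exact: sqr_ge0. Qed.

Lemma ctr_mul_self n (y : 'cV[K]_n) : ctr y *m y = (ofR (sqnorm y))%:M.
Proof.
apply/matrixP => i j; rewrite !ord1 !mxE eqxx mulr1n /sqnorm raddf_sum/=.
by apply: eq_bigr => l _; rewrite ctrE kconj_mul.
Qed.

Lemma sqnorm_inj m n (y : 'cV[K]_n) (z : 'cV[K]_m) :
  ctr y *m y = ctr z *m z -> sqnorm y = sqnorm z.
Proof.
rewrite !ctr_mul_self => /matrixP/(_ 0 0); rewrite !mxE eqxx !mulr1n.
exact: of_real_inj.
Qed.

Lemma sqnormZ n (t : R) (y : 'cV[K]_n) : sqnorm (ofR t *: y) = t ^+ 2 * sqnorm y.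
Proof.
rewrite /sqnorm mulr_sumr; apply: eq_bigr => i _.
by rewrite mxE rnormM exprMn rnorm_of_real real_normK ?num_real.
Qed.

Lemma sqnorm_orth n (y z : 'cV[K]_n) : ctr y *m z = 0 -> sqnorm (y + z) = sqnorm y + sqnorm z.
Proof.
move=> yz; have zy : ctr z *m y = 0.
  by rewrite -(ctrK y) -ctr_mul yz; apply/matrixP => i j; rewrite !mxE raddf0.
apply: (@of_real_inj R k).
have : (ofR (sqnorm (y + z)))%:M = (ofR (sqnorm y + sqnorm z))%:M :> 'M[K]_1.
  rewrite -ctr_mul_self ctrD mulmxDl !mulmxDr yz zy addr0 add0r !ctr_mul_self.
  by apply/matrixP => i j; rewrite !mxE of_realD mulrnDl.
by move/matrixP/(_ 0 0); rewrite !mxE eqxx !mulr1n.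
Qed.

Lemma rnorm_prod (I : Type) (r : seq I) (P : pred I) (F : I -> K) :
  rnorm (\prod_(i <- r | P i) F i) = \prod_(i <- r | P i) rnorm (F i).
Proof. by elim/big_rec2 : _ => [|i y x _ <-]; rewrite ?rnorm1// rnormM. Qed.

Lemma rnormX (a : K) n : rnorm (a ^+ n) = rnorm a ^+ n.
Proof. by elim: n => [|n IH]; rewrite ?expr0 ?rnorm1// !exprS rnormM IH. Qed.

(** Both sides are the determinant of the block matrix with identity diagonal blocks and
    off-diagonal blocks [V] and [W], from which [V] is eliminated by columns or by rows. It brings
    the determinant of a perturbation of rank [j] down to size [j]. *)
Lemma det_sylvester m n (V : 'M[K]_(m, n)) (W : 'M[K]_(n, m)) :
  \det (1%:M - W *m V) = \det (1%:M - V *m W).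
Proof.
have u1 : \det (block_mx 1%:M (- V) 0 1%:M) = 1 by rewrite det_ublock !det1 mulr1.
have l1 : block_mx 1%:M V W 1%:M *m block_mx 1%:M (- V) 0 1%:M =
    block_mx 1%:M 0 W (1%:M - W *m V).
  rewrite mulmx_block !mul1mx !mulmx1 !mulmx0 !addr0 addNr mulmxN.
  by rewrite (addrC (- (W *m V))).
have l2 : block_mx 1%:M (- V) 0 1%:M *m block_mx 1%:M V W 1%:M =
    block_mx (1%:M - V *m W) 0 W 1%:M.
  by rewrite mulmx_block !mul1mx !mulmx1 !mul0mx !add0r mulNmx subrr.
have := congr1 determinant l1; rewrite det_mulmx u1 mulr1 det_lblock det1 mul1r => <-.
by have := congr1 determinant l2; rewrite det_mulmx u1 mul1r det_lblock det1 mulr1.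
Qed.

End conjugate_transpose.

Section dvoretzky_rogers.
Context {R : realType} {k : scalar_kind}.
Local Notation K := (scalar_field R k).
Local Notation ofR := (@of_real R k).
Variable E : normedModType K.

(** Infinite dimension provides an [x] off the span of the [y_i]; subtracting its components gives
    [x'], which the old functionals annihilate. A functional that is non-zero at [x'] is then
    corrected to vanish at the [y_i] and normalized. *)
Lemma biorthogonal_system n : infinite_dimensional E ->
  exists (psi : 'I_n -> E -> K^o) (y : 'I_n -> E) (C : R),
  [/\ forall i, linear (psi i), forall i u, rnorm (psi i u : K) <= C * rnorm u &
      forall i j, psi i (y j) = (i == j)%:R].
Proof.
move=> Einf; elim: n => [|n [psi [y [C [psil psiC psiy]]]]].
  by exists (fun _ _ => 0), (fun=> 0), 0; split => -[].
have [x xy] : exists x : E, x - \sum_i (psi i x : K) *: y i != 0.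
  apply: contrapT => H; apply: Einf; exists n, y => x; exists (fun i => psi i x).
  apply/eqP; rewrite -subr_eq0; apply: contrapT => /negP Hx.
  by apply: H; exists x.
set x' := x - _ in xy.
have psiB i u v : psi i (u - v) = psi i u - psi i v.
  by rewrite addrC -scaleN1r psil scaleN1r addrC.
have psi0 i : psi i 0 = 0 by rewrite -(subrr 0) psiB subrr.
have psi_sum i (a : 'I_n -> K) : psi i (\sum_j a j *: y j) = a i.
  have -> : psi i (\sum_j a j *: y j) = \sum_j a j * psi i (y j).
    elim/big_rec2 : _ => [|j u v _ <-]; first exact: psi0.
    by rewrite psil.
  rewrite (bigD1 i)//= psiy eqxx mulr1 big1 ?addr0// => j ji.
  by rewrite psiy eq_sym (negbTE ji) mulr0.
have psix' i : psi i x' = 0 by rewrite /x' psiB psi_sum subrr.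
have [phi [phiC phix]] := separating_functional xy.
pose c : K := (phi x')^-1.
pose chi (u : E) : K^o := c * (phi u - \sum_j (psi j u : K) * phi (y j)).
pose S := \sum_j rnorm (phi (y j) : K).
have S0 : 0 <= S by apply: sumr_ge0 => *; exact: rnorm_ge0.
have chil : linear chi.
  move=> a u v; rewrite /chi linearP/= (eq_bigr (fun j => a * ((psi j u : K) * phi (y j)) +
     (psi j v : K) * phi (y j))) => [|j _]; last by rewrite psil mulrDl -mulrA.
  rewrite big_split/= -mulr_sumr.
  set S1 := \sum_j _; set S2 := \sum_j _.
  change (c * (a * (phi u : K) + phi v - (a * S1 + S2)) =
    a * (c * ((phi u : K) - S1)) + c * ((phi v : K) - S2)).
  by ring.
pose psi' (i : 'I_n.+1) := if unlift ord_max i is Some j then psi j else chi.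
pose y' (i : 'I_n.+1) := if unlift ord_max i is Some j then y j else x'.
exists psi', y', (`|C| + rnorm c * (2 + S * `|C|)); split.
- by move=> i; rewrite /psi'; case: unliftP.
- move=> i u; rewrite /psi'; have u0 := rnorm_ge0 u.
  have CC j : rnorm (psi j u : K) <= `|C| * rnorm u.
    by apply: le_trans (psiC j u) _; rewrite ler_wpM2r// ler_norm.
  case: unliftP => [j _|_].
    apply: le_trans (CC j) _; rewrite ler_wpM2r// lerDl mulr_ge0 ?rnorm_ge0//.
    by rewrite addr_ge0// mulr_ge0.
  rewrite /chi rnormM mulrDl -mulrA; apply: ler_wpDl; first by rewrite mulr_ge0.
  rewrite ler_wpM2l ?rnorm_ge0//; apply: le_trans (rnormD _ _) _; rewrite rnormN mulrDl.
  apply: lerD; first exact: phiC.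
  apply: le_trans (rnorm_sum _ _ _) _; rewrite /S -mulrA mulr_suml; apply: ler_sum => j _.
  by rewrite rnormM mulrC ler_wpM2l ?rnorm_ge0.
move=> i j; rewrite /psi' /y'.
case: unliftP => [i' ->|->]; case: unliftP => [j' ->|->].
- by rewrite psiy (inj_eq lift_inj).
- by rewrite psix' eq_sym (negbTE (neq_lift _ _)).
- rewrite /chi (negbTE (neq_lift _ _)) (bigD1 j')//= psiy eqxx mul1r big1 ?addr0 ?subrr ?mulr0//.
  by move=> l lj; rewrite psiy (negbTE lj) mul0r.
- rewrite eqxx /chi big1 => [|l _]; last by rewrite psix' mul0r.
  by rewrite subr0 /c mulVf.
Qed.

Section maximal_determinant.
Variables (n : nat) (psi : 'I_n -> E -> K^o) (y : 'I_n -> E) (C : R).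
Hypothesis psil : forall i, linear (psi i).
Hypothesis psiC : forall i u, rnorm (psi i u : K) <= C * rnorm u.
Hypothesis psiy : forall i j, psi i (y j) = (i == j)%:R.

Definition psicol x : 'cV[K]_n := \col_j psi j x.

Lemma psicolD (t : K) u v : psicol (t *: u + v) = t *: psicol u + psicol v.
Proof. by apply/matrixP => i j; rewrite !mxE psil. Qed.

Definition feasible (A : 'M[K]_n) : Prop :=
  forall x, sqnorm (A *m psicol x) <= rnorm x ^+ 2.

(** A determinant above half of the supremum stands in for a maximum, at the price of the bound 2
    instead of 1. The supremum is finite because the columns of [A] are the images of the [y_j], and
    positive because a small multiple of the identity is feasible. *)
Lemma near_maximal_determinant : exists2 A, feasible A &
  forall B, feasible (B *m A) -> rnorm (\det B) < 2.
Proof.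
pose S := [set rnorm (\det A) | A in feasible].
have Aij A i j : feasible A -> rnorm (A i j) <= rnorm (y j).
  move=> /(_ (y j)) H; rewrite -(ler_pXn2r (n := 2)) ?nnegrE ?rnorm_ge0//.
  apply: le_trans H; rewrite /sqnorm (bigD1 i)//=.
  rewrite (_ : (A *m psicol (y j)) i 0 = A i j).
    by rewrite lerDl sumr_ge0// => *; exact: sqr_ge0.
  rewrite mxE (bigD1 j)//= mxE psiy eqxx mulr1 big1 ?addr0// => l lj.
  by rewrite mxE psiy (negbTE lj) mulr0.
have Sub : has_ubound S.
  exists (\sum_(s : 'S_n) \prod_i rnorm (y (s i))) => _ [A Af <-].
  apply: le_trans (rnorm_sum _ _ _) _; apply: ler_sum => s _.
  rewrite rnormM rnormX rnormN rnorm1 expr1n mul1r rnorm_prod.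
  by apply: ler_prod => i _; rewrite rnorm_ge0 Aij.
pose e := (n%:R * C ^+ 2 + 1)^-1.
have nC0 : 0 <= n%:R * C ^+ 2 by rewrite mulr_ge0 ?sqr_ge0.
have e0 : 0 < e by rewrite invr_gt0 ltr_wpDl.
have ef : feasible (ofR e)%:M.
  move=> x; rewrite mul_scalar_mx sqnormZ.
  have e1 : e <= 1 by rewrite invf_le1 ?ltr_wpDl// lerDr.
  apply: (@le_trans _ _ (e * (n%:R * C ^+ 2 * rnorm x ^+ 2))).
    apply: ler_pM; rewrite ?sqr_ge0 ?sqnorm_ge0//.
      by rewrite expr2 -[leRHS]mulr1 ler_wpM2l// ltW.
    rewrite -mulrA mulr_natl -[X in _ *+ X](card_ord n) -sumr_const.
    apply: ler_sum => i _; rewrite mxE -exprMn.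
    have Cx : 0 <= C * rnorm x by apply: le_trans (psiC i x); exact: rnorm_ge0.
    by rewrite lerXn2r ?nnegrE ?rnorm_ge0.
  rewrite mulrA -[leRHS]mul1r ler_wpM2r ?sqr_ge0// /e ler_pdivrMl ?ltr_wpDl//.
  by rewrite mulr1 lerDl.
have S0 : 0 < sup S.
  apply: (@lt_le_trans _ _ (rnorm (\det ((ofR e)%:M : 'M[K]_n)))).
    by rewrite det_scalar rnormX rnorm_of_real_ge0 ?exprn_gt0// ltW.
  by apply: ub_le_sup => //; exists (ofR e)%:M.
have hS : has_sup S by split => //; exists (rnorm (\det ((ofR e)%:M : 'M[K]_n))); exists (ofR e)%:M.
have [_ [A Af <-] Am] := sup_adherent (divr_gt0 S0 (ltr0n R 2)) hS.
exists A => // B BA; have : rnorm (\det (B *m A)) <= sup S.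
  by apply: ub_le_sup => //; exists (B *m A).
rewrite det_mulmx rnormM => BAm.
have Ad : 0 < rnorm (\det A) by apply: lt_trans Am; lra.
rewrite -(ltr_pM2r Ad); apply: le_lt_trans BAm _.
by lra.
Qed.

End maximal_determinant.

Definition ortho n (v : nat -> 'rV[K]_n) j : 'M[K]_(j, n) := \matrix_(i < j) v i.

(* If all x had component at most ||x|| / 8 off the span of the chosen rows, stretching the
   orthogonal complement by 4 and halving the span would keep feasibility while at least
   doubling the determinant. *)
Lemma orthonormal_selection n (phi : E -> 'cV[K]_n) (j : nat) :
  (forall (t : K) u v, phi (t *: u + v) = t *: phi u + phi v) ->
  (forall x, sqnorm (phi x) <= rnorm x ^+ 2) ->
  (forall B : 'M[K]_n, (forall x, sqnorm (B *m phi x) <= rnorm x ^+ 2) -> rnorm (\det B) < 2) ->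
  (2 * j <= n)%N ->
  exists v : nat -> 'rV[K]_n, ortho v j *m ctr (ortho v j) = 1%:M /\
    forall i, (i < j)%N -> exists2 x, rnorm x <= 1 & 1 / 8 <= rnorm ((v i *m phi x) 0 0).
Proof.
move=> phil phi1 phid; elim: j => [|j IH] jn.
  by exists (fun=> 0); split => //; apply/matrixP => -[].
have [|v [vo vx]] := IH; first by apply: leq_trans jn; rewrite leq_mul2l leqnSn.
set V := ortho v j in vo.
have phiZ (t : K) x : phi (t *: x) = t *: phi x.
  have phi0 : phi 0 = 0 by have := phil (-1) 0 0; rewrite scaler0 addr0 scaleN1r addNr.
  by have := phil t x 0; rewrite phi0 !addr0.
pose z x := phi x - ctr V *m (V *m phi x).
have Vz x : V *m z x = 0 by rewrite mulmxBr (mulmxA V) vo mul1mx subrr.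
have zV x : ctr (z x) *m ctr V = 0.
  by rewrite -ctr_mul Vz; apply/matrixP => a b; rewrite !mxE raddf0.
have zZ (t : K) x : z (t *: x) = t *: z x by rewrite /z phiZ -!scalemxAr scalerBr.
have phiz x : phi x = z x + ctr V *m (V *m phi x) by rewrite subrK.
have zo x : ctr (z x) *m (ctr V *m (V *m phi x)) = 0 by rewrite mulmxA zV mul0mx.
have [x xz] : exists x, rnorm x ^+ 2 / 64 < sqnorm (z x).
  apply: contrapT => H; have {}H x : sqnorm (z x) <= rnorm x ^+ 2 / 64.
    by rewrite leNgt; apply/negP => zx; apply: H; exists x.
  (* [B] acts on the span of the rows as [4 * (1 - 7/8) = 1/2] and has determinant [4^n / 8^j],
     which is at least 2 because [2 * (j + 1) <= n]. The threshold 1/64 gives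
     [16 * ||z||^2 <= ||x||^2 / 4], so [B] keeps [phi] a contraction. *)
  pose B : 'M[K]_n := ofR 4 *: (1%:M - (ofR (7 / 8) *: ctr V) *m V).
  have : rnorm (\det B) < 2.
    apply: phid => x; have -> : B *m phi x =
        ofR 4 *: z x + ofR (1 / 2) *: (ctr V *m (V *m phi x)).
      rewrite /B -scalemxAl mulmxBl mul1mx -!scalemxAl -mulmxA.
      rewrite {1}(phiz x) -addrA scalerDr; congr (_ + _).
      rewrite -{1}(scale1r (ctr V *m _)) -scalerBl scalerA -(of_real1 R k) -raddfB/=.
      by rewrite -of_realM; congr (ofR _ *: _); field.
    rewrite sqnorm_orth; last by rewrite ctrZ -scalemxAl -scalemxAr zo !scaler0.
    rewrite !sqnormZ; have := phi1 x; rewrite {1}(phiz x) sqnorm_orth//.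
    have := H x; have := sqnorm_ge0 (z x); have := sqr_ge0 (rnorm x); lra.
  rewrite ltNge => /negP; apply.
  rewrite /B detZ rnormM rnormX rnorm_of_real_ge0// det_sylvester.
  have -> : 1%:M - V *m (ofR (7 / 8) *: ctr V) = (ofR 8^-1)%:M.
    rewrite -scalemxAr vo scalemx1 -[in RHS](_ : 1 - 7 / 8 = 8^-1); last by field.
    by apply/matrixP => a b; rewrite !mxE of_real_is_additive of_real1 mulrnBl.
  rewrite det_scalar rnormX.
  rewrite rnorm_of_real_ge0 ?invr_ge0// exprVn ler_pdivlMr ?exprn_gt0//.
  have -> : 2 * 8 ^+ j = (2 ^ (3 * j).+1)%:R :> R 
    by rewrite natrX exprS exprM; congr (_ * _ ^+ _); ring.
  have -> : 4 ^+ n = (2 ^ (2 * n))%:R :> R by rewrite natrX exprM; congr (_ ^+ _); ring.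
  rewrite ler_nat leq_exp2l// -(leq_add2r j) -addSn.
  have -> : ((3 * j).+1 + j = (2 * (2 * j)).+1)%N 
    by rewrite mulnA -[(2 * 2)%N]/4%N -[4%N]addn1 mulnDl mul1n addSn.
  apply: (@leq_trans (2 * n)%N); last exact: leq_addr.
  apply: (@leq_trans (2 * (2 * j.+1))); last by rewrite leq_mul2l.
  by rewrite mulnS mulnDr -addn1 addnC leq_add2r.
have x0 : rnorm x != 0.
  have z0 : z 0 = 0 by have := zZ 0 0; rewrite !scale0r.
  have s0 : sqnorm (0 : 'cV[K]_n) = 0.
    by rewrite /sqnorm big1// => i _; rewrite mxE rnorm0 expr0n.
  apply/eqP => x0; move: xz; rewrite x0 (rnorm0_eq0 x0) z0 s0 expr0n/= mul0r ltxx.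
  by [].
have xp : 0 < rnorm x by rewrite lt_def x0 rnorm_ge0.
pose x' := ofR (rnorm x)^-1 *: x.
have x'1 : rnorm x' = 1 by rewrite rnormZ rnorm_of_real_ge0 ?invr_ge0 ?rnorm_ge0// mulVf.
have x'z : 1 / 64 < sqnorm (z x').
  rewrite /x' zZ sqnormZ exprVn ltr_pdivlMl ?exprn_gt0//.
  by rewrite mulrA mulr1.
pose d := Num.sqrt (sqnorm (z x')).
have sp : 0 < sqnorm (z x') by rewrite (lt_trans _ x'z).
have d0 : 0 < d by rewrite sqrtr_gt0.
have d2 : d ^+ 2 = sqnorm (z x') by rewrite sqr_sqrtr// ltW.
(* The new row is the normalized component of [phi x'] orthogonal to the old ones; its value at [x']
   is the length [d > 1/8] of that component. *)
pose a : 'rV[K]_n := ofR d^-1 *: ctr (z x').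
have aa : a *m ctr a = 1%:M.
  rewrite /a ctrZ ctrK -scalemxAl -scalemxAr scalerA -of_realM ctr_mul_self.
  rewrite -d2 scale_scalar_mx -of_realM; congr _%:M; rewrite -(of_real1 R k); congr ofR.
  by field; rewrite gt_eqF.
have aV : a *m ctr V = 0 by rewrite /a -scalemxAl zV scaler0.
have aphi : (a *m phi x') 0 0 = ofR d.
  rewrite (phiz x') mulmxDr mulmxA aV mul0mx addr0 /a -scalemxAl ctr_mul_self.
  rewrite -d2 scale_scalar_mx -of_realM mxE eqxx mulr1n; congr ofR.
  by field; rewrite gt_eqF.
exists (fun i => if i == j then a else v i); split; last first.
  move=> i; rewrite ltnS leq_eqVlt => /predU1P[->|ij]; last by rewrite (ltn_eqF ij); exact: vx.
  exists x'; first by rewrite x'1.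
  rewrite eqxx aphi rnorm_of_real_ge0 ?(ltW d0)// /d.
  rewrite -(ler_pXn2r (n := 2)) ?nnegrE ?sqrtr_ge0// d2 ltW//.
  by apply: le_lt_trans x'z; lra.
have rowE (w : nat -> 'rV[K]_n) m (i i' : 'I_m) :
    (ortho w m *m ctr (ortho w m)) i i' = (w i *m ctr (w i')) 0 0.
  by rewrite !mxE; apply: eq_bigr => l _; rewrite !mxE.
have vE (i i' : nat) : (i < j)%N -> (i' < j)%N -> (v i *m ctr (v i')) 0 0 = (i == i')%:R.
  move=> ij ij'; have := rowE v j (Ordinal ij) (Ordinal ij').
  by rewrite vo mxE => <-.
have avE (i : nat) : (i < j)%N -> (a *m ctr (v i)) 0 0 = 0.
  move=> ij; have /matrixP/(_ 0 (Ordinal ij)) := aV; rewrite [RHS]mxE => <-.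
  by rewrite !mxE; apply: eq_bigr => l _; rewrite !mxE.
have vaE (i : nat) : (i < j)%N -> (v i *m ctr a) 0 0 = 0.
  move=> ij; rewrite -[v i]ctrK -ctr_mul ctrE avE// raddf0//.
apply/matrixP => i i'; rewrite rowE [RHS]mxE.
have [ij|ij] := eqVneq (i : nat) j; have [ij'|ij'] := eqVneq (i' : nat) j.
- rewrite aa mxE eqxx mulr1n (_ : i = i') ?eqxx//.
  by apply: val_inj; rewrite /= ij ij'.
- have ltj : (i' < j)%N by have := ltn_ord i'; rewrite ltnS leq_eqVlt (negbTE ij').
  have -> : (i == i') = false.
    by apply/negbTE; apply: contra ij' => /eqP <-; apply/eqP.
  exact: avE.
- have ltj : (i < j)%N by have := ltn_ord i; rewrite ltnS leq_eqVlt (negbTE ij).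
  have -> : (i == i') = false.
    by apply/negbTE; apply: contra ij => /eqP ->; apply/eqP.
  exact: vaE.
have ltj : (i < j)%N by have := ltn_ord i; rewrite ltnS leq_eqVlt (negbTE ij).
have ltj' : (i' < j)%N by have := ltn_ord i'; rewrite ltnS leq_eqVlt (negbTE ij').
exact: vE.
Qed.

(** Orthonormal rows composed with a contraction into Euclidean space satisfy the Bessel inequality.
    Dimension [2 * m] leaves room for [m] selections. *)
Lemma dvoretzky_rogers m : infinite_dimensional E ->
  exists f : nat -> E -> K^o,
  [/\ forall i, linear (f i),
      forall x, \sum_(i < m) rnorm (f i x : K) ^+ 2 <= rnorm x ^+ 2 &
      forall i, (i < m)%N -> exists2 x, rnorm x <= 1 & 1 / 8 <= rnorm (f i x : K)].
Proof.
move=> Einf; have [psi [y [C [psil psiC psiy]]]] := biorthogonal_system (2 * m) Einf.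
have [A Af Ad] := near_maximal_determinant psiC psiy.
pose phi x := A *m psicol psi x.
have phil (t : K) u v : phi (t *: u + v) = t *: phi u + phi v.
  by rewrite /phi (psicolD psil) mulmxDr scalemxAr.
have [B Bf|v [vo vx]] := @orthonormal_selection _ phi m phil Af _ (leqnn _).
  by apply: Ad => x; rewrite -mulmxA; exact: Bf.
exists (fun i x => (v i *m phi x) 0 0); split => //.
  by move=> i t u w; rewrite phil mulmxDr -scalemxAr !mxE.
move=> x; apply: le_trans (Af x); rewrite -/(phi x).
set V := ortho v m in vo.
have -> : \sum_(i < m) rnorm ((v i *m phi x) 0 0) ^+ 2 = sqnorm (V *m phi x).
  apply: eq_bigr => i _; congr (rnorm _ ^+ 2); rewrite !mxE.
  by apply: eq_bigr => l _; rewrite !mxE.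
pose z := phi x - ctr V *m (V *m phi x).
have zV : ctr z *m ctr V = 0.
  rewrite -ctr_mul /z mulmxBr (mulmxA V (ctr V)) vo mul1mx subrr.
  by apply/matrixP => a b; rewrite !mxE raddf0.
have -> : sqnorm (phi x) = sqnorm z + sqnorm (ctr V *m (V *m phi x)).
  by rewrite -sqnorm_orth ?subrK// mulmxA zV mul0mx.
have -> : sqnorm (ctr V *m (V *m phi x)) = sqnorm (V *m phi x).
  by apply: sqnorm_inj; rewrite ctr_mul ctrK -mulmxA (mulmxA V (ctr V)) vo mul1mx.
by rewrite lerDr sqnorm_ge0.
Qed.

End dvoretzky_rogers.

(** * Spaceability of polynomials *)

Section multilinear_maps.
Context {R : realType} {k : scalar_kind}.
Local Notation K := (scalar_field R k).
Variables (E F : normedModType K).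

Lemma rnorm_lim_le (u : nat -> F) (l : F) (c : R) : u @ \oo --> l ->
  (forall n, rnorm (u n) <= c) -> rnorm l <= c.
Proof.
move=> /cvg_seq_rnormP ul uc; apply/ler_addgt0Pr => e /ul[N HN].
rewrite -(subrK (u N) l) addrC; apply: le_trans (rnormD _ _) _.
by rewrite lerD// HN.
Qed.

Lemma seq_lim_unique (u : nat -> F) (l l' : F) : u @ \oo --> l -> u @ \oo --> l' -> l = l'.
Proof. by move=> ul ul'; apply: (cvg_unique (@norm_hausdorff _ F) ul ul'). Qed.

(** The source carries the topology of pointwise convergence. The arguments are exchanged one at a
    time, [h m] taking the first [m] from [w] and the others from [v], and the differences
    telescope. *)
Lemma multilinear_continuous n (M : ('I_n -> E) -> F) (C : R) : multilinear M ->
  (forall v, rnorm (M v) <= C * \prod_j rnorm (v j)) ->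
  continuous (M : {ptws 'I_n -> E} -> F).
Proof.
move=> Mlin MC v.
have FF : Filter (nbhs (v : {ptws 'I_n -> E})) by exact: nbhs_filter.
apply: (iffRL (@cvg_rnormP R k F (fmap (M : {ptws 'I_n -> E} -> F)
  (nbhs (v : {ptws 'I_n -> E}))) (M v) _)) => e e0.
change (nbhs (v : {ptws 'I_n -> E})
  [set w : {ptws 'I_n -> E} | rnorm (M v - M w) <= e]).
pose A := 1 + \sum_j rnorm (v j) + 1.
have A1 : 1 <= A by rewrite /A -addrA lerDl addr_ge0 ?sumr_ge0// => *; exact: rnorm_ge0.
have vA j : rnorm (v j) + 1 <= A.
  rewrite lerD2r (bigD1 j)//= addrCA lerDl addr_ge0 ?sumr_ge0// => *; exact: rnorm_ge0.
pose D := n%:R * (`|C| * A ^+ n) + 1.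
have D0 : 0 < D by rewrite ltr_wpDl// !mulr_ge0 ?exprn_ge0// (le_trans _ A1).
pose d := Num.min 1 (e / D).
have d0 : 0 < d by rewrite lt_min ltr01 divr_gt0.
have d1 : d <= 1 by rewrite ge_min lexx.
have close : nbhs (v : {ptws 'I_n -> E})
    [set w : {ptws 'I_n -> E} | forall j, rnorm (v j - w j) <= d].
  apply: (@filter_forall _ _
    (fun (j : 'I_n) (w : {ptws 'I_n -> E}) => rnorm (v j - w j) <= d) _ FF) => j.
  exact: (iffLR (@cvg_rnormP R k E (fmap (@proj 'I_n (fun=> E) j)
    (nbhs (v : {ptws 'I_n -> E}))) (v j) _) (@proj_continuous 'I_n (fun=> E) j v) d d0).
apply: filterS close => w vw.
have wA j : rnorm (w j) <= A.
  rewrite -(subrK (v j) (w j)) addrC; apply: le_trans (rnormD _ _) _.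
  by apply: le_trans (vA j); rewrite lerD2l rnormB (le_trans (vw j)).
pose h m (j : 'I_n) := if (j < m)%N then w j else v j.
have hA m j : rnorm (h m j) <= A.
  by rewrite /h; case: ifP => // _; apply: le_trans (vA j); rewrite lerDl.
have step m : (m < n)%N -> rnorm (M (h m) - M (h m.+1)) <= `|C| * A ^+ n * d.
  move=> mn; pose i := Ordinal mn.
  pose U z : 'I_n -> E := fun j => if j == i then z else h m j.
  have Ulin := Mlin i (h m).
  have UB (x y : E) : M (U (x - y)) = M (U x) - M (U y).
    by rewrite [x - y]addrC -scaleN1r Ulin scaleN1r addrC.
  have hm : h m = U (v i).
    by apply/funext => j; rewrite /U; case: eqP => // ->; rewrite /h ltnn.
  have hm1 : h m.+1 = U (w i).
    apply/funext => j; rewrite /U /h ltnS leq_eqVlt -[(j == m :> nat)]/(j == i).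
    by case: eqP => [->|].
  rewrite {1}hm hm1 -UB; apply: le_trans (MC _) _.
  apply: (@le_trans _ _ (`|C| * \prod_j rnorm (U (v i - w i) j))).
    by rewrite ler_wpM2r ?ler_norm// prodr_ge0// => *; exact: rnorm_ge0.
  rewrite -mulrA ler_wpM2l// (bigD1 i)//= {1}/U eqxx mulrC.
  have rp : 0 <= \prod_(j < n | j != i) rnorm (U (v i - w i) j).
    by apply: prodr_ge0 => *; exact: rnorm_ge0.
  apply: ler_pM; [exact: rp|exact: rnorm_ge0| |exact: vw].
  apply: (@le_trans _ _ (\prod_(j < n) A)); last by rewrite prodr_const card_ord.
  rewrite [leRHS](bigD1 i)//= -[leLHS]mul1r.
  apply: ler_pM => //.
  apply: ler_prod => j ji; rewrite rnorm_ge0 /= /U (negbTE ji); exact: hA.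
have h0 : h 0%N = v by apply/funext => j; rewrite /h ltn0.
have hn : h n = w by apply/funext => j; rewrite /h ltn_ord.
have tele m : (m <= n)%N -> rnorm (M v - M (h m)) <= m%:R * (`|C| * A ^+ n * d).
  elim: m => [_|m IH mn]; first by rewrite h0 subrr rnorm0 mul0r.
  rewrite -(subrK (M (h m)) (M v)) -addrA -natr1 mulrDl mul1r.
  apply: le_trans (rnormD _ _) _; apply: lerD; last exact: step.
  exact: IH (ltnW mn).
have := tele n (leqnn n); rewrite hn => /le_trans; apply.
have dD : d <= e / D by rewrite ge_min lexx orbT.
apply: (@le_trans _ _ (D * d)).
  by rewrite mulrA ler_wpM2r ?(ltW d0)// /D lerDl.
by rewrite -ler_pdivlMl// mulrC.
Qed.

Lemma bounded_homogeneous_polynomial n (M : ('I_n -> E) -> F) (C : R) : multilinear M ->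
  (forall (t : 'S_n) v, M (v \o t) = M v) ->
  (forall v, rnorm (M v) <= C * \prod_j rnorm (v j)) ->
  homogeneous_polynomial n (fun x => M (fun=> x)).
Proof.
by move=> Ml Ms MC; exists M; split => //; exact: multilinear_continuous MC.
Qed.

End multilinear_maps.

Section polynomial_example.
Context {R : realType} {k : scalar_kind}.
Local Notation K := (scalar_field R k).
Local Notation ofR := (@of_real R k).

Lemma cauchy_schwarz (I : finType) (a b : I -> R) (A B : R) : 0 <= A -> 0 <= B ->
  (forall i, 0 <= a i) -> (forall i, 0 <= b i) ->
  \sum_i a i ^+ 2 <= A ^+ 2 -> \sum_i b i ^+ 2 <= B ^+ 2 -> \sum_i a i * b i <= A * B.
Proof.
move=> A0 B0 a0 b0 aA bB.
have sq0 (c : I -> R) : \sum_i c i ^+ 2 <= 0 -> forall i, c i = 0.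
  move=> c0 i; apply/eqP; rewrite -sqrf_eq0; apply/eqP.
  have cc (j : I) : true -> 0 <= c j ^+ 2 by move=> _; exact: sqr_ge0.
  apply: (psumr_eq0P cc) => //.
  by apply/eqP; rewrite eq_le c0 sumr_ge0// => *; exact: sqr_ge0.
have [A00|An0] := eqVneq A 0.
  rewrite A00 mul0r big1// => i _; rewrite (sq0 a) ?mul0r//.
  by move: aA; rewrite A00 expr0n.
have [B00|Bn0] := eqVneq B 0.
  rewrite B00 mulr0 big1// => i _; rewrite (sq0 b) ?mulr0//.
  by move: bB; rewrite B00 expr0n.
have AB : 0 < 2 * (A * B) by rewrite !mulr_gt0// lt_def ?An0 ?Bn0.
rewrite -(ler_pM2l AB) mulr_sumr.
apply: (@le_trans _ _ (\sum_i (B ^+ 2 * a i ^+ 2 + A ^+ 2 * b i ^+ 2))).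
  apply: ler_sum => i _; have := sqr_ge0 (B * a i - A * b i); rewrite -subr_ge0 => h.
  rewrite -subr_ge0; move: h; rewrite subr0; congr (_ <= _); ring.
rewrite big_split/= -!mulr_sumr.
have h1 := ler_wpM2l (sqr_ge0 B) aA; have h2 := ler_wpM2l (sqr_ge0 A) bB.
by apply: le_trans (lerD h1 h2) _; rewrite le_eqVlt; apply/orP; left; apply/eqP; ring.
Qed.

(** This is where the degree has to be at least 2: the Bessel inequality and Cauchy-Schwarz on two
    of the factors give absolute summability with a bound free of [N], whereas a single factor is
    only square summable. The other factors are bounded by norms. *)
Lemma sum_prod_functionals_le (E : normedModType K) d N (f : nat -> E -> K^o) (v : 'I_d.+2 -> E) :
  (forall x, \sum_(i < N) rnorm (f i x : K) ^+ 2 <= rnorm x ^+ 2) ->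
  \sum_(i < N) \prod_j rnorm (f i (v j) : K) <= \prod_j rnorm (v j).
Proof.
move=> f1; have f2 (i : 'I_N) x : rnorm (f i x : K) <= rnorm x.
  rewrite -(ler_pXn2r (n := 2)) ?nnegrE ?rnorm_ge0//; apply: le_trans (f1 x).
  by rewrite (bigD1 i)//= lerDl sumr_ge0// => *; exact: sqr_ge0.
rewrite !big_ord_recl/= mulrA; under eq_bigr do rewrite !big_ord_recl/= mulrA.
set P := \prod_j _.
have P0 : 0 <= P by apply: prodr_ge0 => *; exact: rnorm_ge0.
apply: (@le_trans _ _ (\sum_(i < N) rnorm (f i (v ord0) : K) *
    rnorm (f i (v (lift ord0 ord0)) : K) * P)).
  apply: ler_sum => i _; rewrite ler_wpM2l ?mulr_ge0 ?rnorm_ge0//.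
  by apply: ler_prod => j _; rewrite rnorm_ge0 f2.
rewrite -mulr_suml ler_wpM2r//.
by apply: cauchy_schwarz; rewrite ?rnorm_ge0// => *; exact: rnorm_ge0.
Qed.

(* The polynomial is P x = sum_(e, i) kap^e f_(e,i)(x)^d b_(e,i), where the f_e are
   Dvoretzky-Rogers functionals and the b_e are the vectors of a block system. *)
Lemma polynomial_spaceable (s : exponent R) (E : normedModType K) (p q : R) d :
  2 <= p -> p < q -> infinite_dimensional E -> (2 <= d)%N ->
  spaceable (lbar k s) (polynomial_norm q)
    (p_compact_polynomials E (lbar k s) q d `\` p_compact_polynomials E (lbar k s) p d).
Proof.
move=> p2 pq Einf; case: d => [//|[//|d]] _; set F := lbar k s.
have p0 : 0 < p by rewrite (lt_le_trans _ p2).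
have p1 : 1 <= p by rewrite (le_trans _ p2)// ler1n.
have q1 : 1 <= q := le_trans p1 (ltW pq).
have q0 : 0 < q := lt_trans p0 pq.
have [kap [th [kap0 kp /andP[th0 th1] kt thq]]] := block_weights p0 pq.
have kap1 : kap < 1 := le_lt_trans kt th1.
have kt0 : 0 < kap / th by rewrite divr_gt0.
have /choice[b /choice[L bL]] := @block_system_exists R k s.
have /choice[f fP] := fun e => @dvoretzky_rogers R k E (2 ^ e)%N Einf.
have f1 e x : \sum_(i < 2 ^ e) rnorm (f e i x : K) ^+ 2 <= rnorm x ^+ 2 by case: (fP e).
have fl e i : linear (f e i) by case: (fP e).
have [idx [sz [szJ idx1 idx2 idxS]]] := @block_enum (fun e => 2 ^ e)%N (fun e => expn_gt0 2 e).
have b1 n : rnorm (b (idx n).1 (idx n).2) <= 1.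
  by case: (bL (idx n).1) => _ [+ _ _ _ _]; apply.
pose T n (v : 'I_d.+2 -> E) : K := ofR (kap ^+ (idx n).1) * \prod_j f (idx n).1 (idx n).2 (v j).
pose B n : F := b (idx n).1 (idx n).2.
(* Used twice: [g = kap] makes the series of [M v] converge absolutely, and [g = th] bounds the
   coefficients of its hull representation. *)
have g_sum (g : R) (v : 'I_d.+2 -> E) N : 0 < g -> g < 1 ->
    \sum_(n < N) g ^+ (idx n).1 * \prod_j rnorm (f (idx n).1 (idx n).2 (v j) : K) <=
    (1 - g)^-1 * \prod_j rnorm (v j).
  move=> g0 g1.
  apply: le_trans (enumerated_sum_le (g := fun e i => g ^+ e * \prod_j rnorm (f e i (v j) : K))
    N szJ _ (idxS R _)) _.
    move=> e i; rewrite mulr_ge0 ?exprn_ge0 ?(ltW g0)//.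
    by apply: prodr_ge0 => *; exact: rnorm_ge0.
  apply: le_trans (ler_wpM2r _ (geometric_sum_le N (ltW g0) g1)).
    rewrite mulr_suml; apply: ler_sum => e _; rewrite -mulr_sumr.
    by rewrite ler_wpM2l ?exprn_ge0 ?(ltW g0)// sum_prod_functionals_le.
  by apply: prodr_ge0 => *; exact: rnorm_ge0.
have TB v N : \sum_(n < N) rnorm (T n v *: B n) <= (1 - kap)^-1 * \prod_j rnorm (v j).
  apply: le_trans (g_sum kap v N kap0 kap1); apply: ler_sum => n _.
  rewrite rnormZ rnormM rnorm_of_real_ge0 ?exprn_ge0 ?(ltW kap0)// rnorm_prod -[leRHS]mulr1.
  rewrite ler_wpM2l ?b1// mulr_ge0 ?exprn_ge0 ?(ltW kap0)//.
  by apply: prodr_ge0 => *; exact: rnorm_ge0.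
have /choice[M MP] : forall v, exists l : F, series (fun n => T n v *: B n) @ \oo --> l.
  by move=> v; exact: abs_series_cvg (TB v).
have Mlin : multilinear M.
  move=> i v a x y; pose U z : 'I_d.+2 -> E := fun j => if j == i then z else v j.
  have TE n z : T n (U z) = ofR (kap ^+ (idx n).1) *
      ((f (idx n).1 (idx n).2 z : K) * \prod_(j | j != i) f (idx n).1 (idx n).2 (v j)).
    rewrite /T (bigD1 i)//= {1}/U eqxx; congr (_ * (_ * _)).
    by apply: eq_bigr => j ji; rewrite /U (negbTE ji).
  have TU n : T n (U (a *: x + y)) = a * T n (U x) + T n (U y).
    rewrite !TE fl; set P3 := \prod_(_ | _) _.
    set fx := f _ _ x; set fy := f _ _ y.
    change (ofR (kap ^+ (idx n).1) * ((a * (fx : K) + fy) * P3) =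
      a * (ofR (kap ^+ (idx n).1) * (fx * P3)) + ofR (kap ^+ (idx n).1) * (fy * P3)).
    by ring.
  apply: (seq_lim_unique (MP (U (a *: x + y)))).
  rewrite (_ : series _ = a *: series (fun n => T n (U x) *: B n) +
      series (fun n => T n (U y) *: B n)).
    by apply: cvgD; [apply: cvgZr; exact: MP|exact: MP].
  apply/funext => n; transitivity (a *: series (fun n => T n (U x) *: B n) n +
    series (fun n => T n (U y) *: B n) n); last by [].
  rewrite !seriesE scaler_sumr -big_split/=; apply: eq_bigr => m _.
  by rewrite TU scalerDl scalerA.
have Msym (t : 'S_d.+2) v : M (v \o t) = M v.
  apply: (seq_lim_unique (MP (v \o t))); rewrite (_ : (fun n => _) = (fun n => T n v *: B n)).
    exact: MP.
  apply/funext => n; congr (_ *: _); rewrite /T; congr (_ * _).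
  by rewrite [RHS](reindex_inj (@perm_inj _ t)).
have MC v : rnorm (M v) <= (1 - kap)^-1 * \prod_j rnorm (v j).
  apply: rnorm_lim_le (MP v) _ => n; rewrite seriesE.
  by apply: le_trans (rnorm_sum _ _ _) (TB v n).
pose D (g : E -> F) := g @` ball 0 1.
have DT a : D (fun x => tensor a (M (fun=> x))) = tensor a @` D (fun x => M (fun=> x)).
  by rewrite /D image_comp.
have := @spaceable_tensor R k E s p q D (homogeneous_polynomial d.+2) (fun x => M (fun=> x)) p1 q1 DT.
apply.
- move=> a; apply: (@bounded_homogeneous_polynomial _ _ _ _ _ (fun v => tensor a (M v))
    (rnorm a * (1 - kap)^-1)).
  + by move=> i v c x y; rewrite Mlin linearP.
  + by move=> t v; rewrite Msym.
  + move=> v; apply: le_trans (rnorm_tensor _ _) _.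
    by rewrite -mulrA ler_wpM2l ?rnorm_ge0.
(* The weight is split as [kap^e = th^e * (kap / th)^e]: [th^e] makes the coefficients absolutely
   summable with total at most [C1], and [(kap / th)^e] stays with [b_e], where it is still
   [q]-summable. *)
- pose C1 := (1 - th)^-1; have C10 : 0 < C1 by rewrite invr_gt0 subr_gt0.
  exists (fun n => ofR (2 * 1) *: (ofR (C1 * (kap / th) ^+ (idx n).1) *: B n)).
  apply/p_coverP; split.
    exists (2 `^ q * (C1 `^ q * (1 - 2 * (kap / th) `^ q)^-1)) => N.
    have := weighted_blocks_sum q0 kt0 (ltW C10) thq szJ (idxS R) b1 N.
    move=> /(ler_wpM2l (powR_ge0 2 q)); apply: le_trans; rewrite mulr_sumr.
    apply: ler_sum => n _; have -> : 2 * 1 = 2 :> R by rewrite mulr1.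
    by rewrite rnormZ rnorm_of_real_ge0// powRM ?rnorm_ge0.
  move=> _ [x x1 <-]; have {}x1 : rnorm x <= 1.
    move: x1; rewrite -ball_normE /= sub0r normrN -rnormE => /ltW.
    by rewrite -(of_real1 R k) of_real_le.
  pose a n : K := ofR (th ^+ (idx n).1 / C1) * \prod_(j < d.+2) f (idx n).1 (idx n).2 x.
  apply: (@p_hull_scale _ _ _ _ _ _ a) => //.
    apply: conj_norm_le1 => // N.
    rewrite (eq_bigr (fun n : 'I_N => C1^-1 * (th ^+ (idx n).1 *
      \prod_(j < d.+2) rnorm (f (idx n).1 (idx n).2 x : K)))) => [|n _]; last first.
      rewrite /a rnormM rnorm_of_real_ge0 ?divr_ge0 ?exprn_ge0 ?(ltW th0) ?(ltW C10)//.
      by rewrite rnorm_prod; ring.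
    rewrite -mulr_sumr ler_pdivrMl// mulr1.
    apply: le_trans (g_sum th (fun=> x) N th0 th1) _; rewrite -[leRHS]mulr1 ler_wpM2l ?(ltW C10)//.
    by rewrite prodr_const card_ord exprn_ile1 ?rnorm_ge0.
  rewrite (_ : (fun n => _) = (fun n => T n (fun=> x) *: B n)); first exact: MP.
  apply/funext => n; rewrite scalerA; congr (_ *: _); rewrite /a /T mulrAC -of_realM.
  congr (ofR _ * _); rewrite exprMn exprVn.
  have te0 : th ^+ (idx n).1 != 0 by rewrite expf_neq0// gt_eqF.
  have c0 : C1 != 0 by rewrite gt_eqF.
  by rewrite mulrA mulfVK// mulrCA mulfV ?mulr1.
have c0 : 0 < (1 / 16 : R) ^+ d.+2 by rewrite exprn_gt0 ?divr_gt0.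
apply: (@not_p_compact_blocks R k s p ((1 / 16) ^+ d.+2) kap L) => //.
- by move=> e; case: (bL e).
- by move=> e; case: (bL e) => _ [].
move=> e i ie; have [_ _ /(_ i ie)[x x1 fx]] := fP e.
(* Halving [x] puts it in the open unit ball; hence [1/16 = 1/2 * 1/8], raised to the degree. *)
pose x' := ofR (1 / 2) *: x.
have h0 : 0 <= 1 / 2 :> R by [].
have x'1 : rnorm x' <= 1 / 2.
  by rewrite rnormZ rnorm_of_real_ge0// -[leRHS]mulr1 ler_wpM2l.
have [Ll [_ Lb bsupp Lloc Lb2]] := bL e.
have L0 : L e i 0 = 0 by have := Ll i (-1) 0 0; rewrite scaler0 addr0 scaleN1r addNr.
have LD y z : L e i (y + z) = L e i y + L e i z by have := Ll i 1 y z; rewrite !scale1r.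
have LZ (a : K) y : L e i (a *: y) = a * (L e i y : K).
  by have := Ll i a y 0; rewrite L0 !addr0.
(* [L e i] sees only block [e], because distinct dyadic blocks are disjoint, and its Bessel
   inequality makes it continuous, so it can be applied to the series term by term. *)
have LM : L e i (M (fun=> x')) = ofR (kap ^+ e) * (f e i x' : K) ^+ d.+2.
  have Lsum J : (e < J)%N -> L e i (series (fun n => T n (fun=> x') *: B n) (sz J)) =
      ofR (kap ^+ e) * (f e i x' : K) ^+ d.+2.
    move=> eJ; rewrite seriesE (big_morph (L e i) LD L0).
    under eq_bigr do rewrite LZ.
    rewrite (idxS K (fun e' i' => ofR (kap ^+ e') * (\prod_(j < d.+2) f e' i' x') *
      (L e i (b e' i') : K))).
    rewrite (bigD1 (Ordinal eJ))//= [X in _ + X]big1 ?addr0; last first.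
      move=> e' ee'; rewrite big1// => i' _; rewrite Lloc ?mulr0// => n en.
      have [_ [_ _ + _ _]] := bL e'; apply => //; apply: contra ee' => en'.
      apply/eqP/val_inj => /=; move: en en' => /andP[en1 en2] /andP[en3 en4].
      have l1 : (e' < e.+1)%N by rewrite -(@ltn_exp2l 2)// (leq_ltn_trans en3 en2).
      have l2 : (e < e'.+1)%N by rewrite -(@ltn_exp2l 2)// (leq_ltn_trans en1 en4).
      by apply/eqP; rewrite eqn_leq -(ltnS e') l1 -(ltnS e) l2.
    rewrite (bigD1 (Ordinal ie))//= Lb// eqxx mulr1 prodr_const card_ord big1 ?addr0// => j ji.
    by rewrite Lb// (_ : (i == j) = false) ?mulr0//; apply/negbTE;
      apply: contra ji => /eqP ij; apply/eqP/val_inj.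
  apply/eqP; rewrite -subr_eq0; apply/eqP/rnorm0_eq0/eqP; rewrite eq_le rnorm_ge0 andbT.
  apply/ler_addgt0Pr => r r0; rewrite add0r.
  have r20 : 0 < r / 2 by rewrite divr_gt0.
  have /cvg_seq_rnormP/(_ _ r20)[N HN] := MP (fun=> x').
  pose J := maxn N e.+1.
  have := HN (sz J) (leq_trans (leq_maxl N e.+1) (szJ J)).
  rewrite -(Lsum J (leq_maxr N e.+1)); set S := series _ _ => MS.
  have -> : L e i (M (fun=> x')) - L e i S = L e i (M (fun=> x') - S).
    by rewrite [in RHS]addrC -(scaleN1r S) Ll scaleN1r addrC.
  have : rnorm (L e i (M (fun=> x') - S) : K) <= 2 * rnorm (M (fun=> x') - S).
    rewrite -(ler_pXn2r (n := 2)) ?nnegrE ?mulr_ge0 ?rnorm_ge0//.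
    apply: le_trans (le_trans (Lb2 (M (fun=> x') - S)) _).
      by rewrite (bigD1 (Ordinal ie))//= lerDl sumr_ge0// => *; exact: sqr_ge0.
    by rewrite exprMn ler_wpM2r ?sqr_ge0// expr2 -natrM ler_nat.
  by move=> /le_trans; apply; rewrite mulrC -ler_pdivlMr.
exists (M (fun=> x')).
  exists x' => //; rewrite -ball_normE /= sub0r normrN -rnormE -(of_real1 R k).
  rewrite -subr_gt0 -(of_real_is_additive) of_real_gt0 subr_gt0.
  by apply: le_lt_trans x'1 _; rewrite ltr_pdivrMr// mul1r ltr1n.
rewrite LM rnormM rnormX rnorm_of_real_ge0 ?exprn_ge0 ?(ltW kap0)// mulrC.
rewrite ler_wpM2l ?exprn_ge0 ?(ltW kap0)//.
have fZ : f e i x' = ofR (1 / 2) * (f e i x : K).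
  have f0 : f e i 0 = 0 by have := fl e i (-1) 0 0; rewrite scaler0 addr0 scaleN1r addNr.
  by have := fl e i (ofR (1 / 2)) x 0; rewrite f0 !addr0.
rewrite lerXn2r ?nnegrE ?rnorm_ge0// fZ rnormM rnorm_of_real_ge0//.
by rewrite (_ : 1 / 16 = 1 / 2 * (1 / 8)) ?ler_wpM2l//; field.
Qed.

End polynomial_example.

(** * 2-hulls in l_s for s >= 2 *)

Section hilbert_hulls.
Context {R : realType} {k : scalar_kind} (s : exponent R).
Local Notation K := (scalar_field R k).
Local Notation ofR := (@of_real R k).
Local Notation F := (lbar k s).

Lemma sum_sgn_bilinear (I : finType) (a b : I -> K) :
  \sum_(w : {ffun I -> bool}) (\sum_i ofR (sgn w i) * a i) * (\sum_i ofR (sgn w i) * b i) =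
  ofR #|{ffun I -> bool}|%:R * \sum_i a i * b i.
Proof.
transitivity (\sum_i \sum_j (\sum_(w : {ffun I -> bool}) ofR (sgn w i * sgn w j)) * (a i * b j)).
  rewrite (eq_bigr (fun w : {ffun I -> bool} =>
      \sum_i \sum_j ofR (sgn w i * sgn w j) * (a i * b j))); last first.
    move=> w _; rewrite big_distrlr/=; apply: eq_bigr => i _; apply: eq_bigr => j _.
    by rewrite of_realM; ring.
  rewrite exchange_big/=; apply: eq_bigr => i _; rewrite exchange_big/=.
  by apply: eq_bigr => j _; rewrite mulr_suml.
rewrite mulr_sumr; apply: eq_bigr => i _; rewrite (bigD1 i)//= -raddf_sum/= sum_sgnM eqxx.
rewrite mulr1n big1 ?addr0// => j ji.
by rewrite -raddf_sum/= sum_sgnM eq_sym (negbTE ji) mulr0n of_real0 mul0r.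
Qed.

Lemma sum_sgn_sqr (I : finType) (a : I -> K) :
  \sum_(w : {ffun I -> bool}) rnorm (\sum_i ofR (sgn w i) * a i) ^+ 2 =
  #|{ffun I -> bool}|%:R * \sum_i rnorm (a i) ^+ 2.
Proof. exact: (orth_isometry (@orth_sgn R k I)). Qed.

Lemma fin_enum (J : finType) (j0 : J) : exists e : nat -> J,
  forall (V : nmodType) (g : J -> V), \sum_(i < #|J|) g (e i) = \sum_j g j.
Proof.
exists (nth j0 (enum J)) => V g.
by rewrite -[RHS]big_enum (big_nth j0) -cardE big_mkord.
Qed.

(* Writing <a, x> = E[f h] with f, h the Rademacher sums of a and x, truncation of f and of the
   coordinates of h gives bounded coefficients and an absolutely summable family, up to
   remainders that are small in L_2 and form a system of the same kind. *)
Lemma truncation_step : exists2 t : R, 0 < t &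
  forall (I : finType) (x : I -> F) (W : F),
  (forall n, \sum_i rnorm (x i n) ^+ 2 <= rnorm (W n) ^+ 2) ->
  exists (z : {ffun I -> bool} -> F) (x' : bool * {ffun I -> bool} -> F),
  [/\ \sum_j rnorm (z j) <= t * rnorm W,
      forall n, \sum_i rnorm (x' i n) ^+ 2 <= (rnorm (W n) / 4) ^+ 2 &
      forall a : I -> K, \sum_i rnorm (a i) ^+ 2 <= 1 ->
        exists (b : {ffun I -> bool} -> K) (a' : bool * {ffun I -> bool} -> K),
        [/\ forall j, rnorm (b j) <= t, \sum_i rnorm (a' i) ^+ 2 <= 1 &
            \sum_i a i *: x i = \sum_j b j *: z j + \sum_i a' i *: x' i]].
Proof.
have [C C0 HC] := @trunc_remainder R k.
(* The value 32 makes [C / t^2] at most 1/1024, which leaves room for the rescalings by 8 and 2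
   below. *)
pose t : R := 32 * (C + 1).
have t0 : 0 < t by rewrite mulr_gt0// addr_gt0.
have tC : C / t ^+ 2 <= 1 / 1024.
  rewrite ler_pdivrMr ?exprn_gt0// /t exprMn.
  have := sqr_ge0 C; lra.
exists t => // I x W xW.
set N := #|{ffun I -> bool}|.
have N0 : 0 < N%:R :> R.
  by rewrite ltr0n /N card_ffun card_bool expn_gt0.
pose sn n := Num.sqrt (\sum_i rnorm (x i n) ^+ 2).
have q0 n : 0 <= \sum_i rnorm (x i n) ^+ 2 by apply: sumr_ge0 => *; exact: sqr_ge0.
have sn0 n : 0 <= sn n by exact: sqrtr_ge0.
have sn2 n : sn n ^+ 2 = \sum_i rnorm (x i n) ^+ 2 by rewrite sqr_sqrtr.
have snW n : sn n <= rnorm (W n).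
  by rewrite -(ler_pXn2r (n := 2)) ?nnegrE ?rnorm_ge0// sn2.
pose h n (w : {ffun I -> bool}) := \sum_i ofR (sgn w i) * x i n.
pose h1 n w := trunc (t * sn n) (h n w).
have h1W n w : rnorm (h1 n w) <= t * rnorm (W n).
  apply: le_trans (rnorm_trunc _ _) _; first by rewrite mulr_ge0 ?(ltW t0).
  by rewrite ler_wpM2l ?(ltW t0).
(* This bound depends on the number of vectors, but serves only to see that [h - h1] lies in the
   space. *)
have h2W n w : rnorm (h n w - h1 n w) <= (#|I|%:R + t) * rnorm (W n).
  rewrite mulrDl; apply: le_trans (rnormD _ _) _; rewrite rnormN lerD//.
  apply: le_trans (rnorm_sum _ _ _) _; rewrite mulr_natl -sumr_const; apply: ler_sum => i _.
  rewrite rnormM rnorm_of_real /sgn normrX normrN1 expr1n mul1r.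
  apply: le_trans (snW n); rewrite -(ler_pXn2r (n := 2)) ?nnegrE ?rnorm_ge0// sn2.
  by rewrite (bigD1 i)//= lerDl sumr_ge0// => *; exact: sqr_ge0.
pose kap : R := Num.sqrt N%:R^-1.
have kap0 : 0 <= kap by exact: sqrtr_ge0.
have k8 : 0 <= kap / 8 by rewrite divr_ge0.
have k2 : 0 <= kap / 2 by rewrite divr_ge0.
have k8' : 0 <= kap * 8 by rewrite mulr_ge0.
have k2' : 0 <= kap * 2 by rewrite mulr_ge0.
have kap2 : kap ^+ 2 = N%:R^-1 by rewrite sqr_sqrtr// invr_ge0 ltW.
have Ni0 : 0 <= N%:R^-1 :> R by rewrite invr_ge0 ltW.
have /choice[z zP] : forall w : {ffun I -> bool}, exists z : F,
    (forall n, z n = ofR N%:R^-1 * h1 n w) /\ rnorm z <= N%:R^-1 * t * rnorm W.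
  move=> w; have [||z ? ?] := @lbar_dominated R k s (fun n => ofR N%:R^-1 * h1 n w) (N%:R^-1 * t) W.
  - by rewrite mulr_ge0 ?(ltW t0).
  - by move=> n; rewrite rnormM rnorm_of_real_ge0// -[leRHS]mulrA ler_wpM2l.
  by exists z.
(* In [f h = f1 h1 + (f - f1) h1 + f (h - h1)] the last two products are regrouped as [8 (f - f1)]
   times [h1 / 8] and [f / 2] times [2 (h - h1)], each factor carrying [kap], the root of the
   probability [1/N]. Squares then total [64/1024 + 1/4 <= 1] for the coefficients and
   [1/64 + 4/1024 <= 1/16] for the vectors, relative to [W]. *)
have /choice[x' x'E] : forall i : bool * {ffun I -> bool}, exists y : F, forall n, y n =
    if i.1 then ofR (kap / 8) * h1 n i.2 else ofR (kap * 2) * (h n i.2 - h1 n i.2).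
  move=> [[] w] /=.
    have [||y yE _] := @lbar_dominated R k s (fun n => ofR (kap / 8) * h1 n w) (kap / 8 * t) W.
    - by rewrite (mulr_ge0 k8) ?(ltW t0).
    - by move=> n; rewrite rnormM rnorm_of_real_ge0// -[leRHS]mulrA ler_wpM2l.
    by exists y.
  have [||y yE _] := @lbar_dominated R k s (fun n => ofR (kap * 2) * (h n w - h1 n w))
    (kap * 2 * (#|I|%:R + t)) W.
  - by rewrite (mulr_ge0 k2') ?addr_ge0 ?(ltW t0).
  - by move=> n; rewrite rnormM rnorm_of_real_ge0// -[leRHS]mulrA ler_wpM2l.
  by exists y.
have pairsum (V : nmodType) (g : bool * {ffun I -> bool} -> V) :
    \sum_i g i = \sum_w g (true, w) + \sum_w g (false, w).
  transitivity (\sum_(a : bool) \sum_(w : {ffun I -> bool}) g (a, w)); last by rewrite big_bool.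
  by rewrite pair_bigA/=; apply: eq_bigr => -[].
exists z, x'; split.
- apply: le_trans (ler_sum _ (fun w _ => proj2 (zP w))) _.
  rewrite sumr_const -[leLHS]mulr_natl !mulrA -/N mulfV ?mul1r// gt_eqF//.
- move=> n; rewrite pairsum.
  rewrite (eq_bigr (fun w => N%:R^-1 / 64 * rnorm (h1 n w) ^+ 2)) => [|w _]; last first.
    rewrite x'E /= rnormM rnorm_of_real_ge0// exprMn -kap2; congr (_ * _).
    by field.
  rewrite [X in _ + X](eq_bigr (fun w => N%:R^-1 * 4 * rnorm (h n w - h1 n w) ^+ 2)) => [|w _];
      last first.
    rewrite x'E /= rnormM rnorm_of_real_ge0// exprMn -kap2; congr (_ * _).
    by ring.
  rewrite -!mulr_sumr.
  have e1 : \sum_w rnorm (h1 n w) ^+ 2 <= N%:R * rnorm (W n) ^+ 2.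
    apply: (@le_trans _ _ (\sum_w rnorm (h n w) ^+ 2)).
      by apply: ler_sum => w _; rewrite lerXn2r ?nnegrE ?rnorm_ge0// rnorm_trunc_le.
    by rewrite sum_sgn_sqr ler_wpM2l ?(ltW N0).
  have e2 : \sum_w rnorm (h n w - h1 n w) ^+ 2 <= N%:R * (1 / 1024 * rnorm (W n) ^+ 2).
    apply: le_trans (HC I (fun i => x i n) (sn n) t t0 (sn0 n) (sn2 n)) _.
    rewrite ler_wpM2l ?(ltW N0)//; apply: ler_pM => //; rewrite ?sqr_ge0 ?divr_ge0 ?(ltW C0) ?sqr_ge0//.
    by rewrite sn2.
  have := lerD (ler_wpM2l (_ : 0 <= N%:R^-1 / 64) e1) (ler_wpM2l (_ : 0 <= N%:R^-1 * 4) e2).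
  rewrite !mulr_ge0// => /(_ isT isT)/le_trans; apply.
  rewrite [leLHS](_ : _ = (1 / 64 + 4 / 1024) * rnorm (W n) ^+ 2); last by field; rewrite gt_eqF.
  by have := sqr_ge0 (rnorm (W n)); rewrite exprMn; lra.
move=> a a1; pose f (w : {ffun I -> bool}) := \sum_i ofR (sgn w i) * a i.
pose sa := Num.sqrt (\sum_i rnorm (a i) ^+ 2).
have qa0 : 0 <= \sum_i rnorm (a i) ^+ 2 by apply: sumr_ge0 => *; exact: sqr_ge0.
have sa0 : 0 <= sa by exact: sqrtr_ge0.
have sa2 : sa ^+ 2 = \sum_i rnorm (a i) ^+ 2 by rewrite sqr_sqrtr.
have sa1 : sa <= 1 by rewrite -(ler_pXn2r (n := 2)) ?nnegrE// sa2 expr1n.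
pose f1 w := trunc (t * sa) (f w).
exists f1, (fun i => if i.1 then ofR (kap * 8) * (f i.2 - f1 i.2) else ofR (kap / 2) * f i.2).
split.
- move=> w; apply: le_trans (rnorm_trunc _ _) _; first by rewrite mulr_ge0 ?(ltW t0).
  by rewrite -[leRHS]mulr1 ler_wpM2l ?(ltW t0).
- rewrite pairsum /=.
  rewrite (eq_bigr (fun w => N%:R^-1 * 64 * rnorm (f w - f1 w) ^+ 2)) => [|w _]; last first.
    rewrite rnormM rnorm_of_real_ge0// exprMn -kap2; congr (_ * _).
    by ring.
  rewrite [X in _ + X](eq_bigr (fun w => N%:R^-1 / 4 * rnorm (f w) ^+ 2)) => [|w _]; last first.
    rewrite rnormM rnorm_of_real_ge0// exprMn -kap2; congr (_ * _).
    by field.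
  rewrite -!mulr_sumr.
  have e1 : \sum_w rnorm (f w) ^+ 2 <= N%:R * 1 by rewrite sum_sgn_sqr ler_wpM2l ?(ltW N0).
  have e2 : \sum_w rnorm (f w - f1 w) ^+ 2 <= N%:R * (1 / 1024 * 1).
    apply: le_trans (HC I a sa t t0 sa0 sa2) _.
    rewrite ler_wpM2l ?(ltW N0)//; apply: ler_pM => //; rewrite ?sqr_ge0 ?divr_ge0 ?(ltW C0) ?sqr_ge0//.
    by rewrite sa2.
  have := lerD (ler_wpM2l (_ : 0 <= N%:R^-1 * 64) e2) (ler_wpM2l (_ : 0 <= N%:R^-1 / 4) e1).
  rewrite !mulr_ge0// => /(_ isT isT)/le_trans; apply.
  by rewrite [leLHS](_ : _ = 64 / 1024 + 1 / 4); [lra|field; rewrite gt_eqF].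
apply: lbarP => n; rewrite lbarDE !lbar_sumE pairsum.
transitivity (\sum_i a i * x i n); first by apply: eq_bigr => i _; rewrite lbarZE.
have NK : ofR N%:R^-1 * ofR N%:R = 1 by rewrite -of_realM mulVf ?of_real1// gt_eqF.
have kk : ofR kap * ofR kap = ofR N%:R^-1 by rewrite -of_realM -expr2 kap2.
have -> : \sum_i a i * x i n = ofR N%:R^-1 * \sum_w f w * h n w.
  by rewrite sum_sgn_bilinear mulrA NK mul1r.
rewrite mulr_sumr -!big_split; apply: eq_bigr => w _; cbv beta.
rewrite !lbarZE (proj1 (zP w)) !x'E /= !of_realM -kk.
have e8 : ofR 8 * ofR 8^-1 = 1 by rewrite -of_realM mulfV ?of_real1.
have e2 : ofR 2 * ofR 2^-1 = 1 by rewrite -of_realM mulfV ?of_real1.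
transitivity (ofR kap * ofR kap * (f1 w * h1 n w) +
  (ofR kap * ofR kap * (ofR 8 * ofR 8^-1) * ((f w - f1 w) * h1 n w) +
   ofR kap * ofR kap * (ofR 2 * ofR 2^-1) * (f w * (h n w - h1 n w)))).
  by rewrite e8 e2; ring.
by ring.
Qed.

End hilbert_hulls.

Section type_two_hulls.
Context {R : realType} {k : scalar_kind} (s : exponent R).
Local Notation K := (scalar_field R k).
Local Notation ofR := (@of_real R k).
Local Notation F := (lbar k s).

Definition square_dominated n (x : nat -> F) (W : F) : Prop :=
  forall m, \sum_(i < n) rnorm (x i m) ^+ 2 <= rnorm (W m) ^+ 2.

Definition unit_coefficients n (a : nat -> K) : Prop := \sum_(i < n) rnorm (a i) ^+ 2 <= 1.

Lemma rnorm_lbar_mono (u w : F) : (forall n, rnorm (u n) <= rnorm (w n)) -> rnorm u <= rnorm w.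
Proof.
move=> uw; have [n|y yu] := @lbar_dominated R k s u 1 w ler01; first by rewrite mul1r.
by rewrite mul1r (_ : y = u)//; exact: lbarP.
Qed.

Lemma square_dominated_norm n x W a : square_dominated n x W -> unit_coefficients n a ->
  rnorm (\sum_(i < n) a i *: x i) <= rnorm W.
Proof.
move=> xW a1; apply: rnorm_lbar_mono => m; rewrite lbar_sumE.
apply: le_trans (rnorm_sum _ _ _) _.
under eq_bigr do rewrite lbarZE rnormM.
rewrite -[leRHS]mul1r; apply: cauchy_schwarz; rewrite ?rnorm_ge0 ?expr1n//.
  by move=> i; exact: rnorm_ge0.
by move=> i; exact: rnorm_ge0.
Qed.

(** Families indexed by finite types change their index type at each step; over initial segments of
    [nat] the step becomes a function on one type and can be iterated. Its output is arbitrary where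
    domination fails, so that choice applies to all states. *)
Lemma truncation_step_nat : exists2 t : R, 0 < t &
  forall st : nat * ((nat -> F) * F), exists out : (nat * (nat -> F)) * (nat * (nat -> F)),
  square_dominated st.1 st.2.1 st.2.2 ->
  [/\ (0 < out.1.1)%N,
      \sum_(j < out.1.1) rnorm (out.1.2 j) <= t * rnorm st.2.2,
      forall m, \sum_(i < out.2.1) rnorm (out.2.2 i m) ^+ 2 <= (rnorm (st.2.2 m) / 4) ^+ 2 &
      forall a : nat -> K, unit_coefficients st.1 a ->
        exists ba : (nat -> K) * (nat -> K),
        [/\ forall j, rnorm (ba.1 j) <= t, unit_coefficients out.2.1 ba.2 &
            \sum_(i < st.1) a i *: st.2.1 i =
            \sum_(j < out.1.1) ba.1 j *: out.1.2 j + \sum_(i < out.2.1) ba.2 i *: out.2.2 i]].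
Proof.
have [t t0 Ht] := @truncation_step R k s; exists t => // -[n [x W]] /=.
have [xW|nxW] := pselect (square_dominated n x W); last first.
  by exists ((0%N, x), (0%N, x)).
have [z [x' [zt x'W H]]] := Ht 'I_n (fun i => x i) W xW.
have [e1 e1P] := fin_enum ([ffun=> true] : {ffun 'I_n -> bool}).
have [e2 e2P] := fin_enum ((true, [ffun=> true]) : bool * {ffun 'I_n -> bool}).
exists ((#|{ffun 'I_n -> bool}|, fun j => z (e1 j)),
  (#|{: bool * {ffun 'I_n -> bool}}|, fun i => x' (e2 i))) => _ /=; split.
- by rewrite card_ffun card_bool expn_gt0.
- by rewrite (e1P R (fun j => rnorm (z j))).
- by move=> m; rewrite (e2P R (fun i => rnorm (x' i m) ^+ 2)).
move=> a a1; have [b [a' [bt a'1 ab]]] := H (fun i => a i) a1.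
exists (fun j => b (e1 j), fun i => a' (e2 i)) => /=; split => //.
  by rewrite /unit_coefficients (e2P R (fun i => rnorm (a' i) ^+ 2)).
by rewrite (e1P F (fun j => b j *: z j)) (e2P F (fun i => a' i *: x' i)).
Qed.

Lemma sum_offset (V : zmodType) (bs : nat -> nat) (f : nat -> V) J :
  \sum_(i < \sum_(j < J.+1) bs j) f i =
  \sum_(i < \sum_(j < J) bs j) f i + \sum_(i < bs J) f (\sum_(j < J) bs j + i)%N.
Proof. by rewrite big_ord_recr/= big_split_ord. Qed.

(** Summing the recursion, the total [S] of the [w j] satisfies [S <= w 0 + S / 2 + 2 * E]. *)
Lemma half_sum_bound (w e : nat -> R) (E : R) : (forall j, 0 <= w j) ->
  (forall j, w j.+1 <= w j / 2 + 2 * e j.+1) -> (forall j, 0 <= e j) ->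
  (forall J, \sum_(j < J) e j <= E) -> forall J, \sum_(j < J) w j <= 2 * w 0%N + 4 * E.
Proof.
move=> w0 we e0 eE J; apply: (@le_trans _ _ (\sum_(j < J.+1) w j)).
  by rewrite big_ord_recr/= lerDl.
have h : \sum_(j < J.+1) w j <= w 0%N + (\sum_(j < J.+1) w j) / 2 + 2 * E.
  rewrite {1}big_ord_recl -addrA lerD2l.
  apply: (@le_trans _ _ (\sum_(j < J) (w j / 2 + 2 * e j.+1))).
    by apply: ler_sum => j _; exact: we.
  rewrite big_split/= -mulr_suml -mulr_sumr; apply: lerD.
    by rewrite ler_wpM2r// big_ord_recr/= lerDl.
  rewrite ler_wpM2l//; apply: le_trans (eE J.+1).
  by rewrite big_ord_recl lerDr.
by lra.
Qed.

(* W_j is the pointwise square function of the j-th block; as s >= 2, its norm is at most the l_2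
   sum of the norms in the block, and the blocks are cut so that these decay geometrically. *)
Lemma block_square_functions (x : nat -> F) (M0 : R) : (2%:E <= s)%E ->
  (forall M, \sum_(m < M) rnorm (x m) ^+ 2 <= M0) ->
  exists (bs : nat -> nat) (W : nat -> F) (E : R),
  [/\ forall j, (0 < bs j)%N,
      forall j, square_dominated (bs j) (fun i => x (\sum_(l < j) bs l + i)%N) (W j),
      forall j n, W j n = ofR (rnorm (W j n)) &
      forall J, \sum_(j < J) rnorm (W j) <= E].
Proof.
move=> s2 xM; have x0 m : 0 <= rnorm (x m) ^+ 2 by exact: sqr_ge0.
have M00 : 0 <= M0 by have := xM 0%N; rewrite big_ord0.
have h40 (j : nat) : 0 < (1 / 4 : R) ^+ j by rewrite exprn_gt0.
have /choice[Nf NfP] := fun j => bounded_sum_tail x0 xM (h40 j).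
pose bs j := (Nf j.+1).+1; pose m j := (\sum_(l < j) bs l)%N.
have /choice[W WP] : forall j, exists W : F,
    (forall n, W n = ofR (Num.sqrt (\sum_(i < bs j) rnorm (x (m j + i)%N n) ^+ 2))) /\
    rnorm W ^+ 2 <= \sum_(i < bs j) rnorm (x (m j + i)%N) ^+ 2.
  by move=> j; have [W] := lbar_square_function (fun i : 'I_(bs j) => x (m j + i)%N) s2; exists W.
pose D := Num.sqrt M0 + 1.
have D0 : 0 <= D by rewrite addr_ge0 ?sqrtr_ge0.
have WD j : rnorm (W j) <= D * (1 / 2) ^+ j.
  have [_ Wj] := WP j; rewrite -(ler_pXn2r (n := 2)) ?nnegrE ?rnorm_ge0 ?mulr_ge0 ?exprn_ge0//.
  apply: le_trans Wj _.
  have := sum_offset bs (fun i => rnorm (x i) ^+ 2) j; rewrite -/(m j) -/(m j.+1) => mE.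
  case: j mE => [|j] mE.
    rewrite expr0 mulr1; apply: (@le_trans _ _ M0).
      by apply: le_trans (xM (m 1%N)); rewrite mE lerDr sumr_ge0.
    rewrite /D sqrrD sqr_sqrtr// expr1n mulr1 -addrA lerDl.
    by rewrite addr_ge0// mulrn_wge0// sqrtr_ge0.
  have Nm : (Nf j.+1 <= m j.+1)%N.
    by rewrite /m big_ord_recr/= /bs (leq_trans (leqnSn _))// leq_addl.
  have m12 : (m j.+1 <= m j.+2)%N by rewrite /m [leqRHS]big_ord_recr/= leq_addr.
  have := NfP j.+1 _ (leq_trans Nm m12); rewrite mE.
  have := ler_sum_ord_le x0 Nm => h1 h2.
  apply: (@le_trans _ _ ((1 / 4) ^+ j.+1)).
    by rewrite -(lerD2l (\sum_(i < m j.+1) rnorm (x i) ^+ 2)) (le_trans h2)// lerD2r.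
  rewrite [leRHS]exprMn -exprM mulnC exprM (_ : (1 / 2 : R) ^+ 2 = 1 / 4); last by field.
  rewrite -[leLHS]mul1r ler_wpM2r ?exprn_ge0//.
  by rewrite exprn_ege1// /D lerDr sqrtr_ge0.
exists bs, W, (D * (1 - 1 / 2)^-1); split => //.
- move=> j n; have [WE _] := WP j; rewrite WE rnorm_of_real_ge0 ?sqrtr_ge0// sqr_sqrtr//.
  by apply: sumr_ge0 => *; exact: sqr_ge0.
- by move=> j n; have [WE _] := WP j; rewrite WE rnorm_of_real_ge0// sqrtr_ge0.
move=> J; apply: (@le_trans _ _ (\sum_(j < J) D * (1 / 2) ^+ j)).
  by apply: ler_sum => j _; exact: WD.
by rewrite -mulr_sumr ler_wpM2l// geometric_sum_le//; lra.
Qed.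

(* The remainder left by truncating a block is appended, rescaled by 2, to the next block; its
   square function is halved at each step. *)
Lemma p_hull2_p_compact1 (x : nat -> F) (M0 : R) : (2%:E <= s)%E ->
  (forall M, \sum_(m < M) rnorm (x m) ^+ 2 <= M0) -> p_compact 1 (p_hull 2 x).
Proof.
move=> s2 xM.
have [bs [Wb [E [bs0 xWb Wbreal WbE]]]] := block_square_functions s2 xM.
have [t t0 /choice[step stepP]] := truncation_step_nat.
pose m j := (\sum_(l < j) bs l)%N.
(* A state is a length, a family and a bound for its square function. Vectors are doubled and
   coefficients halved: two halved unit vectors of [l_2] together have norm at most 1, and [(2 *
   W/4)^2 + (2 * Wb)^2 <= (W/2 + 2 * Wb)^2]. *)
pose next j (st : nat * ((nat -> F) * F)) : nat * ((nat -> F) * F) :=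
  (((step st).2.1 + bs j.+1)%N,
   (fun i => if (i < (step st).2.1)%N then ofR 2 *: (step st).2.2 i
             else ofR 2 *: x (m j.+1 + (i - (step st).2.1))%N,
    ofR (1 / 2) *: st.2.2 + ofR 2 *: Wb j.+1)).
pose st := fix st j := if j is j'.+1 then next j' (st j') else (bs 0%N, (x, Wb 0%N)).
have two0 : 0 <= 2 :> R by [].
have half0 : 0 <= 1 / 2 :> R by [].
have splitsum (V : nmodType) n d (f : nat -> V) :
    \sum_(i < n + d) f i = \sum_(i < n) f i + \sum_(i < d) f (n + i)%N.
  by rewrite big_split_ord.
have nextW j n : (st j).2.2 n = ofR (rnorm ((st j).2.2 n)) ->
    (st j.+1).2.2 n = ofR (rnorm ((st j).2.2 n) / 2 + 2 * rnorm (Wb j.+1 n)).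
  move=> Wn; rewrite (_ : (st j.+1).2.2 = ofR (1 / 2) *: (st j).2.2 + ofR 2 *: Wb j.+1)//.
  rewrite lbarDE !lbarZE Wn Wbreal !rnorm_of_real_ge0 ?rnorm_ge0// -!of_realM -of_realD.
  by rewrite mul1r [X in ofR (X + _) = _]mulrC.
(* The bounds are non-negative sequences, so the modulus of a sum of bounds is the sum of the
   moduli. *)
have streal j n : (st j).2.2 n = ofR (rnorm ((st j).2.2 n)).
  elim: j => [|j IH]; first exact: Wbreal.
  by rewrite (nextW _ _ IH) rnorm_of_real_ge0// addr_ge0 ?mulr_ge0 ?rnorm_ge0.
have stdom j : square_dominated (st j).1 (st j).2.1 (st j).2.2.
  elim: j => [|j IH].
    have := xWb 0%N; rewrite big_ord0 => H n; have := H n.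
    by under eq_bigr do rewrite add0n.
  have [_ _ x'W _] := stepP _ IH.
  move=> n; rewrite (nextW _ _ (streal j n)) rnorm_of_real_ge0; last first.
    by rewrite addr_ge0 ?mulr_ge0 ?rnorm_ge0.
  rewrite /= (splitsum R _ _ (fun i => rnorm ((if (i < (step (st j)).2.1)%N then
    ofR 2 *: (step (st j)).2.2 i else ofR 2 *: x (m j.+1 + (i - (step (st j)).2.1))%N) n) ^+ 2)).
  rewrite (eq_bigr (fun i : 'I_ _ => 4 * rnorm ((step (st j)).2.2 i n) ^+ 2)) => [|i _]; last first.
    rewrite ltn_ord; cbv iota; rewrite lbarZE rnormM rnorm_of_real_ge0// exprMn; congr (_ * _); ring.
  rewrite [X in _ + X](eq_bigr (fun i : 'I_ _ => 4 * rnorm (x (m j.+1 + i)%N n) ^+ 2)) => [|i _];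
      last first.
    rewrite ltnNge leq_addr addKn; cbv iota beta delta [negb]; rewrite lbarZE rnormM.
    rewrite rnorm_of_real_ge0// exprMn; congr (_ * _); ring.
  rewrite -!mulr_sumr; have h1 := x'W n; have h2 := xWb j.+1 n.
  have h3 : 0 <= rnorm ((st j).2.2 n) * rnorm (Wb j.+1 n) by rewrite mulr_ge0 ?rnorm_ge0.
  apply: le_trans (lerD (ler_wpM2l (ler0n _ 4) h1) (ler_wpM2l (ler0n _ 4) h2)) _.
  rewrite -subr_ge0; apply: le_trans (mulr_ge0 two0 h3) _.
  by rewrite le_eqVlt; apply/orP; left; apply/eqP; field.
have wbound J : \sum_(j < J) rnorm ((st j).2.2) <= 2 * rnorm (Wb 0%N) + 4 * E.
  apply: (@half_sum_bound (fun j => rnorm ((st j).2.2)) (fun j => rnorm (Wb j)) E) => //.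
  - by move=> j; exact: rnorm_ge0.
  - move=> j /=; apply: le_trans (rnormD _ _) _; rewrite !rnormZ !rnorm_of_real_ge0//.
    by rewrite mul1r mulrC.
  - by move=> j; exact: rnorm_ge0.
pose sz j := (step (st j)).1.1; pose z j := (step (st j)).1.2.
have sz0 j : (0 < sz j)%N by case: (stepP _ (stdom j)).
have [idx [sJ [sJJ _ _ idxS]]] := block_enum sz0.
pose Z n := z (idx n).1 (idx n).2.
have ZE N : \sum_(n < N) rnorm (Z n) <= t * (2 * rnorm (Wb 0%N) + 4 * E).
  apply: (@le_trans _ _ (\sum_(n < sJ N) rnorm (Z n))).
    by apply: (@ler_sum_ord_le _ (fun n => rnorm (Z n))) => // n; exact: rnorm_ge0.
  rewrite (idxS R (fun j i => rnorm (z j i))).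
  apply: le_trans (ler_wpM2l (ltW t0) (wbound N)); rewrite mulr_sumr.
  by apply: ler_sum => j _; case: (stepP _ (stdom j)).
exists (fun n => ofR (2 * t) *: Z n); apply/p_coverP; split.
  exists (2 * t * (t * (2 * rnorm (Wb 0%N) + 4 * E))) => N.
  have tt0 : 0 <= 2 * t by rewrite mulr_ge0// ltW.
  apply: le_trans (ler_wpM2l tt0 (ZE N)); rewrite mulr_sumr; apply: ler_sum => n _.
  by rewrite powRr1 ?rnorm_ge0// rnormZ rnorm_of_real_ge0.
move=> v [a a1 av].
have a2 M : \sum_(i < M) rnorm (a i) ^+ 2 <= 1.
  move/ltW : a1; rewrite conj_gt1 ?ltr1n// (_ : 2 / (2 - 1) = 2); last by field.
  move=> /(seq_norm_leP _ (_ : 1 <= 2) ler01)-/(_ _ M); rewrite powR1 ler1n => /(_ isT).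
  by under eq_bigr do rewrite powR_mulrn ?rnorm_ge0//.
have ablk j : \sum_(i < bs j) rnorm (a (m j + i)%N) ^+ 2 <= 1.
  apply: le_trans (a2 (m j.+1)); rewrite /m (sum_offset bs (fun i => rnorm (a i) ^+ 2)) lerDr.
  by rewrite sumr_ge0// => *; exact: sqr_ge0.
have /choice[cf cfP] : forall jg : nat * (nat -> K), exists ba : (nat -> K) * (nat -> K),
    unit_coefficients (st jg.1).1 jg.2 ->
    [/\ forall j, rnorm (ba.1 j) <= t, unit_coefficients (step (st jg.1)).2.1 ba.2 &
        \sum_(i < (st jg.1).1) jg.2 i *: (st jg.1).2.1 i =
        \sum_(i < sz jg.1) ba.1 i *: z jg.1 i +
        \sum_(i < (step (st jg.1)).2.1) ba.2 i *: (step (st jg.1)).2.2 i].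
  move=> [j g] /=; have [_ _ _ H] := stepP _ (stdom j).
  have [/H[ba baP]|ng] := pselect (unit_coefficients (st j).1 g); first by exists ba.
  by exists (g, g).
pose gam := fix gam j : nat -> K := if j is j'.+1 then
    (fun i => if (i < (step (st j')).2.1)%N then ofR (1 / 2) * (cf (j', gam j')).2 i
              else ofR (1 / 2) * a (m j'.+1 + (i - (step (st j')).2.1))%N) else a.
have gam1 j : unit_coefficients (st j).1 (gam j).
  elim: j => [|j IH]; first exact: a2.
  have [_ a'1 _] := cfP (j, gam j) IH.
  rewrite /unit_coefficients /= (splitsum R _ _ (fun i => rnorm (if (i < (step (st j)).2.1)%N then
    ofR (1 / 2) * (cf (j, gam j)).2 i else ofR (1 / 2) * a (m j.+1 + (i - (step (st j)).2.1))%N) ^+ 2)).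
  apply: (@le_trans _ _ (1 / 4 * \sum_(i < (step (st j)).2.1) rnorm ((cf (j, gam j)).2 i) ^+ 2 +
    1 / 4 * \sum_(i < bs j.+1) rnorm (a (m j.+1 + i)%N) ^+ 2)).
    rewrite !mulr_sumr; apply: lerD; apply: ler_sum => i _.
      rewrite ltn_ord rnormM rnorm_of_real_ge0// exprMn ler_wpM2r ?sqr_ge0//.
      by rewrite le_eqVlt; apply/orP; left; apply/eqP; field.
    rewrite ltnNge leq_addr/= addKn rnormM rnorm_of_real_ge0// exprMn ler_wpM2r ?sqr_ge0//.
    by rewrite le_eqVlt; apply/orP; left; apply/eqP; field.
  by have h1 := a'1; have h2 := ablk j.+1; rewrite /unit_coefficients /= in h1; lra.
pose bt j i := (cf (j, gam j)).1 i.
have btt j i : rnorm (bt j i) <= t by have [+ _ _] := cfP (j, gam j) (gam1 j); exact.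
(* The blocks up to [j] equal what has been released into the families [z] plus the current family,
   whose norm is at most that of its bound; these norms are summable and tend to 0. *)
have decomp j : \sum_(i < m j.+1) a i *: x i =
    \sum_(l < j) \sum_(i < sz l) bt l i *: z l i + \sum_(i < (st j).1) gam j i *: (st j).2.1 i.
  elim: j => [|j IH].
    by rewrite big_ord0 add0r /m big_ord_recl big_ord0 addn0.
  rewrite /m (sum_offset bs (fun i => a i *: x i)) -/(m j.+1) IH.
  have [_ _ ->] := cfP (j, gam j) (gam1 j).
  rewrite [in RHS]big_ord_recr/= -!addrA; congr (_ + (_ + _)).
  rewrite (splitsum F _ _ (fun i => (if (i < (step (st j)).2.1)%N then
      ofR (1 / 2) * (cf (j, gam j)).2 i else ofR (1 / 2) * a (m j.+1 + (i - (step (st j)).2.1))%N) *: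
     (if (i < (step (st j)).2.1)%N then ofR 2 *: (step (st j)).2.2 i
      else ofR 2 *: x (m j.+1 + (i - (step (st j)).2.1))%N))).
  have h12 : ofR (1 / 2) * ofR 2 = 1 by rewrite -of_realM divfK ?of_real1.
  congr (_ + _); apply: eq_bigr => i _.
    by rewrite ltn_ord scalerA mulrAC h12 mul1r.
  by rewrite ltnNge leq_addr/= addKn scalerA mulrAC h12 mul1r.
pose BT n := bt (idx n).1 (idx n).2.
have [l lP] : exists l : F, series (fun n => BT n *: Z n) @ \oo --> l.
  apply: (@abs_series_cvg _ _ F _ (t * (t * (2 * rnorm (Wb 0%N) + 4 * E)))) => N.
  apply: le_trans (ler_wpM2l (ltW t0) (ZE N)); rewrite mulr_sumr; apply: ler_sum => n _.
  by rewrite rnormZ ler_wpM2r ?rnorm_ge0//; exact: btt.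
apply: (@p_hull_scale _ _ _ _ t _ BT) => //.
  by rewrite conj1; apply/seq_norm_ooP => n; exact: btt.
suff -> : v = l by [].
apply/eqP; rewrite -subr_eq0; apply/eqP/rnorm0_eq0/eqP; rewrite eq_le rnorm_ge0 andbT.
apply/ler_addgt0Pr => e e0; rewrite add0r.
have e30 : 0 < e / 3 by rewrite divr_gt0.
have [N1 HN1] := (cvg_seq_rnormP _ _).1 av _ e30.
have [N2 HN2] := (cvg_seq_rnormP _ _).1 lP _ e30.
have [N3 HN3] := bounded_sum_tail (fun j => rnorm_ge0 ((st j).2.2)) wbound e30.
pose J := maxn N1 (maxn N2 N3).
have mJ : (N1 <= m J.+1)%N.
  apply: (leq_trans (leq_maxl N1 (maxn N2 N3))); rewrite -/J.
  have : (J.+1 <= m J.+1)%N.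
    elim: (J.+1) => // j IH; rewrite /m big_ord_recr/= -/(m j) -[j.+1]addn1.
    by rewrite leq_add// bs0.
  exact: leq_trans.
have h1 := HN1 _ mJ.
have h2 : rnorm (l - series (fun n => BT n *: Z n) (sJ J)) <= e / 3.
  by apply: HN2; apply: leq_trans (sJJ J); rewrite /J (leq_trans (leq_maxl N2 N3))// leq_maxr.
have h3 : rnorm ((st J).2.2) <= e / 3.
  have N3J : (N3 <= J)%N by rewrite /J (leq_trans (leq_maxr N2 N3))// leq_maxr.
  have := HN3 J.+1 (leqW N3J); rewrite big_ord_recr/=.
  have := ler_sum_ord_le (fun j => rnorm_ge0 ((st j).2.2)) N3J => h4 h5.
  by rewrite -(lerD2l (\sum_(i < J) rnorm (st i).2.2)) (le_trans h5)// lerD2r.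
have h4 : rnorm (\sum_(i < (st J).1) gam J i *: (st J).2.1 i) <= e / 3.
  by apply: le_trans h3; exact: square_dominated_norm (stdom J) (gam1 J).
rewrite !seriesE in h1 h2; rewrite decomp in h1.
rewrite (idxS F (fun j i => bt j i *: z j i)) in h2.
set S := \sum_(l < J) _ in h1 h2; set T := \sum_(i < _) _ in h1 h4.
have -> : v - l = (v - (S + T)) - (l - S) + T.
  by rewrite opprB [RHS]addrAC opprD [v + (_ - _)]addrA subrK addrA subrK.
apply: le_trans (rnormD _ _) _; have := rnormD (v - (S + T)) (- (l - S)).
rewrite rnormN => h5.
have -> : e = e / 3 + e / 3 + e / 3 by field.
apply: lerD => //; apply: le_trans h5 _; exact: lerD.
Qed.

End type_two_hulls.

(** * Operators on l_r for r >= 2 *)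

Section square_summing_forms.
Context {R : realType} {k : scalar_kind} (r : exponent R).
Local Notation K := (scalar_field R k).
Local Notation ofR := (@of_real R k).
Local Notation X := (lbar k r).
Hypothesis r2 : (2%:E <= r)%E.

Let square_bounded (I : finType) (b : I -> X) : Prop := exists2 w : X, rnorm w <= 1 &
  forall n, \sum_i rnorm (b i n) ^+ 2 <= rnorm (w n) ^+ 2.

(* [b] splits into an average of truncated Rademacher sums, controlled by [A], and a remainder
   whose square function is halved, controlled by [S]. *)
Lemma halving_step : exists2 t : R, 0 < t &
  forall (I : finType) (G : I -> {linear X -> K^o}) (A S : R),
  (forall u : {ffun I -> bool} -> X, (forall w, rnorm (u w) <= 1) ->
    \sum_w rnorm (\sum_i ofR (sgn w i) * G i (u w) : K) <= #|{ffun I -> bool}|%:R * A) ->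
  (forall b, square_bounded b -> rnorm (\sum_i G i (b i) : K) <= S) ->
  forall b, square_bounded b -> rnorm (\sum_i G i (b i) : K) <= t * A + S / 2.
Proof.
have [C C0 HC] := @trunc_remainder R k.
(* [C / t^2 <= 1/4] suffices here: the remainder, once doubled, again has a square function below
   [W]. *)
pose t : R := 2 * (C + 1).
have t0 : 0 < t by rewrite mulr_gt0// addr_gt0.
have tC : C / t ^+ 2 <= 1 / 4.
  rewrite ler_pdivrMr ?exprn_gt0// /t exprMn.
  have := sqr_ge0 C; lra.
exists t => // I G A S GA GS b [W W1 bW].
set N := #|{ffun I -> bool}|.
have N0 : 0 < N%:R :> R by rewrite ltr0n /N card_ffun card_bool expn_gt0.
have Ni0 : 0 <= N%:R^-1 :> R by rewrite invr_ge0 ltW.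
pose sn n := Num.sqrt (\sum_i rnorm (b i n) ^+ 2).
have q0 n : 0 <= \sum_i rnorm (b i n) ^+ 2 by apply: sumr_ge0 => *; exact: sqr_ge0.
have sn0 n : 0 <= sn n by exact: sqrtr_ge0.
have sn2 n : sn n ^+ 2 = \sum_i rnorm (b i n) ^+ 2 by rewrite sqr_sqrtr.
have snW n : sn n <= rnorm (W n).
  by rewrite -(ler_pXn2r (n := 2)) ?nnegrE ?rnorm_ge0// sn2.
pose h n (w : {ffun I -> bool}) := \sum_i ofR (sgn w i) * b i n.
have /choice[g /all_and2 [gE gt]] : forall w, exists g : X,
    (forall n, g n = trunc (t * sn n) (h n w)) /\ rnorm g <= t.
  move=> w; have [n|g gE gW] := @lbar_dominated R k r (fun n => trunc (t * sn n) (h n w)) t W (ltW t0).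
    apply: le_trans (rnorm_trunc _ _) _; first by rewrite mulr_ge0 ?(ltW t0).
    by rewrite ler_wpM2l ?(ltW t0).
  exists g; split => //; apply: le_trans gW _.
  by rewrite -[leRHS]mulr1 ler_wpM2l ?(ltW t0).
(* [b_i] is the mean of the [i]-th sign times [h]; subtracting the same mean of [g] leaves that of
   [h - g], and the Bessel inequality for the signs bounds the square function of [c]. *)
pose c i := b i - ofR N%:R^-1 *: \sum_w ofR (sgn w i) *: g w.
have cE i n : c i n = ofR N%:R^-1 * \sum_(w : {ffun I -> bool}) ofR (sgn w i) * (h n w - g w n).
  have -> : c i n = b i n - ofR N%:R^-1 * \sum_w ofR (sgn w i) * g w n.
    rewrite /c lbarBE lbarZE lbar_sumE; congr (_ - _ * _).
  under [in RHS]eq_bigr do rewrite mulrBr.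
  rewrite sumrB mulrBr; congr (_ - _).
  have := sum_sgn_bilinear (fun j => (j == i)%:R : K) (fun j => b j n).
  rewrite (eq_bigr (fun w => ofR (sgn w i) * h n w)) => [->|w _]; last first.
    congr (_ * _); rewrite (bigD1 i)//= eqxx mulr1 big1 ?addr0// => j /negbTE ->.
    by rewrite mulr0.
  rewrite mulrA -of_realM mulVf ?gt_eqF// of_real1 mul1r.
  rewrite (bigD1 i)//= eqxx mul1r big1 ?addr0// => j /negbTE ->.
  by rewrite mul0r.
have c2 : square_bounded (fun i => ofR 2 *: c i).
  exists W => // n.
  rewrite (eq_bigr (fun i => (2 / N%:R) ^+ 2 *
    rnorm (\sum_(w : {ffun I -> bool}) kconj (ofR (sgn w i)) * (h n w - g w n)) ^+ 2)) => [|i _].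
    rewrite -mulr_sumr.
    have := orth_bessel (@orth_sgn R k I) (fun w => h n w - g w n) N0.
    move=> /(ler_wpM2l (sqr_ge0 (2 / N%:R))) /le_trans; apply.
    rewrite (eq_bigr (fun w => rnorm (h n w - trunc (t * sn n) (h n w)) ^+ 2)) => [|w _].
      have := HC I (fun i => b i n) (sn n) t t0 (sn0 n) (sn2 n).
      move=> /(ler_wpM2l (ltW N0))/(ler_wpM2l (sqr_ge0 (2 / N%:R)))/le_trans; apply.
      rewrite [leLHS](_ : _ = 4 * (C / t ^+ 2 * sn n ^+ 2)); last first.
        by field; rewrite !gt_eqF.
      have e1 : sn n ^+ 2 <= rnorm (W n) ^+ 2 by rewrite sn2.
      have := ler_pM (divr_ge0 (ltW C0) (sqr_ge0 t)) (sqr_ge0 (sn n)) tC e1.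
      by set a := _ * _; set d := rnorm _ ^+ 2; lra.
    by rewrite gE.
  rewrite lbarZE cE mulrA -of_realM rnormM rnorm_of_real_ge0 ?mulr_ge0// exprMn.
  by congr (_ * rnorm _ ^+ 2); apply: eq_bigr => w _; rewrite kconj_ofR.
have cS : rnorm (\sum_i G i (c i) : K) <= S / 2.
  have := GS _ c2; rewrite (eq_bigr (fun i => ofR 2 * (G i (c i) : K))) => [|i _]; last first.
    by rewrite linearZ.
  by rewrite -mulr_sumr rnormM rnorm_of_real_ge0// ler_pdivlMr// mulrC.
have gA : \sum_w rnorm (\sum_i ofR (sgn w i) * G i (g w) : K) <= N%:R * (t * A).
  have ug w : rnorm (ofR t^-1 *: g w) <= 1.
    rewrite rnormZ rnorm_of_real_ge0 ?invr_ge0 ?(ltW t0)//.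
    by rewrite mulrC ler_pdivrMr// mul1r.
  have := GA _ ug; move=> /(ler_wpM2l (ltW t0)); rewrite mulrCA => /le_trans/(_ (lexx _)).
  rewrite mulr_sumr; apply: le_trans; apply: ler_sum => w _.
  have tE : t = rnorm (ofR t) by rewrite rnorm_of_real_ge0 ?(ltW t0).
  rewrite [X in _ <= X * _]tE -rnormM mulr_sumr.
  rewrite (eq_bigr (fun i => ofR t * (ofR (sgn w i) * G i (ofR t^-1 *: g w)))) // => i _.
  rewrite linearZ /= mulrCA [ofR t * _]mulrA -of_realM mulfV ?gt_eqF//.
  by rewrite of_real1 mul1r.
have -> : \sum_i (G i (b i) : K) = \sum_i (G i (c i) : K) +
    ofR N%:R^-1 * \sum_w (\sum_i ofR (sgn w i) * G i (g w)).
  rewrite exchange_big/= mulr_sumr -big_split; apply: eq_bigr => i _; cbv beta.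
  rewrite /c linearB linearZ linear_sum/= -[LHS](subrK (ofR N%:R^-1 *
    \sum_w ofR (sgn w i) * G i (g w))).
  by congr (_ - _ * _ + _); apply: eq_bigr => w _; rewrite linearZ.
apply: le_trans (rnormD _ _) _; rewrite addrC; apply: lerD => //.
rewrite rnormM rnorm_of_real_ge0// mulrC ler_pdivrMr// [leRHS]mulrC.
by apply: le_trans (rnorm_sum _ _ _) _.
Qed.

(** Let [V] be the set of values on square bounded families. The halving step gives
    [sup V <= t * A + sup V / 2], hence [sup V <= 2 * t * A]. The weights
    [kconj (G i (a i)) / sqrt Q] turn such a value into the root of the sum of squares, and
    2-convexity of [l_r] makes the weighted family square bounded. *)
Lemma sum_square_forms_le : exists2 t : R, 0 < t &
  forall (I : finType) (G : I -> {linear X -> K^o}) (A : R), 0 <= A ->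
  (forall u : {ffun I -> bool} -> X, (forall w, rnorm (u w) <= 1) ->
    \sum_w rnorm (\sum_i ofR (sgn w i) * G i (u w) : K) <= #|{ffun I -> bool}|%:R * A) ->
  forall a : I -> X, (forall i, rnorm (a i) <= 1) ->
    \sum_i rnorm (G i (a i) : K) ^+ 2 <= (t * A) ^+ 2.
Proof.
have [t t0 step] := halving_step; exists (2 * t); first by rewrite mulr_gt0.
move=> I G A A0 GA a a1.
have N0 : 0 < #|{ffun I -> bool}|%:R :> R by rewrite ltr0n card_ffun card_bool expn_gt0.
(* A constant [u], averaged against the sign at [j], isolates one form. Summed over [I], this only
   shows that [sup V] is finite. *)
have coordA b j : rnorm b <= 1 -> rnorm (G j b : K) <= A.
  move=> b1; rewrite -(ler_pM2l N0); apply: le_trans (GA (fun=> b) (fun=> b1)).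
  rewrite -[X in X * _ <= _](@rnorm_of_real_ge0 R k)// -rnormM.
  have := sum_sgn_bilinear (fun i => (i == j)%:R : K) (fun i => G i b).
  rewrite [in RHS](bigD1 j)//= eqxx mul1r [X in _ + X]big1 ?addr0 => [<-|i /negbTE ->];
    last by rewrite mul0r.
  apply: le_trans (rnorm_sum _ _ _) _; apply: ler_sum => w _.
  rewrite rnormM (bigD1 j)//= eqxx mulr1 [X in _ + X]big1 ?addr0 => [|i /negbTE ->];
    last by rewrite mulr0.
  by rewrite rnorm_of_real /sgn normrX normrN1 expr1n mul1r.
pose V := [set v | exists2 b, square_bounded b & v = rnorm (\sum_i G i (b i) : K)].
have Vsup : has_sup V.
  split.
    exists (rnorm (\sum_i G i (0 : X) : K)), (fun=> 0) => //.
    exists 0; rewrite ?rnorm0// => n; rewrite big1 ?sqr_ge0// => i _.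
    by rewrite lbar0E rnorm0 expr0n.
  exists (\sum_(i : I) A) => _ [b [w w1 bw] ->].
  apply: le_trans (rnorm_sum _ _ _) _; apply: ler_sum => i _.
  apply/coordA/le_trans/w1; have [n|y yE] := @lbar_dominated R k r (b i) 1 w ler01.
    rewrite mul1r -(ler_pXn2r (n := 2)) ?nnegrE ?rnorm_ge0//; apply: le_trans (bw n).
    by rewrite (bigD1 i)//= lerDl sumr_ge0// => *; exact: sqr_ge0.
  by rewrite mul1r (_ : y = b i)//; exact: lbarP.
have supA : sup V <= 2 * t * A.
  suff : sup V <= t * A + sup V / 2 by lra.
  apply: ge_sup; first by case: Vsup.
  move=> _ [b bb ->]; apply: step bb => // b' bb'.
  by apply: ub_le_sup; [case: Vsup|exists b'].
set Q := \sum_i _.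
have Q0 : 0 <= Q by apply: sumr_ge0 => *; exact: sqr_ge0.
have [->|Qn0] := eqVneq Q 0; first exact: sqr_ge0.
have sQ : 0 < Num.sqrt Q by rewrite sqrtr_gt0 lt_def Qn0.
rewrite -(sqr_sqrtr Q0) lerXn2r ?nnegrE ?(ltW sQ) ?mulr_ge0 ?(ltW t0)//.
apply: le_trans supA; pose b i := (ofR (Num.sqrt Q)^-1 * kconj (G i (a i) : K)) *: a i.
apply: ub_le_sup; first by case: Vsup.
exists b; last first.
  rewrite (eq_bigr (fun i => ofR (Num.sqrt Q)^-1 * ofR (rnorm (G i (a i) : K) ^+ 2))) => [|i _].
    rewrite -mulr_sumr -raddf_sum/= -/Q -of_realM rnorm_of_real_ge0; last first.
      by rewrite mulr_ge0// invr_ge0 ltW.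
    by rewrite -{3}(sqr_sqrtr Q0) expr2 mulKf// gt_eqF.
  by rewrite -kconj_mul mulrA /b linearZ.
have [w wE w2] := lbar_square_function b r2; exists w => [|n].
  rewrite -(ler_pXn2r (n := 2)) ?nnegrE ?rnorm_ge0// expr1n; apply: le_trans w2 _.
  apply: (@le_trans _ _ (\sum_i Q^-1 * rnorm (G i (a i) : K) ^+ 2)).
    apply: ler_sum => i _; rewrite /b rnormZ rnormM rnorm_kconj rnorm_of_real_ge0; last first.
      by rewrite invr_ge0 ltW.
    rewrite !exprMn exprVn sqr_sqrtr// -[leRHS]mulr1 ler_wpM2l ?mulr_ge0 ?invr_ge0 ?rnorm_ge0//.
    by rewrite exprn_ile1 ?rnorm_ge0.
  by rewrite -mulr_sumr mulVf.
rewrite wE rnorm_of_real_ge0 ?sqrtr_ge0// sqr_sqrtr//.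
by apply: sumr_ge0 => *; exact: sqr_ge0.
Qed.

End square_summing_forms.

(** * Khintchine's inequality applied to [q]-hulls *)

Section square_domination.
Context {R : realType} {k : scalar_kind}.
Local Notation K := (scalar_field R k).
Local Notation ofR := (@of_real R k).

(** The hull inequality is applied to one seminorm for each choice of signs, the modulus of the
    signed sum of the [y i], and Khintchine's inequality averages their [q]-th powers at the [x m].
    The constant [C] depends neither on the family nor on its size, as the separation argument in
    [operator_hull2] demands. *)
Lemma hull_square_bound (r : exponent R) (q : R) : (2%:E <= r)%E -> 1 <= q ->
  exists2 C : R, 0 < C & forall (F : completeNormedModType K) (T : {linear lbar k r -> F})
    (x : nat -> F) (I : finType) (y : I -> {linear F -> K^o}) (Y D : R),
  (forall u, rnorm u < 1 -> p_hull q x (T u)) -> 0 <= Y ->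
  (forall i v, rnorm (y i v : K) <= Y * rnorm v) -> 0 < D ->
  (forall M, \sum_(m < M) (\sum_i rnorm (y i (x m) : K) ^+ 2) `^ (q / 2) <= D `^ (q / 2)) ->
  forall a, (forall i, rnorm (a i) <= 1) -> \sum_i rnorm (y i (T (a i)) : K) ^+ 2 <= C * D.
Proof.
move=> r2 q1; have q0 : 0 < q by rewrite (lt_le_trans _ q1).
have [t t0 Ht] := @sum_square_forms_le R k r r2.
have [Kq Kq0 HK] := @khintchine R k q q0.
exists ((t * (2 * (1 + Kq))) ^+ 2); first by rewrite exprn_gt0// !mulr_gt0// addr_gt0.
move=> F T x I y Y D Tx Y0 yY D0 xD a a1.
set N := #|{ffun I -> bool}|%:R : R.
(* With [B = sqrt D] both terms of the hull inequality have the same order, since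
   [B^(1 - q) * D^(q/2) = B]. *)
pose B := D `^ 2^-1.
have B0 : 0 < B by rewrite powR_gt0.
have B2 : B ^+ 2 = D by rewrite -powR_mulrn ?(ltW B0)// /B -powRrM mulVf// powRr1// ltW.
have Bq : B `^ (1 - q) * D `^ (q / 2) = B.
  rewrite (_ : D `^ (q / 2) = B `^ q); last by rewrite /B -powRrM mulrC.
  by rewrite -powRD ?subrK ?powRr1 ?(ltW B0)// (gt_eqF B0) implybT.
pose G i : {linear lbar k r -> K^o} := y i \o T.
rewrite -B2 -exprMn -mulrA.
have A0 : 0 <= 2 * (1 + Kq) * B by rewrite !mulr_ge0 ?addr_ge0 ?(ltW Kq0) ?(ltW B0).
suff GA : forall u : {ffun I -> bool} -> lbar k r, (forall w, rnorm (u w) <= 1) ->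
    \sum_w rnorm (\sum_i ofR (sgn w i) * G i (u w) : K) <= N * (2 * (1 + Kq) * B).
  exact: (Ht I G _ A0 GA a a1).
move=> u u1.
have := @hull_seminorm R k F {ffun I -> bool} q (\sum_(i : I) Y) B (N * (Kq * D `^ (q / 2)))
  (fun w => T (ofR 2^-1 *: u w)) (fun w v => rnorm (\sum_i ofR (sgn w i) * y i v : K)) x q1 B0.
have sgn1 (w : {ffun I -> bool}) i : rnorm (ofR (sgn w i)) = 1.
  by rewrite rnorm_of_real /sgn normrX normrN1 expr1n.
have -> : \sum_w rnorm (\sum_i ofR (sgn w i) * y i (T (ofR 2^-1 *: u w)) : K) =
    2^-1 * \sum_w rnorm (\sum_i ofR (sgn w i) * G i (u w) : K).
  rewrite mulr_sumr; apply: eq_bigr => w _.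
  rewrite -[X in X * _](@rnorm_of_real_ge0 R k)// -rnormM mulr_sumr; congr rnorm.
  by apply: eq_bigr => i _; rewrite /G /= !linearZ /= mulrCA.
have -> : #|{: {ffun I -> bool}}|%:R * B + B `^ (1 - q) * (N * (Kq * D `^ (q / 2))) =
    N * ((1 + Kq) * B).
  by rewrite -/N mulrDl mul1r mulrDr -{4}Bq; congr (_ + _); ring.
move=> H; rewrite -(ler_pM2l (_ : 0 < 2^-1)) ?invr_gt0//.
rewrite (_ : 2^-1 * (N * _) = N * ((1 + Kq) * B)); last by field.
apply: H => //.
- by apply: sumr_ge0.
- by move=> *; exact: rnorm_ge0.
- move=> w v v'; rewrite (eq_bigr (fun i => ofR (sgn w i) * (y i v : K) +
    ofR (sgn w i) * (y i v' : K))).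
    by rewrite big_split; exact: rnormD.
  by move=> i _; rewrite linearD -mulrDr.
- move=> w c v; rewrite (eq_bigr (fun i => c * (ofR (sgn w i) * (y i v : K)))).
    by rewrite -mulr_sumr rnormM.
  by move=> i _; rewrite [RHS]mulrCA; congr (_ * _); exact: linearZ.
- move=> w v; rewrite mulr_suml; apply: le_trans (rnorm_sum _ _ _) _.
  by apply: ler_sum => i _; rewrite rnormM sgn1 mul1r.
- move=> w; apply: Tx; rewrite rnormZ rnorm_of_real_ge0 ?invr_ge0//.
  rewrite (@le_lt_trans _ _ 2^-1) ?invf_lt1 ?ltr1n// -[leRHS]mulr1 ler_wpM2l ?invr_ge0//.
move=> M; rewrite exchange_big/=.
apply: (@le_trans _ _ (\sum_(m < M) N * (Kq * (\sum_i rnorm (y i (x m) : K) ^+ 2) `^ (q / 2)))).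
  by apply: ler_sum => m _; exact: HK.
by rewrite -!mulr_sumr ler_wpM2l ?ler0n// ler_wpM2l ?(ltW Kq0).
Qed.

End square_domination.

Section coordinates.
Context {R : realType} {k : scalar_kind} (s : exponent R).
Local Notation K := (scalar_field R k).
Local Notation ofR := (@of_real R k).

Lemma lbar_headE M (b : nat -> K) n :
  (\sum_(m < M) b m *: @lbar_unit R k s m) n = if (n < M)%N then b n else 0.
Proof.
rewrite lbar_sumE; under eq_bigr do rewrite lbarZE lbar_unitE.
case: ltnP => [nM|Mn].
  rewrite (bigD1 (Ordinal nM))//= eqxx mulr1 big1 ?addr0// => m mn.
  case: eqP => [nm|_]; last by rewrite mulr0.
  by move: mn; rewrite -val_eqE/= nm eqxx.
rewrite big1// => m _; rewrite gtn_eqF ?mulr0//.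
exact: leq_trans (ltn_ord m) Mn.
Qed.

Lemma lbar_head_norm (t : R) (b : nat -> K) M : exponent_val s = t%:E -> 1 <= t ->
  rnorm (\sum_(m < M) b m *: @lbar_unit R k s m) <= (\sum_(m < M) rnorm (b m) `^ t) `^ t^-1.
Proof.
move=> st t1; have t0 : 0 < t by rewrite (lt_le_trans _ t1).
apply/(rnorm_lbarP _ t1 st); first exact: powR_ge0.
move=> N; rewrite powR_invK ?gt_eqF//; last by apply: sumr_ge0 => *; exact: powR_ge0.
pose f n := rnorm ((\sum_(m < M) b m *: @lbar_unit R k s m) n) `^ t.
have f0 n : 0 <= f n by exact: powR_ge0.
apply: le_trans (ler_sum_ord_le f0 (leq_addl M N)) _.
rewrite big_split_ord/= [X in _ + X]big1 => [|i _].
  by rewrite addr0; apply: ler_sum => i _; rewrite /f lbar_headE ltn_ord.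
by rewrite /f lbar_headE ltnNge leq_addr /= rnorm0 powR0// gt_eqF.
Qed.

Lemma lbar_tail (t : R) (x : lbar k s) e : exponent_val s = t%:E -> 1 <= t -> 0 < e ->
  exists N, forall M, (N <= M)%N -> rnorm (x - \sum_(m < M) x m *: @lbar_unit R k s m) <= e.
Proof.
move=> st t1 e0; have t0 : 0 < t by rewrite (lt_le_trans _ t1).
have f0 n : 0 <= rnorm (x n) `^ t by exact: powR_ge0.
have /(rnorm_lbarP _ t1 st (rnorm_ge0 _)) xx := lexx (rnorm x).
have et0 : 0 < e `^ t by rewrite powR_gt0.
have [N HN] := bounded_sum_tail f0 xx et0.
exists N => M NM; apply/(rnorm_lbarP _ t1 st (ltW e0)) => N'.
pose g n := rnorm ((x - \sum_(m < M) x m *: @lbar_unit R k s m) n) `^ t.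
have g0 n : 0 <= g n by exact: powR_ge0.
apply: le_trans (ler_sum_ord_le g0 (leq_addl M N')) _.
have := HN (M + N')%N (leq_trans NM (leq_addr _ _)).
rewrite !big_split_ord/= [X in X + _ <= e `^ t]big1 => [|i _].
  rewrite add0r => H.
  have h : \sum_(i < N) rnorm (x i) `^ t <= \sum_(i < M) rnorm (x i) `^ t.
    exact: (ler_sum_ord_le f0 NM).
  rewrite (eq_bigr (fun i : 'I_N' => rnorm (x (M + i)%N) `^ t)) => [|i _].
    by rewrite -(lerD2l (\sum_(i < M) rnorm (x i) `^ t)) (le_trans H)// lerD2r.
  by rewrite /g lbarBE lbar_headE ltnNge leq_addr /= subr0.
by rewrite /g lbarBE lbar_headE ltn_ord subrr rnorm0 powR0// gt_eqF.
Qed.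

End coordinates.

(** * Weights from a Hahn-Banach argument in [l_t] *)

Section positive_functionals.
Context {R : realType} (s : exponent R) (t : R).
Hypotheses (st : exponent_val s = t%:E) (t1 : 1 <= t).
Local Notation V := (lbar real_scalars s).
Local Notation co u m := (@real_part R real_scalars (u m)).

Let le_seq (u v : V) := forall m, co u m <= co v m.

Let rnorm_abs (a : scalar_field R real_scalars) : rnorm a = `|real_part a|.
Proof. by []. Qed.

(* The Hahn-Banach theorem is applied to
   p u = inf {C ||v|| - g : (h, g) in S and u + h <= v}. *)
Lemma dominating_functional (C : R) (S : set (V * R)) : 0 <= C -> S (0, 0) ->
  (forall a b, S a -> S b -> S (a.1 + b.1, a.2 + b.2)) ->
  (forall c a, 0 < c -> S a -> S (of_real real_scalars c *: a.1, c * a.2)) ->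
  (forall a, S a -> (forall m, 0 <= co a.1 m) /\ a.2 <= C * rnorm a.1) ->
  exists2 l : V -> R, real_linear l &
    [/\ forall u, l u <= C * rnorm u,
        forall u : V, (forall m, 0 <= co u m) -> 0 <= l u &
        forall a, S a -> a.2 <= l a.1].
Proof.
move=> C0 S0 SD SZ SC.
pose P u := [set z | exists v a, [/\ S a, le_seq (u + a.1) v & z = C * rnorm v - a.2]].
have PS u : P u (C * rnorm u) by exists u, (0, 0); split; rewrite ?subr0 ?addr0// => m.
have Pn u : P u !=set0 by exists (C * rnorm u).
(* A non-negative [h] with [u + h <= v] satisfies [h <= v - u], so the hypothesis on [S] bounds
   [p u] below by [- C * ||u||]. *)
have lower u z : P u z -> - (C * rnorm u) <= z.
  move=> [v [a [Sa ua ->]]]; have [a0 aC] := SC _ Sa.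
  suff av : rnorm a.1 <= rnorm v + rnorm u.
    have := ler_wpM2l C0 av; rewrite mulrDr => h.
    by rewrite lerBrDr -lerBrDl opprK; apply: le_trans aC h.
  apply: le_trans (_ : rnorm (v - u) <= _); last by rewrite -(rnormN u); exact: rnormD.
  apply: rnorm_lbar_mono => m; rewrite !rnorm_abs ger0_norm//.
  by apply: le_trans (ler_norm _); have := ua m; rewrite lbarBE lbarDE /= lerBrDl.
have Plb u : has_lbound (P u) by exists (- (C * rnorm u)) => z; exact: lower.
pose p u := inf (P u).
have pP u z : P u z -> p u <= z by move=> uz; exact: ge_inf.
have infge u c : (forall z, P u z -> c <= z) -> c <= p u by move=> uc; exact: lb_le_inf.
have psub : sublinear p.
  split=> [u v|c u c0].
    rewrite -lerBlDl; apply: (infge) => z2 Pz2; rewrite lerBlDl -lerBlDr; apply: infge => z1 Pz1.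
    rewrite lerBlDr; case: Pz1 Pz2 => v1 [a1 [Sa1 ua1 ->]] [v2 [a2 [Sa2 va2 ->]]].
    apply: (@le_trans _ _ (C * rnorm (v1 + v2) - (a1.2 + a2.2))).
      apply: pP; exists (v1 + v2), (a1.1 + a2.1, a1.2 + a2.2); split => //; first exact: SD.
      by move=> m; have := lerD (ua1 m) (va2 m); rewrite !lbarDE /= addrACA.
    rewrite opprD addrACA lerD2r -mulrDr ler_wpM2l//; exact: rnormD.
  rewrite -ler_pdivrMl//; apply: (infge) => z [v [a [Sa ua ->]]]; rewrite ler_pdivrMl//.
  apply: pP; exists (of_real real_scalars c *: v), (of_real real_scalars c *: a.1, c * a.2).
  split; first exact: SZ.
    by move=> m; have := ler_wpM2l (ltW c0) (ua m); rewrite -scalerDr.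
  by rewrite rnormZ rnorm_of_real_ge0 ?(ltW c0)// mulrBr mulrCA.
have [l [ll lp]] := hahn_banach psub.
have l0 : l 0 = 0 by apply: (addrI (l 0)); rewrite -ll.1 !addr0.
have lN u : l (- u) = - l u.
  by apply/eqP; rewrite -addr_eq0 -ll.1 addNr l0.
exists l => //; split.
- by move=> u; apply: le_trans (lp u) _; apply: pP.
- move=> u u0; rewrite -oppr_le0 -lN; apply: le_trans (lp _) _; apply: pP.
  exists 0, (0, 0); split => //; last by rewrite rnorm0 mulr0 subr0.
  by move=> m; rewrite addr0; have := u0 m; rewrite -oppr_le0.
- move=> a Sa; rewrite -lerN2 -lN; apply: le_trans (lp _) _; apply: pP.
  by exists 0, a; split; rewrite ?addNr ?rnorm0 ?mulr0 ?sub0r// => m.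
Qed.

(** The weights are the values of the functional at the unit vectors. Finite sections converge in
    [l_t] for finite [t], so the functional is controlled by partial sums. *)
Lemma dominating_weights (C : R) (S : set (V * R)) : 0 <= C -> S (0, 0) ->
  (forall a b, S a -> S b -> S (a.1 + b.1, a.2 + b.2)) ->
  (forall c a, 0 < c -> S a -> S (of_real real_scalars c *: a.1, c * a.2)) ->
  (forall a, S a -> (forall m, 0 <= co a.1 m) /\ a.2 <= C * rnorm a.1) ->
  exists nu : nat -> R, [/\ forall m, 0 <= nu m,
    forall M (b : nat -> R), (forall m, 0 <= b m) ->
      \sum_(m < M) nu m * b m <= C * (\sum_(m < M) b m `^ t) `^ t^-1 &
    forall a c, S a -> (forall M, \sum_(m < M) nu m * co a.1 m <= c) -> a.2 <= c].
Proof.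
move=> C0 S0 SD SZ SC.
have [l [lD lZ] [lC l0 lS]] := dominating_functional C0 S0 SD SZ SC.
pose e m : V := @lbar_unit R real_scalars s m.
have lsum M (b : nat -> R) : l (\sum_(m < M) of_real real_scalars (b m) *: e m) =
    \sum_(m < M) l (e m) * b m.
  elim: M => [|M IH]; last by rewrite !big_ord_recr/= lD IH lZ mulrC.
  by rewrite !big_ord0; have := lZ 0 0; rewrite scaler0 mul0r.
exists (fun m => l (e m)); split.
- by move=> m; apply: l0 => n; rewrite lbar_unitE /=; exact: ler0n.
- move=> M b b0; rewrite -lsum; apply: le_trans (lC _) _; rewrite ler_wpM2l//.
  apply: le_trans (lbar_head_norm _ _ st t1) _.
  by under eq_bigr do rewrite rnorm_of_real_ge0//.
move=> a c Sa ac; apply/ler_addgt0Pr => d d0.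
have dC0 : 0 < d / (C + 1) by rewrite divr_gt0// ltr_wpDl.
have [N HN] := lbar_tail a.1 st t1 dC0.
apply: le_trans (lS _ Sa) _.
rewrite -(subrK (\sum_(m < N) a.1 m *: e m) a.1) lD addrC; apply: lerD.
  apply: le_trans (ac N); rewrite -lsum; exact: lexx.
apply: le_trans (lC _) _; apply: le_trans (ler_wpM2l C0 (HN _ (leqnn N))) _.
by rewrite mulrCA ger_pMr// ler_pdivrMr ?ltr_wpDl// mul1r lerDl.
Qed.

End positive_functionals.

Section domination_by_square_sums.
Context {R : realType} {k : scalar_kind}.
Local Notation K := (scalar_field R k).
Local Notation ofR := (@of_real R k).
Variables (F : completeNormedModType K) (W : lmodType K) (pr : W -> {linear F -> K^o}).
Hypothesis prL : forall v, linear (fun y => pr y v).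
Hypothesis pr_bounded : forall y, exists2 Y : R, 0 <= Y &
  forall v, rnorm (pr y v : K) <= Y * rnorm v.
Hypothesis pr_sep : forall v, (forall y, pr y v = 0) -> v = 0.

Let sq (a : R) : 0 <= a -> a `^ 2 = a ^+ 2.
Proof. by move=> a0; rewrite -powR_mulrn. Qed.

Let prZ c y v : pr (c *: y) v = c * (pr y v : K).
Proof.
pose f : {linear W -> K^o} := HB.pack (fun y => pr y v) (GRing.isLinear.Build _ _ _ _ _ (prL v)).
by rewrite -[LHS]/(f (c *: y)) linearZ.
Qed.

(* The functional (pr y (z m))_m |-> pr y v, defined on a subspace of l_2, extends to l_2; the
   values of the extension at the unit vectors are the coefficients of v. *)
Lemma hull2_of_domination (z : nat -> F) (B : R) (v : F) :
  (forall M, \sum_(m < M) rnorm (z m) ^+ 2 <= B) ->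
  (forall y c, 0 <= c -> (forall M, \sum_(m < M) rnorm (pr y (z m) : K) ^+ 2 <= c ^+ 2) ->
    rnorm (pr y v : K) <= c) ->
  p_hull 2 (fun m => ofR 4 *: z m) v.
Proof.
move=> zB vz; have B0 : 0 <= B by have := zB 0%N; rewrite big_ord0.
have two1 : (1 <= 2%:E :> \bar R)%E by rewrite lee_fin ler1n.
pose two := Exponent two1; have twoE : exponent_val two = 2%:E by [].
have r1 : 1 <= 2 :> R by rewrite ler1n.
have r0 : (2 : R) != 0 by [].
have sqB : Num.sqrt B ^+ 2 = B by rewrite sqr_sqrtr.
have /choice[J0 J0E] : forall y, exists u : lbar k two, forall n, u n = pr y (z n).
  move=> y; have [Y Y0 yY] := pr_bounded y.
  have YB : 0 <= Y * Num.sqrt B by rewrite mulr_ge0 ?sqrtr_ge0.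
  apply: (lbar_finP r1 twoE YB) => N; rewrite sq// exprMn sqB.
  apply: le_trans (ler_wpM2l (sqr_ge0 Y) (zB N)); rewrite mulr_sumr; apply: ler_sum => n _.
  by rewrite sq ?rnorm_ge0// -exprMn lerXn2r ?nnegrE ?mulr_ge0 ?rnorm_ge0.
have J0L : linear J0.
  by move=> c y y'; apply: lbarP => n; rewrite lbarDE lbarZE !J0E; exact: prL.
pose J : {linear W -> lbar k two} := HB.pack J0 (GRing.isLinear.Build _ _ _ _ _ J0L).
pose f : {linear W -> K^o} := HB.pack (fun y => pr y v) (GRing.isLinear.Build _ _ _ _ _ (prL v)).
have fJ y : rnorm (f y : K) <= rnorm (J y).
  apply: vz => [|M]; first exact: rnorm_ge0.
  have /(rnorm_lbarP _ r1 twoE (rnorm_ge0 _))/(_ M) := lexx (rnorm (J y)).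
  rewrite sq ?rnorm_ge0//; apply: le_trans; apply: ler_sum => m _.
  by rewrite sq ?rnorm_ge0// /J /= J0E.
have [phi [phiJ phiN]] := hahn_banach_extension (@rnormD R k _) (@rnormZ R k _) fJ.
pose e m : lbar k two := @lbar_unit R k two m.
pose b m : K := phi (e m).
have phi_sum M (a : nat -> K) : phi (\sum_(m < M) a m *: e m) = \sum_(m < M) a m * b m.
  by rewrite linear_sum; apply: eq_bigr => m _; exact: linearZ.
(* [phi] is tested on the conjugates of its own coefficients; the bound 2 is the factor of
   [hahn_banach_extension]. *)
have b2 M : \sum_(m < M) rnorm (b m) ^+ 2 <= 2 ^+ 2.
  set Q := \sum_(m < M) _.
  have Q0 : 0 <= Q by apply: sumr_ge0 => *; exact: sqr_ge0.
  pose D := Q `^ 2^-1; have D0 : 0 <= D by exact: powR_ge0.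
  have DQ : D ^+ 2 = Q by rewrite -sq// powR_invK.
  have : Q <= 2 * D.
    have := phiN (\sum_(m < M) kconj (b m) *: e m).
    rewrite (phi_sum M (fun m => kconj (b m))).
    rewrite (eq_bigr (fun m : 'I_M => ofR (rnorm (b m) ^+ 2))) => [|m _]; last exact: kconj_mul.
    rewrite -raddf_sum/= -/Q rnorm_of_real_ge0// => /le_trans; apply; rewrite ler_wpM2l//.
    apply: le_trans (lbar_head_norm (fun m => kconj (b m)) M twoE r1) _.
    by under eq_bigr do rewrite rnorm_kconj sq ?rnorm_ge0//.
  rewrite -DQ expr2; have [->|Dn0] := eqVneq D 0; first by rewrite mul0r sqr_ge0.
  have Dp : 0 < D by rewrite lt_def Dn0.
  by rewrite ler_pM2r// => D2; rewrite -expr2 lerXn2r ?nnegrE.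
have [l lP] : exists l : F, series (fun m => b m *: z m) @ \oo --> l.
  apply: (@abs_series_cvg _ _ F _ (2 * Num.sqrt B)) => N.
  under eq_bigr do rewrite rnormZ.
  apply: cauchy_schwarz => //; rewrite ?sqrtr_ge0 ?sqB//.
  - by move=> i; exact: rnorm_ge0.
  - by move=> i; exact: rnorm_ge0.
have -> : v = l.
  apply/eqP; rewrite -subr_eq0; apply/eqP/pr_sep => y.
  apply: (@rnorm0_eq0 R k K^o); apply/eqP; rewrite eq_le rnorm_ge0 andbT.
  apply/ler_addgt0Pr => d d0; rewrite add0r; have [Y Y0 yY] := pr_bounded y.
  have d'0 : 0 < d / (2 + Y) by rewrite divr_gt0// ltr_wpDr.
  have [N1 HN1] := lbar_tail (J y) twoE r1 d'0.
  have [N2 HN2] := (cvg_seq_rnormP _ _).1 lP _ d'0.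
  pose M := maxn N1 N2; have h1 := HN1 M (leq_maxl _ _); have h2 := HN2 M (leq_maxr _ _).
  pose S := \sum_(m < M) b m * (pr y (z m) : K).
  have -> : pr y (v - l) = (pr y v - S) - (pr y l - S).
    by rewrite linearB opprB addrA subrK.
  apply: le_trans (rnormD _ _) _; rewrite rnormN.
  have -> : d = 2 * (d / (2 + Y)) + Y * (d / (2 + Y)).
    by rewrite -mulrDl mulrC divfK// gt_eqF// ltr_wpDr.
  apply: lerD.
    have -> : pr y v - S = phi (J y - \sum_(m < M) J y m *: e m).
      rewrite linearB phiJ (phi_sum M (fun m => J y m)).
      suff -> : S = \sum_(m < M) J y m * b m by [].
      by apply: eq_bigr => m _; rewrite mulrC /J /= J0E.
    by apply: le_trans (phiN _) _; rewrite ler_wpM2l.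
  have -> : pr y l - S = pr y (l - series (fun m => b m *: z m) M).
    rewrite linearB seriesE; suff -> : S = pr y (\sum_(m < M) b m *: z m) by [].
    by rewrite linear_sum; apply: eq_bigr => m _; rewrite linearZ.
  by apply: le_trans (yY _) _; rewrite ler_wpM2l.
have -> : (fun m => ofR 4 *: z m) = (fun m => ofR (2 * 2) *: z m).
  by apply/funext => m; congr (ofR _ *: _); ring.
apply: p_hull_scale lP => //.
rewrite conj_gt1 ?ltr1n// (_ : 2 / (2 - 1) = 2); last by field.
apply/(@seq_norm_leP _ _ K^o) => // N; rewrite sq//; apply: le_trans (b2 N).
by apply: ler_sum => m _; rewrite sq ?rnorm_ge0.
Qed.

(** [S] is a convex cone of pairs, a sequence in [l_(q/2)] and a number, one for each finite family
    of functionals and points: concatenation gives sums, and multiplying the functionals by [sqrt c]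
    gives multiples. [hull_square_bound] is the inequality that permits separation, and families
    with a single member return the pointwise domination. *)
Lemma operator_hull2 (r : exponent R) (q M0 : R) (T : {linear lbar k r -> F}) (x : nat -> F) :
  (2%:E <= r)%E -> 2 < q -> (forall u, rnorm u < 1 -> p_hull q x (T u)) ->
  (forall M, \sum_(m < M) rnorm (x m) `^ q <= M0) ->
  exists z : nat -> F, (exists B : R, forall M, \sum_(m < M) rnorm (z m) ^+ 2 <= B) /\
    forall u, rnorm u < 1 -> p_hull 2 z (T u).
Proof.
move=> r2 q2 Tx xM; pose t : R := q / 2.
have t1 : 1 <= t by rewrite /t ler_pdivlMr// mul1r ltW.
have t0 : 0 < t by rewrite (lt_le_trans _ t1).
have q1 : 1 <= q by rewrite ltW// (lt_trans _ q2)// ltr1n.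
have M00 : 0 <= M0 by have := xM 0%N; rewrite big_ord0.
have sqt (a : R) : 0 <= a -> (a ^+ 2) `^ t = a `^ q.
  by move=> a0; rewrite -sq// -powRrM /t mulrC divfK.
have t1E : (1 <= t%:E)%E by rewrite lee_fin.
pose tE := Exponent t1E; have tEE : exponent_val tE = t%:E by [].
have [C C0 HC] := @hull_square_bound R k r q r2 q1.
pose V := lbar real_scalars tE.
pose S : set (V * R) := [set a : V * R | exists fam : seq (W * lbar k r),
  [/\ all (fun ya => rnorm ya.2 <= 1) fam,
      forall m, @real_part R real_scalars (a.1 m) = \sum_(ya <- fam) rnorm (pr ya.1 (x m) : K) ^+ 2 &
      a.2 = \sum_(ya <- fam) rnorm (pr ya.1 (T ya.2) : K) ^+ 2]].
have S0 : S (0, 0) by exists [::]; split=> // [m|]; rewrite big_nil.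
have SD a b : S a -> S b -> S (a.1 + b.1, a.2 + b.2).
  move=> [fa [fa1 aE a2]] [fb [fb1 bE b2]]; exists (fa ++ fb); split.
  - by rewrite all_cat fa1.
  - by move=> m; rewrite big_cat -aE -bE.
  - by rewrite big_cat -a2 -b2.
have SZ c a : 0 < c -> S a -> S (of_real real_scalars c *: a.1, c * a.2).
  move=> c0 [fa [fa1 aE a2]].
  have cs v y : rnorm (pr (ofR (Num.sqrt c) *: y) v : K) ^+ 2 = c * rnorm (pr y v : K) ^+ 2.
    by rewrite prZ rnormM exprMn rnorm_of_real_ge0 ?sqrtr_ge0// sqr_sqrtr// ltW.
  exists [seq (ofR (Num.sqrt c) *: ya.1, ya.2) | ya <- fa]; split.
  - by rewrite all_map.
  - move=> m; rewrite big_map; under eq_bigr do rewrite cs.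
    by rewrite -mulr_sumr -aE.
  - by rewrite big_map a2; under [in RHS]eq_bigr do rewrite cs; rewrite -mulr_sumr.
have SC a : S a -> (forall m, 0 <= real_part (a.1 m)) /\ a.2 <= C * rnorm a.1.
  move=> [fa [/allP fa1 aE a2]].
  have a0 m : 0 <= real_part (a.1 m) by rewrite aE sumr_ge0// => *; exact: sqr_ge0.
  split => //; apply/ler_addgt0Pr => d d0.
  (* [hull_square_bound] asks for a positive [D], hence the excess [d / C] over the norm. *)
  pose D := rnorm a.1 + d / C.
  have D0 : 0 < D by rewrite ltr_wpDl ?rnorm_ge0// divr_gt0.
  have -> : C * rnorm a.1 + d = C * D by rewrite mulrDr mulrCA divff ?mulr1// gt_eqF.
  have /choice[Y YP] : forall i : 'I_(size fa), exists Y : R, 0 <= Y /\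
      forall v, rnorm (pr (tnth (in_tuple fa) i).1 v : K) <= Y * rnorm v.
    by move=> i; have [Y ? ?] := pr_bounded (tnth (in_tuple fa) i).1; exists Y.
  rewrite a2 big_tnth.
  apply: (HC F T x _ (fun i => pr (tnth (in_tuple fa) i).1) (\sum_i Y i)) => //.
  - by apply: sumr_ge0 => i _; case: (YP i).
  - move=> i v; apply: le_trans (proj2 (YP i) v) _; rewrite ler_wpM2r ?rnorm_ge0//.
    by rewrite (bigD1 i)//= lerDl sumr_ge0// => j _; case: (YP j).
  - move=> M; have /(rnorm_lbarP _ t1 tEE (rnorm_ge0 _))/(_ M) := lexx (rnorm a.1).
    move=> h; apply: (@le_trans _ _ (rnorm a.1 `^ t)); last first.
      by apply: ler_powR_base; rewrite ?rnorm_ge0 ?(ltW t0)// lerDl ltW// divr_gt0.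
    apply: le_trans h; apply: ler_sum => m _.
    have -> : rnorm (a.1 m) = real_part (a.1 m) by rewrite -[RHS]ger0_norm.
    by rewrite aE [in leRHS]big_tnth.
  - by move=> i; apply: fa1; exact: mem_tnth.
have [nu [nu0 nuC nuS]] := dominating_weights tEE t1 (ltW C0) S0 SD SZ SC.
have nus m : rnorm (ofR (Num.sqrt (nu m))) ^+ 2 = nu m.
  by rewrite rnorm_of_real_ge0 ?sqrtr_ge0// sqr_sqrtr.
pose z m := ofR (Num.sqrt (nu m)) *: x m.
have zB M : \sum_(m < M) rnorm (z m) ^+ 2 <= C * M0 `^ t^-1.
  under eq_bigr do rewrite rnormZ exprMn nus.
  apply: le_trans (nuC M _ (fun m => sqr_ge0 (rnorm (x m)))) _; rewrite ler_wpM2l ?(ltW C0)//.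
  apply: ler_powR_base; rewrite ?invr_ge0 ?(ltW t0)//.
    by apply: sumr_ge0 => *; exact: powR_ge0.
  by under eq_bigr do rewrite sqt ?rnorm_ge0//.
exists (fun m => ofR 4 *: z m); split.
  exists (4 ^+ 2 * (C * M0 `^ t^-1)) => M.
  apply: le_trans (ler_wpM2l (sqr_ge0 4) (zB M)); rewrite mulr_sumr; apply: ler_sum => m _.
  by rewrite rnormZ rnorm_of_real_ge0// exprMn.
move=> u u1; apply: (hull2_of_domination zB) => y c c0 yc.
rewrite -(ler_pXn2r (n := 2)) ?nnegrE ?rnorm_ge0//.
have [Y Y0 yY] := pr_bounded y.
have [h hE] : exists h : V, forall m, h m = rnorm (pr y (x m) : K) ^+ 2.
  apply: (lbar_finP t1 tEE (powR_ge0 (Y `^ q * M0) t^-1)) => N.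
  rewrite powR_invK ?gt_eqF ?mulr_ge0 ?powR_ge0//.
  apply: le_trans (ler_wpM2l (powR_ge0 Y q) (xM N)); rewrite mulr_sumr; apply: ler_sum => m _.
  have -> : @rnorm R real_scalars _ (rnorm (pr y (x m) : K) ^+ 2 : R) = rnorm (pr y (x m) : K) ^+ 2.
    by rewrite -[LHS]/(`|_|) ger0_norm ?sqr_ge0.
  rewrite sqt ?rnorm_ge0// -powRM ?rnorm_ge0//.
  by apply: ler_powR_base; rewrite ?rnorm_ge0 ?(le_trans _ q1).
apply: (nuS (h, rnorm (pr y (T u) : K) ^+ 2)) => [|M].
  by exists [:: (y, u)]; split=> [|m|]; rewrite ?big_seq1//= ?andbT ?(ltW u1).
apply: le_trans (yc M); apply: ler_sum => m _.
have -> : pr y (z m) = ofR (Num.sqrt (nu m)) * (pr y (x m) : K) by rewrite /z linearZ.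
by rewrite rnormM exprMn nus /= hE.
Qed.

End domination_by_square_sums.

(** * Emptiness of the operator differences *)

Section operators.
Context {R : realType} {k : scalar_kind}.
Local Notation K := (scalar_field R k).
Implicit Types r s : exponent R.

(* Polynomials play the role of finitely supported sequences of coefficients. *)
Definition coefficient_form s (y : {poly K}) (v : lbar k s) : K^o :=
  \sum_(i < size y) y`_i * v i.

Lemma coefficient_form_is_linear s y : linear (@coefficient_form s y).
Proof.
move=> c u v; rewrite /coefficient_form scaler_sumr -big_split; apply: eq_bigr => i _; cbv beta.
by rewrite lbarDE lbarZE mulrDr mulrCA.
Qed.

HB.instance Definition _ s y := GRing.isLinear.Build K (lbar k s) K^o *:%R
  (@coefficient_form s y) (coefficient_form_is_linear y).

Lemma coefficient_formE s (y : {poly K}) (v : lbar k s) N : (size y <= N)%N ->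
  coefficient_form y v = \sum_(i < N) y`_i * v i.
Proof.
move=> yN; rewrite /coefficient_form -(subnKC yN) big_split_ord/= [X in _ + X]big1 ?addr0//.
by move=> i _; rewrite nth_default ?mul0r// leq_addr.
Qed.

Lemma operator_range_hull2 r s (q : R) (T : lbar k r -> lbar k s) : (2%:E <= r)%E -> 2 < q ->
  p_compact_operators (lbar k r) (lbar k s) q T ->
  exists2 z : nat -> lbar k s, T @` ball 0 1 `<=` p_hull 2 z &
    exists B : R, forall M, \sum_(m < M) rnorm (z m) ^+ 2 <= B.
Proof.
move=> r2 q2 [TL _ [x /p_coverP[[M0 xM] Tx]]].
pose f : {linear lbar k r -> lbar k s} := HB.pack T (GRing.isLinear.Build _ _ _ _ _ TL).
have ballE (u : lbar k r) : ball 0 1 u <-> rnorm u < 1.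
  rewrite -ball_normE /= sub0r normrN -rnormE -(of_real1 R k).
  by rewrite !lt_neqAle of_real_le (inj_eq (@of_real_inj R k)).
have fx u : rnorm u < 1 -> p_hull q x (f u) by move=> /ballE u1; apply: Tx; exists u.
have [|||z [zB zT]] := @operator_hull2 R k (lbar k s) {poly K}
  (fun y => @coefficient_form s y) _ _ _ r q M0 f x r2 q2 fx xM.
- move=> v c y y'; pose N := maxn (size (c *: y + y')) (maxn (size y) (size y')).
  change (coefficient_form (c *: y + y') v = c *: coefficient_form y v + coefficient_form y' v).
  rewrite !(@coefficient_formE _ _ _ N) ?leq_max ?leqnn ?orbT// scaler_sumr -big_split.
  by apply: eq_bigr => i _; rewrite coefD coefZ mulrDl -mulrA.
- move=> y; exists (\sum_(i < size y) rnorm (y`_i)).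
    by apply: sumr_ge0 => *; exact: rnorm_ge0.
  move=> v; rewrite mulr_suml; apply: le_trans (rnorm_sum _ _ _) _.
  by apply: ler_sum => i _; rewrite rnormM ler_wpM2l ?rnorm_ge0// rnorm_coord.
- move=> v y0; apply: lbarP => n; have := y0 'X^n; rewrite -[X in X = _]/(coefficient_form 'X^n v).
  rewrite (@coefficient_formE _ _ _ n.+1) ?size_polyXn// (bigD1 ord_max)//= coefXn eqxx mul1r.
  by rewrite big1 ?addr0// => i /negbTE; rewrite coefXn -val_eqE/= => ->; rewrite mul0r.
by exists z => // _ [u /ballE u1 <-]; exact: zT.
Qed.

(** The 2-hull obtained from [q > 2] is [p]-compact for [p >= 2] by monotonicity, and for every
    [p >= 1] when [s >= 2], because it is then 1-compact. *)
Lemma operators_setD0 r s (p q : R) : 1 <= p -> p < q -> (2%:E <= r)%E -> 2 < q ->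
  2 <= p \/ (2%:E <= s)%E ->
  p_compact_operators (lbar k r) (lbar k s) q `\`
    p_compact_operators (lbar k r) (lbar k s) p = set0.
Proof.
move=> p1 pq r2 q2 ps; apply/seteqP; split => // T [Tq]; apply.
have [TL Tc _] := Tq; have [z Tz [B zB]] := operator_range_hull2 r2 q2 Tq.
split => //; apply: p_compact_sub Tz _; case: ps => [p2|s2].
  apply: (p_compact_mono _ p2); first by rewrite ler1n.
  exists z; apply/p_coverP; split => //; exists B => N; apply: le_trans (zB N).
  by apply: ler_sum => m _; rewrite -powR_mulrn ?rnorm_ge0.
by apply: (p_compact_mono _ p1) => //; exact: p_hull2_p_compact1 zB.
Qed.

End operators.

Lemma spaceable_sub (R : realType) (k : scalar_kind) (S : normedModType (scalar_field R k))
    (V : lmodType (scalar_field R k)) (N : V -> \bar R) (A B : set V) :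
  A `<=` B -> spaceable S N A -> spaceable S N B.
Proof.
move=> AB [phi phiA H]; exists phi => // a.
by have [/AB|] := phiA a; [left|right].
Qed.

Theorem proposition4p6 (R : realType) (k : scalar_kind) (p q : R)
    (r s : exponent R) (E : completeNormedModType (scalar_field R k)) :
  1 <= p -> p < q -> (2%:E <= r)%E ->
  ((1 <= s)%E -> (s <= 2%:E)%E -> 2 <= p ->
    [/\ p_compact_operators (lbar k r) (lbar k s) q `\`
          p_compact_operators (lbar k r) (lbar k s) p = set0,
        infinite_dimensional E -> forall d : nat, (2 <= d)%N ->
          spaceable (lbar k s) (polynomial_norm q)
            (p_compact_polynomials E (lbar k s) q d `\`
             p_compact_polynomials E (lbar k s) p d) &
        (exists x : E, x != 0) ->
          spaceable (lbar k s) (lipschitz_norm q)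
            (p_compact_lipschitz E (lbar k s) q `\`
             p_compact_lipschitz E (lbar k s) p)]) /\
  ((2%:E <= s)%E -> 2 < q ->
    [/\ p_compact_operators (lbar k r) (lbar k s) q `\`
          p_compact_operators (lbar k r) (lbar k s) p = set0,
        infinite_dimensional E -> forall d : nat, (2 <= d)%N ->
          spaceable (lbar k s) (polynomial_norm q)
            (p_compact_polynomials E (lbar k s) q d `\`
             p_compact_polynomials E (lbar k s) p d) &
        (exists x : E, x != 0) ->
          spaceable (lbar k s) (lipschitz_norm q)
            (p_compact_lipschitz E (lbar k s) q `\`
             p_compact_lipschitz E (lbar k s) p)]).
Proof.
move=> p1 pq r2.
have spaceP : 2 < q ->
    (infinite_dimensional E -> forall d : nat, (2 <= d)%N ->
      spaceable (lbar k s) (polynomial_norm q)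
        (p_compact_polynomials E (lbar k s) q d `\` p_compact_polynomials E (lbar k s) p d)) /\
    ((exists x : E, x != 0) ->
      spaceable (lbar k s) (lipschitz_norm q)
        (p_compact_lipschitz E (lbar k s) q `\` p_compact_lipschitz E (lbar k s) p)).
  move=> q2; pose m := Num.max p 2.
  have m2 : 2 <= m by rewrite le_max lexx orbT.
  have pm : p <= m by rewrite le_max lexx.
  have mq : m < q by rewrite gt_max pq.
  split=> [Einf d d2|E0].
    apply: spaceable_sub (polynomial_spaceable s m2 mq Einf d2) => P [Pq Pm]; split=> // -[hP Pp].
    by apply: Pm; split => //; exact: p_compact_mono pm Pp.
  apply: spaceable_sub (lipschitz_spaceable s m2 mq E0) => f [fq fm]; split=> // -[lf f0 fp].
  by apply: fm; split => //; exact: p_compact_mono pm fp.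
split=> [_ _ p2|s2 q2].
  have q2 : 2 < q by exact: le_lt_trans pq.
  have [polyP lipP] := spaceP q2; split => //.
  by apply: operators_setD0 => //; left.
have [polyP lipP] := spaceP q2; split => //.
by apply: operators_setD0 => //; right.
Qed.
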